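(* Let $K \subset \mathbb{C}$ be a convex polygon with corners $\omega_1, \dots, \omega_k$, and let $f$ be an analytic function in $K$ that is analytic on the interior of each side segment and can be analytically continued to a disc near each $\omega_i$ with a slit along the exterior bisector there. Assume that for some $\delta > 0$, $f$ satisfies $f(z) - f(\omega_i) = O(|z - \omega_i|^{\delta})$ as $z \to \omega_i$, for each $i$. Then there exist rational functions $\{r_n\}$, with $r_n$ of degree $n$, $1 \le n < \infty$, satisfying $$\|f - r_n\|_K = O(e^{-C\sqrt{n}}) \quad (n\to\infty)$$ for some $C > 0$, and such that for every compact subset $E \subset \operatorname{Int} K$ there is a constant $c = c(E) > 0$, independent of $n$, with $$\limsup_{n \to \infty} \|f - r_n\|_E\, e^{cn} = 0.$$
   Context: $\|\cdot\|_X$ is the supremum norm over $X$ and $\operatorname{Int} K$ is the interior of $K$. The polygon $K$ is the closed polygonal region with nonempty interior. The hypotheses on $f$ mean: $f$ is continuous on $K$, analytic in $\operatorname{Int} K$, extends analytically to a neighbourhood of each point of each open side of $K$, and for each corner $\omega_i$ there is $\rho_i>0$ such that $f$ extends analytically to the slit disc $\{z: |z-\omega_i|<\rho_i\} \setminus \ell_i$, where $\ell_i$ is the closed ray from $\omega_i$ pointing out of $K$ that bisects the exterior angle of $K$ at $\omega_i$. The condition $f(z)-f(\omega_i)=O(|z-\omega_i|^\delta)$ is for $z \to \omega_i$ in this slit disc (for the continued $f$). A rational function of degree $n$ is a quotient of two polynomials each of degree at most $n$. *)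

(* Defs.v *)
From Stdlib Require Export Reals List.
From Coquelicot Require Export Coquelicot.

Open Scope R_scope.

(* The complex plane is Coquelicot's [C].  "Analytic" means complex
   differentiable at every point of an open set: [ex_derive] is taken over the
   field [C_AbsRing]. *)
Definition analytic_on (U : C -> Prop) (g : C -> C) : Prop :=
  forall z, U z -> @ex_derive C_AbsRing C_NormedModule g z.

(* Coquelicot's [ball] on [C] is a square; this is the round disc. *)
Definition disc (c : C) (rho : R) (z : C) : Prop := Cmod (z - c) < rho.

Definition interior (X : C -> Prop) (z : C) : Prop := locally z X.

Definition compact_set (E : C -> Prop) : Prop :=
  forall (I : Type) (U : I -> C -> Prop),
    (forall i, open (U i)) ->
    (forall z, E z -> exists i, U i z) ->
    exists l : list I, forall z, E z -> exists i, In i l /\ U i z.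

(* The corners are [w 0, ..., w (k-1)], indexed cyclically. *)
Definition next (k i : nat) : nat := (S i mod k)%nat.
Definition prev (k i : nat) : nat := ((i + pred k) mod k)%nat.

(* The z-component of the cross product of two plane vectors. *)
Definition cross (u v : C) : R := Im (Cconj u * v).

(* The corners are listed counterclockwise, without degenerate (straight)
   corners: each corner other than the endpoints of a side lies strictly to the
   left of that side.  In particular the corners are pairwise distinct and are
   the extreme points of their convex hull, which has nonempty interior. *)
Definition convex_polygon (k : nat) (w : nat -> C) : Prop :=
  (3 <= k)%nat /\
  forall i j, (i < k)%nat -> (j < k)%nat -> j <> i -> j <> next k i ->
    0 < cross (w (next k i) - w i) (w j - w i).

(* The closed polygonal region: the convex hull of the corners.  [sum_n] is
   inclusive, so the sums run over 0, ..., k-1. *)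
Definition region (k : nat) (w : nat -> C) (z : C) : Prop :=
  exists t : nat -> R,
    (forall j, 0 <= t j) /\
    sum_n t (pred k) = 1 /\
    z = sum_n (fun j => RtoC (t j) * w j)%C (pred k).

Definition open_side (k : nat) (w : nat -> C) (i : nat) (z : C) : Prop :=
  exists t : R, 0 < t < 1 /\
    z = (RtoC (1 - t) * w i + RtoC t * w (next k i))%C.

Definition direction (a b : C) : C := ((b - a) / RtoC (Cmod (b - a)))%C.

(* The sum of the unit vectors along the two sides at [w i] bisects the interior
   angle (which is less than pi, so the sum is nonzero); its opposite bisects
   the exterior angle. *)
Definition exterior_bisector (k : nat) (w : nat -> C) (i : nat) (z : C) : Prop :=
  exists t : R, 0 <= t /\
    z = (w i - RtoC t * (direction (w i) (w (next k i))
                         + direction (w i) (w (prev k i))))%C.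

Definition slit_disc (k : nat) (w : nat -> C) (i : nat) (rho : R) (z : C) : Prop :=
  disc (w i) rho z /\ ~ exterior_bisector k w i z.

(* [g] is an analytic continuation to [U] of the function [f] on [K]. *)
Definition continues (K : C -> Prop) (f : C -> C) (U : C -> Prop) (g : C -> C) : Prop :=
  analytic_on U g /\ (forall z, U z -> K z -> g z = f z).

(* u = O(v) along the filter [F]; [u] may take infinite values. *)
Definition big_O {T : Type} (F : (T -> Prop) -> Prop) (u : T -> Rbar) (v : T -> R) : Prop :=
  exists M : R, F (fun x => Rbar_le (Rbar_abs (u x)) (Finite (M * Rabs (v x)))).

(* The supremum over [X] of |g|, possibly infinite.  The value 0 is included so
   that the norm over the empty set is 0 rather than -oo. *)
Definition sup_norm (X : C -> Prop) (g : C -> C) : Rbar :=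
  Lub_Rbar (fun y => y = 0 \/ exists z, X z /\ y = Cmod (g z)).

(* Superior limit of a sequence of extended reals; for real sequences it is
   [LimSup_seq], by [LimSup_InfSup_seq]. *)
Definition Rbar_limsup (u : nat -> Rbar) : Rbar :=
  Inf_seq (fun m => Sup_seq (fun n => u (n + m)%nat)).

Definition poly_eval (a : nat -> C) (n : nat) (z : C) : C :=
  sum_n (fun j => a j * Cpow z j)%C n.

(* [r] is a rational function of degree [n], i.e. a quotient of two polynomials
   of degree at most [n].  Values of [r] at its poles are meaningless since
   division in [C] is total, so the denominator must not vanish on the set [X]
   where [r] is to be used; in particular it is not the zero polynomial as soon
   as [X] is nonempty. *)
Definition rational_on (X : C -> Prop) (n : nat) (r : C -> C) : Prop :=
  exists a b : nat -> C,
    (forall z, X z -> poly_eval b n z <> RtoC 0) /\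
    (forall z, r z = poly_eval a n z / poly_eval b n z)%C.

(* Main.v *)
Require Import Defs.
From Stdlib Require Import Lra Lia Psatz ClassicalEpsilon FunctionalExtensionality.

(** Let [p] be a polynomial interpolating [f] at finitely many points ("nodes")
    of the boundary, the corners included.  Inside [K], [f - p] is up to the
    constant factor [W = \int dt/(t-z)] the Cauchy integral of [f - p] over the
    boundary.  Each short piece [[a,b]] of a side, with nodes [a] and [b], is
    deformed into the two segments [[a,q]], [[q,b]] of a small tent outside [K],
    on which [f] continues analytically: acute tents at a corner avoid the slit.
    As [f - p = O(|t-a|^delta)] at the foot [a] of a leg, everything reduces to
    Cauchy integrals over a segment leaving the half plane [Re z <= 0] at [0].

    For these, [1/(t-z)] is replaced by [(1 - B(z)/B(t))/(t-z)], which is rational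
    in [z], where [B(z) = \prod_b (z+b)/(z-b)], [b > 0].  Here [|B| <= 1] on the half
    plane and [1/|B| <= 1] on the segment.  Taking [b = 2^-l], [l < m], each [m]
    times makes [1/|B(t)|] geometrically small in [m] for [|t| >= 2^-m], the rest of
    the integral being [O(2^(-m delta))]; taking moreover [b = 1] [m^2] times makes
    [|B|] at most [exp (- c m^2)] on compact subsets of the open half plane.  The
    degree is [2 m^2]. *)

(** On the line carrying a side |B| is 1, so the new kernel gains nothing there; this is why the
    path must leave the polygon and [f] has to be continued. A Cauchy integral over a segment has a
    logarithmic singularity at each end where its density does not vanish, so cutting the boundary
    would create new singularities. Subtracting [p] removes them and puts corners and other nodes on
    the same footing. With density O(u^dl) and |t-z| >= u the integrand is O(u^(dl-1)): half of dl
    keeps it integrable, the other half yields decay near the foot. The legs make 45 degrees with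
    the side, which keeps |t-b|/|t+b| below a fixed constant under 1 for t at the scale of b, while
    the slit makes more than 90 degrees with both sides at its corner. The pieces must be short
    because the radii of continuation are only local; compactness of the side gives one length for
    all. W is shown to be a nonzero constant from its derivative and the sign of its imaginary part,
    which avoids logarithms and arguments. *)

Local Notation CR := C_R_CompleteNormedModule.

Implicit Types (F G : C -> C) (z : C) (i m n : nat) (bs : list R).

(** * Limits, continuity and complex differentiability in terms of the modulus *)

Definition Cloc z : (C -> Prop) -> Prop := @locally C_UniformSpace z.
Definition Ceq_dec (a b : C) : {a = b} + {a <> b} := excluded_middle_informative (a = b).
Definition unit_itv (u : R) : Prop := 0 <= u <= 1.

Lemma Cmod_sub_self z : Cmod (z - z) = 0.
Proof. replace (z - z)%C with (RtoC 0) by ring. apply Cmod_0. Qed.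

(** Balls in [C] are squares; halving the radius absorbs the factor sqrt 2 between a square and the
    round disc. *)
Lemma locally_Cmod z (P : C -> Prop) :
  Cloc z P <-> exists eta, 0 < eta /\ forall t, Cmod (t - z) < eta -> P t.
Proof.
  split.
  - intros [e He]. exists e. split; [apply cond_pos|].
    intros t Ht. apply He. apply C_NormedModule_mixin_compat1. exact Ht.
  - intros [eta [He H]].
    assert (Hp : 0 < eta / 2) by lra.
    exists (mkposreal _ Hp). intros t Ht. apply H.
    assert (Ht2 : Cmod (minus t z) < sqrt 2 * (eta / 2))
      by exact (C_NormedModule_mixin_compat2 z t (mkposreal _ Hp) Ht).
    change (minus t z) with (t - z)%C in Ht2.
    assert (sqrt 2 < 2).
    { rewrite <- (sqrt_Rsqr 2) at 2 by lra. apply sqrt_lt_1_alt. unfold Rsqr. lra. }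
    nra.
Qed.

#[local] Instance Cloc_filter z : @Filter C (Cloc z).
Proof. apply (filter_filter (F := @locally C_UniformSpace z)). Qed.

#[local] Instance within_Cloc_filter (S : C -> Prop) z : @Filter C (within S (Cloc z)).
Proof. apply within_filter, Cloc_filter. Qed.

#[local] Instance within_R_filter (S : R -> Prop) (u : R) : @Filter R (within S (locally u)).
Proof. apply within_filter, filter_filter. Qed.

(** The filter property is bundled in, so that most combination lemmas below need no separate
    [Filter] argument. *)
Definition clim {T : Type} (Fl : (T -> Prop) -> Prop) (F : T -> C) (l : C) : Prop :=
  Filter Fl /\ forall eps, 0 < eps -> Fl (fun s => Cmod (F s - l) < eps).

Lemma clim_eq {T} (Fl : (T -> Prop) -> Prop) (F : T -> C) (l m : C) :
  l = m -> clim Fl F l -> clim Fl F m.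
Proof. intros <-. auto. Qed.

Lemma clim_const {T} (Fl : (T -> Prop) -> Prop) (c : C) :
  Filter Fl -> clim Fl (fun _ => c) c.
Proof.
  intros HF. split; [exact HF|]. intros eps He. apply filter_forall. intros _.
  rewrite Cmod_sub_self. exact He.
Qed.

Lemma clim_ext {T} (Fl : (T -> Prop) -> Prop) (F G : T -> C) (l : C) :
  Fl (fun s => F s = G s) -> clim Fl F l -> clim Fl G l.
Proof.
  intros H1 [HF H2]. split; [exact HF|]. intros eps He. generalize (filter_and _ _ H1 (H2 eps He)).
  apply filter_imp. intros s [E Hs]. rewrite <- E. exact Hs.
Qed.

Lemma clim_plus {T} (Fl : (T -> Prop) -> Prop) (F G : T -> C) (l m : C) :
  clim Fl F l -> clim Fl G m -> clim Fl (fun s => F s + G s)%C (l + m)%C.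
Proof.
  intros [HF H1] [_ H2]. split; [exact HF|]. intros eps He.
  assert (He2 : 0 < eps / 2) by lra.
  generalize (filter_and _ _ (H1 _ He2) (H2 _ He2)).
  apply filter_imp. intros s [A B].
  replace (F s + G s - (l + m))%C with ((F s - l) + (G s - m))%C by ring.
  eapply Rle_lt_trans; [apply Cmod_triangle|]. lra.
Qed.

Lemma clim_bounded {T} (Fl : (T -> Prop) -> Prop) (F : T -> C) (l : C) :
  clim Fl F l -> Fl (fun s => Cmod (F s) <= Cmod l + 1).
Proof.
  intros [HF H]. generalize (H 1 Rlt_0_1). apply filter_imp. intros s Hs.
  replace (F s) with ((F s - l) + l)%C by ring.
  eapply Rle_trans; [apply Cmod_triangle|]. lra.
Qed.

Lemma clim_mult {T} (Fl : (T -> Prop) -> Prop) (F G : T -> C) (l m : C) :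
  clim Fl F l -> clim Fl G m -> clim Fl (fun s => F s * G s)%C (l * m)%C.
Proof.
  intros H1 [HF H2]. split; [exact HF|]. intros eps He.
  pose proof (clim_bounded Fl F l H1) as Hb0. destruct H1 as [_ H1].
  pose proof (Cmod_ge_0 l) as Hl. pose proof (Cmod_ge_0 m) as Hm.
  set (K := Cmod l + Cmod m + 1).
  assert (HK : 0 < K) by (unfold K; lra).
  assert (He2 : 0 < eps / (2 * K)) by (apply Rdiv_lt_0_compat; lra).
  generalize (filter_and _ _ Hb0 (filter_and _ _ (H1 _ He2) (H2 _ He2))).
  apply filter_imp. intros s [Hb [A B]].
  replace (F s * G s - l * m)%C with (F s * (G s - m) + (F s - l) * m)%C by ring.
  eapply Rle_lt_trans; [apply Cmod_triangle|]. rewrite !Cmod_mult.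
  assert (E : eps = K * (eps / (2 * K)) + K * (eps / (2 * K))) by (field; lra).
  rewrite E.
  pose proof (Cmod_ge_0 (G s - m)). pose proof (Cmod_ge_0 (F s - l)). pose proof (Cmod_ge_0 (F s)).
  apply Rplus_le_lt_compat.
  - apply Rmult_le_compat; try lra. unfold K; lra.
  - rewrite (Rmult_comm K). apply Rle_lt_trans with (eps / (2*K) * Cmod m).
    + apply Rmult_le_compat_r; lra.
    + apply Rmult_lt_compat_l; [lra|]. unfold K; lra.
Qed.

Lemma clim_inv {T} (Fl : (T -> Prop) -> Prop) (F : T -> C) (l : C) :
  l <> RtoC 0 -> clim Fl F l -> clim Fl (fun s => / F s)%C (/ l)%C.
Proof.
  intros Hl [HF H]. split; [exact HF|]. intros eps He.
  assert (Hp : 0 < Cmod l) by (apply Cmod_gt_0; exact Hl).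
  assert (H1 : 0 < Cmod l / 2) by lra.
  assert (H2 : 0 < eps * (Cmod l * Cmod l / 2)) by (apply Rmult_lt_0_compat; nra).
  generalize (filter_and _ _ (H _ H1) (H _ H2)).
  apply filter_imp. intros s [A B].
  assert (C1 : Cmod l / 2 < Cmod (F s)).
  { pose proof (Cmod_triangle (l - F s) (F s)) as Q.
    replace (l - F s + F s)%C with l in Q by ring.
    replace (l - F s)%C with (- (F s - l))%C in Q by ring. rewrite Cmod_opp in Q. lra. }
  assert (N : F s <> RtoC 0) by (apply Cmod_gt_0; lra).
  replace (/ F s - / l)%C with (- ((F s - l) / (F s * l)))%C by (field; split; assumption).
  rewrite Cmod_opp, Cmod_div, Cmod_mult by (apply Cmult_neq_0; assumption).
  apply Rmult_lt_reg_r with (Cmod (F s) * Cmod l); [apply Rmult_lt_0_compat; lra|].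
  unfold Rdiv. rewrite Rmult_assoc, Rinv_l by (apply Rgt_not_eq, Rmult_lt_0_compat; lra).
  rewrite Rmult_1_r. eapply Rlt_le_trans; [exact B|].
  apply Rmult_le_compat_l; nra.
Qed.

Definition ccont (S : C -> Prop) F (t : C) : Prop := clim (within S (Cloc t)) F (F t).

Lemma ccont_spec (S : C -> Prop) F (t : C) :
  ccont S F t <-> forall eps, 0 < eps -> exists eta, 0 < eta /\
    forall s, S s -> Cmod (s - t) < eta -> Cmod (F s - F t) < eps.
Proof.
  split.
  - intros [_ H] eps He. destruct (proj1 (locally_Cmod _ _) (H eps He)) as [eta [A B]].
    exists eta. split; auto.
  - intros H. split; [exact _|]. intros eps He. destruct (H eps He) as [eta [A B]].
    apply locally_Cmod. exists eta. split; auto.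
Qed.

(* Carathéodory's form of complex differentiability. *)
Definition cdiff (f : C -> C) z : Prop :=
  exists phi : C -> C, clim (Cloc z) phi (phi z) /\ forall t, (f t - f z = phi t * (t - z))%C.

Lemma clim_id z : clim (Cloc z) (fun t => t) z.
Proof.
  split; [exact _|]. intros eps He. apply locally_Cmod. exists eps. split; auto.
Qed.

Lemma ex_derive_cdiff (f : C -> C) z :
  @ex_derive C_AbsRing C_NormedModule f z -> cdiff f z.
Proof.
  intros [l [_ Hd]].
  (* The difference quotient, completed by the derivative at [z]. *)
  exists (fun t => if Ceq_dec t z then l else ((f t - f z) / (t - z))%C).
  split.
  - split; [exact _|]. intros eps He.
    assert (Hlim : is_filter_lim (locally (T := AbsRing_UniformSpace C_AbsRing) z) z)
      by (intros P HP; exact HP).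
    assert (He2 : 0 < eps / 2) by lra.
    specialize (Hd z Hlim (mkposreal _ He2)).
    apply locally_C in Hd. revert Hd. apply filter_imp. intros t. change C in (type of t). change C in (type of l). intros Ht. cbv beta.
    change (Cmod (minus (minus (f t) (f z)) (scal (minus t z) l)) <= eps / 2 * Cmod (minus t z)) in Ht.
    change (minus (minus (f t) (f z)) (scal (minus t z) l)) with (f t - f z - (t - z) * l)%C in Ht.
    change (minus t z) with (t - z)%C in Ht.
    destruct (Ceq_dec z z) as [_|n]; [|congruence].
    destruct (Ceq_dec t z) as [e|n].
    + rewrite Cmod_sub_self. exact He.
    + assert (N : (t - z)%C <> RtoC 0) by (intro Q; apply n; rewrite <- (Cplus_0_l z), <- Q; ring).
      assert (0 < Cmod (t - z)) by (apply Cmod_gt_0; exact N).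
      replace ((f t - f z) / (t - z) - l)%C with ((f t - f z - (t - z) * l) / (t - z))%C
        by (field; exact N).
      rewrite Cmod_div by exact N.
      apply Rle_lt_trans with (eps / 2); [|lra].
      apply Rmult_le_reg_r with (Cmod (t - z)); [assumption|].
      unfold Rdiv at 1. rewrite Rmult_assoc, Rinv_l by lra. lra.
  - intros t. destruct (Ceq_dec t z) as [e|n].
    + subst. ring.
    + field. intro Q; apply n; rewrite <- (Cplus_0_l z), <- Q; ring.
Qed.

Lemma cdiff_clim (f : C -> C) z : cdiff f z -> clim (Cloc z) f (f z).
Proof.
  intros [phi [H E]].
  apply (clim_ext (Cloc z) (fun t => f z + phi t * (t + - z))%C).
  - apply filter_forall. intro t. pose proof (E t) as Q.
    replace (f t) with (f z + (f t - f z))%C by ring. rewrite Q. ring.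
  - apply clim_eq with (f z + phi z * (z + - z))%C; [ring|].
    apply clim_plus; [apply clim_const; exact _|]. apply clim_mult; [exact H|].
    apply clim_plus; [apply clim_id|apply clim_const; exact _].
Qed.

Lemma clim_within (S : C -> Prop) z (f : C -> C) (l : C) :
  clim (Cloc z) f l -> clim (within S (Cloc z)) f l.
Proof.
  intros [_ H]. split; [exact _|]. intros eps He.
  generalize (H eps He). unfold within. apply filter_imp. auto.
Qed.

Lemma cdiff_ccont (S : C -> Prop) (f : C -> C) z : cdiff f z -> ccont S f z.
Proof. intros H. apply clim_within, cdiff_clim, H. Qed.

Lemma cdiff_const (c z : C) : cdiff (fun _ => c) z.
Proof.
  exists (fun _ => RtoC 0). split; [apply clim_const; exact _|]. intros; ring.
Qed.

Lemma cdiff_id z : cdiff (fun t => t) z.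
Proof.
  exists (fun _ => RtoC 1). split; [apply clim_const; exact _|]. intros; ring.
Qed.

Lemma cdiff_plus (f g : C -> C) z :
  cdiff f z -> cdiff g z -> cdiff (fun t => f t + g t)%C z.
Proof.
  intros [p [A B]] [q [A' B']]. exists (fun t => p t + q t)%C. split.
  - apply clim_plus; assumption.
  - intro t. replace (f t + g t - (f z + g z))%C with ((f t - f z) + (g t - g z))%C by ring.
    rewrite B, B'. ring.
Qed.

Lemma cdiff_mult (f g : C -> C) z :
  cdiff f z -> cdiff g z -> cdiff (fun t => f t * g t)%C z.
Proof.
  intros [p [A B]] Hg. pose proof (cdiff_clim _ _ Hg) as Hc. destruct Hg as [q [A' B']].
  exists (fun t => p t * g t + f z * q t)%C. split.
  - apply clim_plus; apply clim_mult; auto. apply clim_const; exact _.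
  - intro t.
    replace (f t * g t - f z * g z)%C with ((f t - f z) * g t + f z * (g t - g z))%C by ring.
    rewrite B, B'. ring.
Qed.

Lemma Csub_neq (a b : C) : a <> b -> (a - b)%C <> RtoC 0.
Proof. intros H Q. apply H. rewrite <- (Cplus_0_l b), <- Q. ring. Qed.

(** The factorization in [cdiff] is required at every point, not only near [z], so away from [z] the
    slope function is rebuilt as the difference quotient of [g]. *)
Lemma cdiff_ext_loc (f g : C -> C) z :
  Cloc z (fun t => f t = g t) -> cdiff f z -> cdiff g z.
Proof.
  intros HE [p [A B]].
  assert (Ez : f z = g z) by exact (locally_singleton _ _ HE).
  exists (fun t => if Ceq_dec t z then p z else ((g t - g z) / (t - z))%C).
  split.
  - destruct (Ceq_dec z z) as [_|n]; [|congruence].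
    apply (clim_ext (Cloc z) p); [|exact A].
    generalize HE. apply filter_imp. intros t Ht.
    destruct (Ceq_dec t z) as [e|n]; [now subst|].
    rewrite <- Ht, <- Ez, B. field. apply Csub_neq, n.
  - intros t. destruct (Ceq_dec t z) as [e|n]; [subst; ring|].
    field. apply Csub_neq, n.
Qed.

Lemma cdiff_inv_sub (c z : C) : z <> c -> cdiff (fun t => / (t - c))%C z.
Proof.
  intros H. apply Csub_neq in H.
  (* The identity 1/(t-c) = 1/(z-c) - (t-z)/((z-c)(t-c)) needs t <> c. The guard for t = c changes
     values away from [z] only, which [cdiff_ext_loc] ignores. *)
  apply cdiff_ext_loc with
    (fun t => / (z - c) + (- / (z - c) * (if Ceq_dec t c then RtoC 0 else / (t - c))) * (t - z))%C.
  - apply locally_Cmod. exists (Cmod (z - c)). split; [apply Cmod_gt_0; exact H|].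
    intros t Ht. destruct (Ceq_dec t c) as [e|n].
    + subst. replace (c - z)%C with (- (z - c))%C in Ht by ring. rewrite Cmod_opp in Ht. lra.
    + field. split; [apply Csub_neq, n|exact H].
  - exists (fun t => (- / (z - c) * (if Ceq_dec t c then RtoC 0 else / (t - c))))%C.
    split; [|intro t; ring].
    apply clim_mult; [apply clim_const; exact _|].
    destruct (Ceq_dec z c) as [e|n].
    { exfalso; apply H; subst; ring. }
    apply (clim_ext (Cloc z) (fun t => / (t + - c))%C).
    + apply locally_Cmod. exists (Cmod (z - c)). split; [apply Cmod_gt_0; exact H|].
      intros t Ht. destruct (Ceq_dec t c) as [e|n']; [|reflexivity].
      subst. replace (c - z)%C with (- (z - c))%C in Ht by ring. rewrite Cmod_opp in Ht. lra.
    + apply clim_inv; [exact H|]. apply clim_plus; [apply clim_id|apply clim_const; exact _].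
Qed.

(** * Integrals over segments *)

(** The [u] refers to the unit interval, not to uniformity; continuity is one-sided at the two
    ends. *)
Definition ucont (phi : R -> C) : Prop :=
  forall u, unit_itv u -> clim (within unit_itv (locally u)) phi (phi u).

Lemma ucont_spec (phi : R -> C) :
  ucont phi <-> forall u, unit_itv u -> forall eps, 0 < eps -> exists eta, 0 < eta /\
    forall v, unit_itv v -> Rabs (v - u) < eta -> Cmod (phi v - phi u) < eps.
Proof.
  split.
  - intros H u Hu eps He. destruct (proj2 (H u Hu) eps He) as [d Hd].
    exists d. split; [apply cond_pos|]. intros v Hv Hvu. apply Hd; auto.
  - intros H u Hu. split; [exact _|]. intros eps He. destruct (H u Hu eps He) as [d [Hd1 Hd]].
    exists (mkposreal _ Hd1). intros v Hvu Hv. apply Hd; auto.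
Qed.

Definition Cint (phi : R -> C) : C := RInt (V := CR) phi 0 1.
Definition ex_Cint (phi : R -> C) (a b : R) : Prop := ex_RInt (V := CR) phi a b.

(** Composing with [clamp] extends a path on the unit interval to a continuous one on the line, as
    the integrability criterion asks for two-sided continuity. *)
Definition clamp (u : R) : R := Rmax 0 (Rmin 1 u).

Lemma clamp_unit (u : R) : unit_itv (clamp u).
Proof.
  unfold clamp, unit_itv, Rmax, Rmin. repeat destruct Rle_dec; lra.
Qed.

Lemma clamp_id (u : R) : unit_itv u -> clamp u = u.
Proof.
  unfold clamp, unit_itv, Rmax, Rmin. repeat destruct Rle_dec; lra.
Qed.

Lemma clamp_lip (u v : R) : Rabs (clamp u - clamp v) <= Rabs (u - v).
Proof.
  unfold clamp, Rmax, Rmin, Rabs. repeat destruct Rle_dec; repeat destruct Rcase_abs; lra.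
Qed.

Lemma ucont_ex_Cint_sub (phi : R -> C) (a b : R) :
  ucont phi -> unit_itv a -> unit_itv b -> ex_Cint phi a b.
Proof.
  intros H Ha Hb.
  apply (ex_RInt_ext (V := CR) (fun u => phi (clamp u))).
  - intros u Hu. rewrite clamp_id; [reflexivity|].
    unfold unit_itv, Rmin, Rmax in *; destruct Rle_dec; lra.
  - apply (ex_RInt_continuous (V := CR)). intros z _ P [eps HP].
    destruct (proj1 (ucont_spec phi) H (clamp z) (clamp_unit z) eps (cond_pos eps)) as [eta [He1 He2]].
    exists (mkposreal _ He1). intros v Hv. apply HP.
    apply C_NormedModule_mixin_compat1. apply He2; [apply clamp_unit|].
    eapply Rle_lt_trans; [apply clamp_lip|exact Hv].
Qed.

Lemma ucont_ex_Cint (phi : R -> C) : ucont phi -> ex_Cint phi 0 1.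
Proof. intros H. apply ucont_ex_Cint_sub; auto; unfold unit_itv; lra. Qed.

Lemma Cint_ext (phi psi : R -> C) :
  (forall u, 0 < u < 1 -> phi u = psi u) -> Cint phi = Cint psi.
Proof.
  intros H. apply (RInt_ext (V := CR)). intros u. rewrite Rmin_left, Rmax_right by lra. apply H.
Qed.

Lemma Cint_plus (phi psi : R -> C) : ucont phi -> ucont psi ->
  Cint (fun u => phi u + psi u)%C = (Cint phi + Cint psi)%C.
Proof.
  intros H1 H2. apply (RInt_plus (V := CR)); apply ucont_ex_Cint; assumption.
Qed.

(** Scaling in the real module structure covers real factors only; a complex factor is treated
    through real and imaginary parts. *)
Lemma is_Cint_scal (c : C) (phi : R -> C) (a b : R) (l : C) :
  is_RInt (V := C_R_NormedModule) phi a b l ->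
  is_RInt (V := C_R_NormedModule) (fun u => c * phi u)%C a b (c * l)%C.
Proof.
  intros H.
  pose proof (is_RInt_fct_extend_fst (U := R_NormedModule) (V := R_NormedModule) phi a b l H) as H1.
  pose proof (is_RInt_fct_extend_snd (U := R_NormedModule) (V := R_NormedModule) phi a b l H) as H2.
  apply (is_RInt_fct_extend_pair (U := R_NormedModule) (V := R_NormedModule)
           (fun u => c * phi u)%C a b (fst (c * l)%C) (snd (c * l)%C)).
  - apply (is_RInt_minus (V := R_NormedModule)); apply (is_RInt_scal (V := R_NormedModule)); assumption.
  - apply (is_RInt_plus (V := R_NormedModule)); [apply (is_RInt_scal (V := R_NormedModule)); exact H2|].
    apply (is_RInt_scal (V := R_NormedModule)); exact H1.
Qed.

Lemma Cint_scal (c : C) (phi : R -> C) : ucont phi ->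
  Cint (fun u => c * phi u)%C = (c * Cint phi)%C.
Proof.
  intros H. apply (is_RInt_unique (V := CR)). apply is_Cint_scal.
  apply (RInt_correct (V := CR)), ucont_ex_Cint, H.
Qed.

Lemma Cint_bound (phi : R -> C) (M : R) : ucont phi ->
  (forall u, unit_itv u -> Cmod (phi u) <= M) -> Cmod (Cint phi) <= M.
Proof.
  intros H HM. rewrite Cmod_norm.
  replace M with ((1 - 0) * M) by ring.
  apply (norm_RInt_le_const (V := C_R_NormedModule) phi 0 1 (Cint phi) M); [lra| |].
  - intros u Hu. eapply Rle_trans; [|apply (HM u Hu)]. rewrite Cmod_norm. apply Rle_refl.
  - apply (RInt_correct (V := CR)), ucont_ex_Cint, H.
Qed.

Lemma ucont_plus (phi psi : R -> C) : ucont phi -> ucont psi -> ucont (fun u => phi u + psi u)%C.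
Proof. intros H1 H2 u Hu. apply clim_plus; auto. Qed.

Lemma ucont_mult (phi psi : R -> C) : ucont phi -> ucont psi -> ucont (fun u => phi u * psi u)%C.
Proof. intros H1 H2 u Hu. apply clim_mult; auto. Qed.

Lemma ucont_inv (phi : R -> C) : ucont phi -> (forall u, unit_itv u -> phi u <> RtoC 0) ->
  ucont (fun u => / phi u)%C.
Proof. intros H1 H2 u Hu. apply clim_inv; auto. Qed.

Lemma ucont_const (c : C) : ucont (fun _ => c).
Proof. intros u Hu. apply clim_const; exact _. Qed.

Lemma ucont_scal (c : C) (phi : R -> C) : ucont phi -> ucont (fun u => c * phi u)%C.
Proof. apply ucont_mult, ucont_const. Qed.

Lemma ucont_RtoC : ucont RtoC.
Proof.
  apply ucont_spec. intros u Hu eps He. exists eps. split; auto. intros v _ Hv.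
  rewrite <- RtoC_minus, Cmod_R. exact Hv.
Qed.

Lemma ucont_ext (phi psi : R -> C) : (forall u, unit_itv u -> phi u = psi u) -> ucont phi -> ucont psi.
Proof.
  intros E H. apply ucont_spec. intros u Hu eps He.
  destruct (proj1 (ucont_spec phi) H u Hu eps He) as [eta [A B]].
  exists eta. split; auto. intros v Hv Hvu. rewrite <- !E by assumption. auto.
Qed.

Definition seg (a b : C) (u : R) : C := (a + RtoC u * (b - a))%C.

Lemma seg_sub (a b : C) (u v : R) : (seg a b u - seg a b v = RtoC (u - v) * (b - a))%C.
Proof. unfold seg. rewrite RtoC_minus. ring. Qed.

Lemma seg_0 (a b : C) : seg a b 0 = a.
Proof. unfold seg. ring. Qed.

Lemma seg_1 (a b : C) : seg a b 1 = b.
Proof. unfold seg. ring. Qed.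

Lemma ucont_seg (a b : C) : ucont (seg a b).
Proof.
  apply ucont_plus; [apply ucont_const|]. apply ucont_mult; [apply ucont_RtoC|apply ucont_const].
Qed.

Lemma ucont_comp (S : C -> Prop) F (p : R -> C) :
  ucont p -> (forall u, unit_itv u -> S (p u)) -> (forall t, S t -> ccont S F t) ->
  ucont (fun u => F (p u)).
Proof.
  intros Hp HS HF. apply ucont_spec. intros u Hu eps He.
  destruct (proj1 (ccont_spec _ _ _) (HF _ (HS u Hu)) eps He) as [eta [A B]].
  destruct (proj1 (ucont_spec p) Hp u Hu eta A) as [d [D1 D2]].
  exists d. split; auto.
Qed.

Definition SI F (a b : C) : C := ((b - a) * Cint (fun u => F (seg a b u)))%C.
Definition segcont F (a b : C) : Prop := ucont (fun u => F (seg a b u)).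

Lemma SI_plus F G (a b : C) : segcont F a b -> segcont G a b ->
  SI (fun t => F t + G t)%C a b = (SI F a b + SI G a b)%C.
Proof. intros. unfold SI. rewrite Cint_plus by assumption. ring. Qed.

Lemma SI_scal (c : C) F (a b : C) : segcont F a b ->
  SI (fun t => c * F t)%C a b = (c * SI F a b)%C.
Proof. intros. unfold SI. rewrite Cint_scal by assumption. ring. Qed.

Lemma SI_ext F G (a b : C) : (forall u, 0 < u < 1 -> F (seg a b u) = G (seg a b u)) ->
  SI F a b = SI G a b.
Proof. intros H. unfold SI. f_equal. apply Cint_ext, H. Qed.

Lemma SI_bound F (a b : C) (M : R) : segcont F a b ->
  (forall u, unit_itv u -> Cmod (F (seg a b u)) <= M) -> Cmod (SI F a b) <= Cmod (b - a) * M.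
Proof.
  intros H HM. unfold SI. rewrite Cmod_mult. apply Rmult_le_compat_l; [apply Cmod_ge_0|].
  apply Cint_bound; assumption.
Qed.

(** No order between [s] and [r] is assumed, so that reversed subsegments are covered; [SI_rev] and
    [Cint_id] rely on this. *)
Lemma Cint_affine (phi : R -> C) (s r : R) : ucont phi -> unit_itv s -> unit_itv r ->
  (RtoC (r - s) * Cint (fun u => phi (s + u * (r - s))%R))%C
  = RInt (V := CR) phi s r.
Proof.
  intros H Hs Hr.
  pose proof (RInt_comp_lin (V := CR) phi (r - s) s 0 1) as E.
  replace ((r - s) * 0 + s) with s in E by ring.
  replace ((r - s) * 1 + s) with r in E by ring.
  rewrite <- E by (apply ucont_ex_Cint_sub; assumption).
  rewrite <- Cint_scal.
  - apply Cint_ext. intros u Hu.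
    replace ((r - s) * u + s) with (s + u * (r - s)) by ring.
    symmetry. exact (scal_R_Cmult (r - s) (phi (s + u * (r - s)))).
  - apply ucont_spec. intros u Hu eps He.
    assert (Hin : forall v, unit_itv v -> unit_itv (s + v * (r - s)))
      by (intros v Hv; unfold unit_itv in *; nra).
    destruct (proj1 (ucont_spec phi) H _ (Hin u Hu) eps He) as [eta [A B]].
    exists eta. split; [exact A|]. intros v Hv Hvu. apply B; [auto|].
    replace (s + v * (r - s) - (s + u * (r - s))) with ((r - s) * (v - u)) by ring.
    rewrite Rabs_mult.
    assert (Rabs (r - s) <= 1) by (unfold unit_itv in *; apply Rabs_le; lra).
    pose proof (Rabs_pos (v - u)). pose proof (Rabs_pos (r - s)). nra.
Qed.

Lemma SI_subseg F (a b : C) (s r : R) : segcont F a b -> unit_itv s -> unit_itv r ->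
  SI F (seg a b s) (seg a b r)
  = ((b - a) * RInt (V := CR) (fun u => F (seg a b u)) s r)%C.
Proof.
  intros H Hs Hr. unfold SI. rewrite seg_sub.
  rewrite <- (Cint_affine (fun u => F (seg a b u))) by assumption.
  replace (fun u => F (seg (seg a b s) (seg a b r) u)) with (fun u => F (seg a b (s + u * (r - s)))).
  - ring.
  - apply functional_extensionality. intro u. f_equal.
    unfold seg. rewrite RtoC_plus, RtoC_mult, RtoC_minus. ring.
Qed.

Lemma SI_Chasles F (a b : C) (s r q : R) : segcont F a b ->
  unit_itv s -> unit_itv r -> unit_itv q ->
  (SI F (seg a b s) (seg a b r) + SI F (seg a b r) (seg a b q) = SI F (seg a b s) (seg a b q))%C.
Proof.
  intros H Hs Hr Hq. rewrite !SI_subseg by assumption.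
  rewrite <- (RInt_Chasles (V := CR) _ s r q)
    by (apply ucont_ex_Cint_sub; assumption).
  change (plus ?x ?y) with (Cplus x y). ring.
Qed.

Lemma SI_split F (a b : C) (s : R) : segcont F a b -> unit_itv s ->
  (SI F a b = SI F a (seg a b s) + SI F (seg a b s) b)%C.
Proof.
  intros H Hs. symmetry.
  pose proof (SI_Chasles F a b 0 s 1 H) as E. rewrite seg_0, seg_1 in E.
  apply E; unfold unit_itv in *; lra.
Qed.

Lemma SI_rev F (a b : C) : segcont F a b -> SI F b a = (- SI F a b)%C.
Proof.
  intros H.
  pose proof (SI_Chasles F a b 0 1 0 H) as E. rewrite seg_0, seg_1 in E.
  assert (E0 : SI F a a = RtoC 0) by (unfold SI; ring).
  rewrite E0 in E.
  assert (E1 : (SI F a b + SI F b a)%C = RtoC 0) by (apply E; unfold unit_itv; lra).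
  rewrite <- (Cplus_0_l (- SI F a b)), <- E1. ring.
Qed.

Lemma RtoC_neq0 (r : R) : r <> 0 -> RtoC r <> RtoC 0.
Proof. intros H E. apply H, RtoC_inj, E. Qed.

(** * Cauchy's theorem for a triangle *)

Definition bary (a b c : C) (x y : R) : C := (a + RtoC x * (b - a) + RtoC y * (c - a))%C.
Definition in_simplex (x y : R) : Prop := 0 <= x /\ 0 <= y /\ x + y <= 1.
Definition triangle (a b c t : C) : Prop := exists x y, in_simplex x y /\ t = bary a b c x y.

Definition TI F (a b c : C) : C := (SI F a b + SI F b c + SI F c a)%C.

Lemma seg_bary (a b c : C) (x y x' y' u : R) :
  seg (bary a b c x y) (bary a b c x' y') u = bary a b c (x + u * (x' - x)) (y + u * (y' - y)).
Proof. unfold seg, bary. rewrite !RtoC_plus, !RtoC_mult, !RtoC_minus. ring. Qed.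

Lemma simplex_convex (x y x' y' u : R) : in_simplex x y -> in_simplex x' y' -> unit_itv u ->
  in_simplex (x + u * (x' - x)) (y + u * (y' - y)).
Proof. unfold in_simplex, unit_itv. intros. repeat split; nra. Qed.

Lemma segcont_of_ccont (S : C -> Prop) F (a b : C) :
  (forall u, unit_itv u -> S (seg a b u)) -> (forall t, S t -> ccont S F t) -> segcont F a b.
Proof. intros H1 H2. apply (ucont_comp S); auto. apply ucont_seg. Qed.

Lemma segcont_simplex F (a b c : C) (x y x' y' : R) :
  (forall t, triangle a b c t -> ccont (triangle a b c) F t) ->
  in_simplex x y -> in_simplex x' y' -> segcont F (bary a b c x y) (bary a b c x' y').
Proof.
  intros H H1 H2. apply (segcont_of_ccont (triangle a b c)); auto.
  intros u Hu. rewrite seg_bary. do 2 eexists. split; [|reflexivity].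
  apply simplex_convex; auto.
Qed.

Lemma seg_bary_half (a b c : C) (x y x' y' X Y : R) :
  X = (x + x') / 2 -> Y = (y + y') / 2 ->
  bary a b c X Y = seg (bary a b c x y) (bary a b c x' y') (1 / 2).
Proof. intros -> ->. rewrite seg_bary. f_equal; field. Qed.

(** The triangle with corner (x, y) and size [s] in affine coordinates. A negative [s] gives the
    inverted triangle, so all four quarters of a subdivision have this form. *)
Definition inside (x y s : R) : Prop :=
  in_simplex x y /\ in_simplex (x + s) y /\ in_simplex x (y + s).

Definition subTI F (a b c : C) (x y s : R) : C :=
  TI F (bary a b c x y) (bary a b c (x + s) y) (bary a b c x (y + s)).

(** Subdivision by the midpoints of the edges. The middle quarter is the inverted one, of size -s/2;
    each inner edge is run in both directions and cancels. *)
Lemma subTI_quarter F (a b c : C) (x y s : R) :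
  (forall t, triangle a b c t -> ccont (triangle a b c) F t) -> inside x y s ->
  (subTI F a b c x y s
   = subTI F a b c x y (s / 2) + subTI F a b c (x + s / 2) y (s / 2)
     + subTI F a b c x (y + s / 2) (s / 2) + subTI F a b c (x + s / 2) (y + s / 2) (- (s / 2)))%C.
Proof.
  intros HF [H1 [H2 H3]]. unfold subTI, TI.
  replace (x + s / 2 + s / 2) with (x + s) by field.
  replace (y + s / 2 + s / 2) with (y + s) by field.
  replace (x + s / 2 + - (s / 2)) with x by ring.
  replace (y + s / 2 + - (s / 2)) with y by ring.
  assert (Hu : unit_itv (1 / 2)) by (unfold unit_itv; lra).
  assert (M1 : in_simplex (x + s / 2) y) by (unfold in_simplex in *; lra).
  assert (M2 : in_simplex x (y + s / 2)) by (unfold in_simplex in *; lra).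
  assert (M3 : in_simplex (x + s / 2) (y + s / 2)) by (unfold in_simplex in *; lra).
  rewrite (SI_split F (bary a b c x y) (bary a b c (x + s) y) (1 / 2)) by (auto; apply segcont_simplex; auto).
  rewrite (SI_split F (bary a b c (x + s) y) (bary a b c x (y + s)) (1 / 2)) by (auto; apply segcont_simplex; auto).
  rewrite (SI_split F (bary a b c x (y + s)) (bary a b c x y) (1 / 2)) by (auto; apply segcont_simplex; auto).
  rewrite <- (seg_bary_half a b c x y (x + s) y (x + s / 2) y) by field.
  rewrite <- (seg_bary_half a b c (x + s) y x (y + s) (x + s / 2) (y + s / 2)) by field.
  rewrite <- (seg_bary_half a b c x (y + s) x y x (y + s / 2)) by field.
  rewrite (SI_rev F (bary a b c (x + s / 2) y) (bary a b c x (y + s / 2))) by (apply segcont_simplex; auto).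
  rewrite (SI_rev F (bary a b c x (y + s / 2)) (bary a b c (x + s / 2) (y + s / 2))) by (apply segcont_simplex; auto).
  rewrite (SI_rev F (bary a b c (x + s / 2) (y + s / 2)) (bary a b c (x + s / 2) y)) by (apply segcont_simplex; auto).
  ring.
Qed.

(** Since |x (n+1) - x n| <= |s (n+1)| = |s n| - |s (n+1)|, the intervals of radius |s n| around x n
    are nested; [X] is the supremum of their left ends. *)
Lemma halving_limit (x s : nat -> R) :
  (forall n, Rabs (s (S n)) = Rabs (s n) / 2) ->
  (forall n, Rabs (x (S n) - x n) <= Rabs (s (S n))) ->
  exists X, forall n, Rabs (X - x n) <= Rabs (s n).
Proof.
  intros Hs Hx.
  assert (A : forall n k, x n - Rabs (s n) <= x (n + k)%nat - Rabs (s (n + k)%nat)).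
  { intros n k. induction k as [|k IH]; [rewrite Nat.add_0_r; lra|].
    rewrite Nat.add_succ_r. specialize (Hs (n + k)%nat). specialize (Hx (n + k)%nat).
    apply Rabs_le_between in Hx. lra. }
  assert (B : forall n k, x (n + k)%nat + Rabs (s (n + k)%nat) <= x n + Rabs (s n)).
  { intros n k. induction k as [|k IH]; [rewrite Nat.add_0_r; lra|].
    rewrite Nat.add_succ_r. specialize (Hs (n + k)%nat). specialize (Hx (n + k)%nat).
    apply Rabs_le_between in Hx. lra. }
  assert (AB : forall n m, x n - Rabs (s n) <= x m + Rabs (s m)).
  { intros n m. pose proof (A n m) as P. pose proof (B m n) as Q. rewrite Nat.add_comm in Q.
    pose proof (Rabs_pos (s (n + m)%nat)). lra. }
  destruct (completeness (fun r => exists n, r = x n - Rabs (s n))) as [X [U L]].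
  - exists (x 0%nat + Rabs (s 0%nat)). intros r [n ->]. apply AB.
  - exists (x 0%nat - Rabs (s 0%nat)). exists 0%nat. reflexivity.
  - exists X. intros n. apply Rabs_le.
    assert (x n - Rabs (s n) <= X) by (apply U; exists n; reflexivity).
    assert (X <= x n + Rabs (s n)) by (apply L; intros r [m ->]; apply AB).
    lra.
Qed.

Lemma halving_small (s : nat -> R) (d : R) :
  (forall n, Rabs (s (S n)) = Rabs (s n) / 2) -> 0 < d -> exists n, Rabs (s n) < d.
Proof.
  intros Hs Hd.
  assert (E : forall n, Rabs (s n) = Rabs (s 0%nat) * (1 / 2) ^ n).
  { induction n as [|n IH]; [simpl; ring|]. rewrite Hs, IH. simpl. field. }
  assert (Hp : 0 < Rabs (s 0%nat) + 1) by (pose proof (Rabs_pos (s 0%nat)); lra).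
  destruct (pow_lt_1_zero (1 / 2)) with (y := d / (Rabs (s 0%nat) + 1)) as [N HN].
  - rewrite Rabs_right; lra.
  - apply Rdiv_lt_0_compat; lra.
  - exists N. rewrite E. specialize (HN N (Nat.le_refl N)).
    pose proof (pow_le (1 / 2) N ltac:(lra)) as Hq.
    rewrite Rabs_right in HN by lra.
    apply Rle_lt_trans with ((Rabs (s 0%nat) + 1) * (1 / 2) ^ N); [nra|].
    apply Rmult_lt_compat_l with (r := Rabs (s 0%nat) + 1) in HN; [|lra].
    replace ((Rabs (s 0%nat) + 1) * (d / (Rabs (s 0%nat) + 1))) with d in HN by (field; lra). lra.
Qed.

Lemma Cint_const (c : C) : Cint (fun _ => c) = c.
Proof.
  unfold Cint. rewrite (RInt_const (V := CR)).
  transitivity (RtoC (1 - 0) * c)%C; [exact (scal_R_Cmult (1 - 0) c)|]. rewrite RtoC_minus. ring.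
Qed.

(** The substitution u -> 1 - u shows that the integral X satisfies X + X = 1. *)
Lemma Cint_id : Cint RtoC = RtoC (1 / 2).
Proof.
  assert (U0 : unit_itv 0) by (unfold unit_itv; lra).
  assert (U1 : unit_itv 1) by (unfold unit_itv; lra).
  pose proof (Cint_affine RtoC 1 0 ucont_RtoC U1 U0) as E.
  rewrite <- (opp_RInt_swap (V := CR)) in E by (apply ucont_ex_Cint, ucont_RtoC).
  change (opp ?x) with (- Cint RtoC)%C in E.
  replace (fun u => RtoC (1 + u * (0 - 1))) with (fun u => RtoC 1 + (- RtoC 1) * RtoC u)%C in E.
  - rewrite Cint_plus, Cint_const, Cint_scal in E.
    + set (X := Cint RtoC) in *.
      assert (E2 : (X + X)%C = RtoC 1).
      { replace (X + X)%C with (- - X + X)%C by ring. rewrite <- E, RtoC_minus. ring. }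
      rewrite RtoC_div, <- E2 by lra. field.
    + apply ucont_RtoC.
    + apply ucont_const.
    + apply ucont_scal, ucont_RtoC.
  - apply functional_extensionality. intro u.
    rewrite RtoC_plus, RtoC_mult, RtoC_minus. ring.
Qed.

(** The right side is a difference of values of the primitive m t + l t^2/2, so it cancels around a
    triangle. *)
Lemma SI_affine (m l a b : C) : SI (fun t => m + l * t)%C a b = ((b - a) * (m + l * (a + b) / 2))%C.
Proof.
  unfold SI.
  replace (fun u => (m + l * seg a b u)%C) with (fun u => ((m + l * a) + (l * (b - a)) * RtoC u)%C).
  - rewrite Cint_plus, Cint_const, Cint_scal, Cint_id.
    + rewrite RtoC_div by lra. field.
    + apply ucont_RtoC.
    + apply ucont_const.
    + apply ucont_scal, ucont_RtoC.
  - apply functional_extensionality. intro u. unfold seg. ring.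
Qed.

Lemma bary_sub_bound (a b c : C) (x y x' y' r : R) :
  Rabs (x - x') <= r -> Rabs (y - y') <= r ->
  Cmod (bary a b c x y - bary a b c x' y') <= r * (Cmod (b - a) + Cmod (c - a)).
Proof.
  intros H1 H2.
  replace (bary a b c x y - bary a b c x' y')%C
    with (RtoC (x - x') * (b - a) + RtoC (y - y') * (c - a))%C
    by (unfold bary; rewrite !RtoC_minus; ring).
  eapply Rle_trans; [apply Cmod_triangle|]. rewrite !Cmod_mult, !Cmod_R.
  pose proof (Cmod_ge_0 (b - a)). pose proof (Cmod_ge_0 (c - a)). nra.
Qed.

(** [F] is an affine function plus (phi t - phi t0)(t - t0). The affine part integrates to 0; on
    each of the three edges, of length at most |s| e, the rest is at most eps times 2 |s| e. Here e
    is |b-a| + |c-a|. *)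
Lemma subTI_small F (a b c : C) (x0 y0 eps : R) :
  (forall t, triangle a b c t -> ccont (triangle a b c) F t) ->
  cdiff F (bary a b c x0 y0) -> 0 < eps ->
  exists d, 0 < d /\ forall x y s, inside x y s -> Rabs s < d ->
    Rabs (x0 - x) <= Rabs s -> Rabs (y0 - y) <= Rabs s ->
    Cmod (subTI F a b c x y s) <= eps * (6 * (Cmod (b - a) + Cmod (c - a)) ^ 2) * s ^ 2.
Proof.
  intros HF [phi [Hlim Hphi]] He.
  set (e := Cmod (b - a) + Cmod (c - a)). set (t0 := bary a b c x0 y0) in *.
  assert (He0 : 0 <= e) by (unfold e; pose proof (Cmod_ge_0 (b - a)); pose proof (Cmod_ge_0 (c - a)); lra).
  destruct (proj1 (locally_Cmod _ _) (proj2 Hlim eps He)) as [eta [Heta Hclose]].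
  (* Points of the small triangle are within 2 |s| e of t0, which must stay below eta. *)
  exists (eta / (2 * e + 1)). split; [apply Rdiv_lt_0_compat; lra|].
  intros x y s [I1 [I2 I3]] Hsd Hx Hy.
  assert (Hs2 : Rabs s * Rabs s = s ^ 2) by (rewrite <- Rabs_mult, Rabs_right by nra; ring).
  set (G := fun t => ((phi t - phi t0) * (t - t0))%C).
  set (Aff := fun t => ((F t0 - phi t0 * t0) + phi t0 * t)%C).
  assert (EF : F = (fun t => Aff t + G t)%C).
  { apply functional_extensionality. intro t. unfold Aff, G.
    replace (F t) with (F t0 + (F t - F t0))%C by ring. rewrite Hphi. ring. }
  assert (HAffc : forall t, ccont (triangle a b c) Aff t).
  { intros t. apply cdiff_ccont. unfold Aff. apply cdiff_plus; [apply cdiff_const|].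
    apply cdiff_mult; [apply cdiff_const|apply cdiff_id]. }
  assert (HGc : forall t, triangle a b c t -> ccont (triangle a b c) G t).
  { intros t Ht.
    assert (EG : G = (fun t => F t + (- RtoC 1) * Aff t)%C).
    { apply functional_extensionality. intro r. rewrite EF. ring. }
    rewrite EG. unfold ccont. apply clim_plus; [apply HF, Ht|].
    apply clim_mult; [apply clim_const; exact _|apply HAffc]. }
  assert (Hedge : forall p q p' q', in_simplex p q -> in_simplex p' q' ->
    Rabs (p - p') <= Rabs s -> Rabs (q - q') <= Rabs s ->
    Rabs (p - x) <= Rabs s -> Rabs (q - y) <= Rabs s ->
    Rabs (p' - x) <= Rabs s -> Rabs (q' - y) <= Rabs s ->
    SI F (bary a b c p q) (bary a b c p' q')
      = (SI Aff (bary a b c p q) (bary a b c p' q') + SI G (bary a b c p q) (bary a b c p' q'))%C /\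
    Cmod (SI G (bary a b c p q) (bary a b c p' q')) <= 2 * eps * e ^ 2 * s ^ 2).
  { intros p q p' q' J1 J2 K1 K2 K3 K4 K5 K6. split.
    - rewrite EF at 1. apply SI_plus; apply segcont_simplex; auto.
    - eapply Rle_trans; [apply SI_bound with (M := eps * (2 * Rabs s * e))|].
      + apply segcont_simplex; auto.
      + intros u Hu. rewrite seg_bary. unfold G. rewrite Cmod_mult.
        assert (D : Cmod (bary a b c (p + u * (p' - p)) (q + u * (q' - q)) - t0) <= 2 * Rabs s * e).
        { unfold t0, e. unfold unit_itv in Hu.
          apply bary_sub_bound.
          all: apply Rabs_le_between in K3, K4, K5, K6, Hx, Hy; apply Rabs_le; split; nra. }
        apply Rmult_le_compat; try apply Cmod_ge_0; [|exact D].
        apply Rlt_le, Hclose. eapply Rle_lt_trans; [exact D|].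
        apply Rmult_lt_compat_r with (r := 2 * e + 1) in Hsd; [|lra].
        replace (eta / (2 * e + 1) * (2 * e + 1)) with eta in Hsd by (field; lra).
        pose proof (Rabs_pos s). nra.
      + assert (D : Cmod (bary a b c p' q' - bary a b c p q) <= Rabs s * e)
          by (apply bary_sub_bound; rewrite Rabs_minus_sym; assumption).
        replace (2 * eps * e ^ 2 * s ^ 2) with ((Rabs s * e) * (eps * (2 * Rabs s * e)))
          by (rewrite <- Hs2; ring).
        apply Rmult_le_compat_r; [|exact D].
        pose proof (Rabs_pos s). apply Rmult_le_pos; [lra|]. apply Rmult_le_pos; lra. }
  assert (Z1 : Rabs (x - (x + s)) <= Rabs s) by (replace (x - (x + s)) with (- s) by ring; rewrite Rabs_Ropp; lra).
  assert (Z2 : Rabs (x - x) <= Rabs s) by (replace (x - x) with 0 by ring; rewrite Rabs_R0; apply Rabs_pos).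
  assert (Z3 : Rabs (y - y) <= Rabs s) by (replace (y - y) with 0 by ring; rewrite Rabs_R0; apply Rabs_pos).
  assert (Z4 : Rabs (y - (y + s)) <= Rabs s) by (replace (y - (y + s)) with (- s) by ring; rewrite Rabs_Ropp; lra).
  assert (Z5 : Rabs (x + s - x) <= Rabs s) by (replace (x + s - x) with s by ring; lra).
  assert (Z6 : Rabs (y + s - y) <= Rabs s) by (replace (y + s - y) with s by ring; lra).
  destruct (Hedge x y (x + s) y) as [E1 B1]; auto.
  destruct (Hedge (x + s) y x (y + s)) as [E2 B2]; auto.
  destruct (Hedge x (y + s) x y) as [E3 B3]; auto.
  unfold subTI, TI. rewrite E1, E2, E3. unfold Aff. rewrite !SI_affine.
  match goal with |- Cmod (?A1 + ?G1 + (?A2 + ?G2) + (?A3 + ?G3))%C <= _ =>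
    replace (A1 + G1 + (A2 + G2) + (A3 + G3))%C with (G1 + G2 + G3)%C by field end.
  eapply Rle_trans; [apply Cmod_triangle|].
  match goal with |- Cmod (?A1 + ?A2)%C + _ <= _ => pose proof (Cmod_triangle A1 A2) end.
  apply Rle_trans with (3 * (2 * eps * e ^ 2 * s ^ 2)); [lra|]. unfold e. right. ring.
Qed.

Lemma goursat F (a b c : C) :
  (forall t, triangle a b c t -> cdiff F t) -> TI F a b c = RtoC 0.
Proof.
  intros HF.
  assert (HFc : forall t, triangle a b c t -> ccont (triangle a b c) F t)
    by (intros; apply cdiff_ccont; auto).
  assert (E0 : TI F a b c = subTI F a b c 0 0 1).
  { unfold subTI. f_equal; unfold bary; rewrite ?Rplus_0_l; ring. }
  apply Cmod_eq_0. apply Rle_antisym; [|apply Cmod_ge_0].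
  apply Rnot_lt_le. intros Hpos.
  set (L := 6 * (Cmod (b - a) + Cmod (c - a)) ^ 2).
  assert (HL : 0 <= L) by (unfold L; apply Rmult_le_pos; [lra|apply pow2_ge_0]).
  (* With this [eps] the whole triangle, of size 1, violates the bound eps L s^2 that [subTI_small]
     will give in the limit. *)
  set (eps := Cmod (TI F a b c) / (2 * (L + 1))).
  assert (Heps : 0 < eps) by (apply Rdiv_lt_0_compat; lra).
  set (good := fun q : R * R * R => inside (fst (fst q)) (snd (fst q)) (snd q) /\
     eps * L * snd q ^ 2 < Cmod (subTI F a b c (fst (fst q)) (snd (fst q)) (snd q))).
  (* If all four quarters obeyed eps L (s/2)^2, the triangle itself would obey eps L s^2; so the
     violation passes to some quarter. *)
  assert (step : forall q : {q | good q}, exists q' : {q | good q},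
     let x := fst (fst (proj1_sig q)) in let y := snd (fst (proj1_sig q)) in let s := snd (proj1_sig q) in
     let x' := fst (fst (proj1_sig q')) in let y' := snd (fst (proj1_sig q')) in let s' := snd (proj1_sig q') in
     Rabs s' = Rabs s / 2 /\ Rabs (x' - x) <= Rabs s' /\ Rabs (y' - y) <= Rabs s').
  { intros [[[x y] s] [Hin Hbad]]. cbn [fst snd proj1_sig] in *.
    pose proof (subTI_quarter F a b c x y s HFc Hin) as Q.
    assert (Hh : Rabs (s / 2) = Rabs s / 2)
      by (unfold Rdiv; rewrite Rabs_mult, (Rabs_right (/ 2)); lra).
    pose proof (Rabs_pos s) as Hsp.
    assert (Cmod (subTI F a b c x y (s / 2)) <= eps * L * (s / 2) ^ 2 ->
            Cmod (subTI F a b c (x + s / 2) y (s / 2)) <= eps * L * (s / 2) ^ 2 ->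
            Cmod (subTI F a b c x (y + s / 2) (s / 2)) <= eps * L * (s / 2) ^ 2 ->
            Cmod (subTI F a b c (x + s / 2) (y + s / 2) (- (s / 2))) <= eps * L * (- (s / 2)) ^ 2 -> False).
    { intros B1 B2 B3 B4. rewrite Q in Hbad.
      match type of Hbad with _ < Cmod (?A1 + ?A2 + ?A3 + ?A4)%C =>
        pose proof (Cmod_triangle (A1 + A2 + A3) A4); pose proof (Cmod_triangle (A1 + A2) A3);
        pose proof (Cmod_triangle A1 A2) end.
      nra. }
    assert (N0 : forall r, Rabs (r - r) <= Rabs s / 2)
      by (intro r; replace (r - r) with 0 by ring; rewrite Rabs_R0; lra).
    assert (N1 : forall r, Rabs (r + s / 2 - r) <= Rabs s / 2)
      by (intro r; replace (r + s / 2 - r) with (s / 2) by ring; lra).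
    unfold inside, in_simplex in Hin.
    match goal with |- ?Goal => assert (K : forall x' y' s', inside x' y' s' -> Rabs s' = Rabs s / 2 ->
      Rabs (x' - x) <= Rabs s / 2 -> Rabs (y' - y) <= Rabs s / 2 ->
      eps * L * s' ^ 2 < Cmod (subTI F a b c x' y' s') -> Goal) end.
    { intros x' y' s' K1 K2 K3 K4 K5.
      exists (exist _ (x', y', s') (conj K1 K5)). simpl. rewrite K2. auto. }
    destruct (Rle_or_lt (Cmod (subTI F a b c x y (s / 2))) (eps * L * (s / 2) ^ 2)) as [B1|B1];
      [|apply K in B1; rewrite ?Rabs_Ropp; auto; unfold inside, in_simplex; lra].
    destruct (Rle_or_lt (Cmod (subTI F a b c (x + s / 2) y (s / 2))) (eps * L * (s / 2) ^ 2)) as [B2|B2];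
      [|apply K in B2; rewrite ?Rabs_Ropp; auto; unfold inside, in_simplex; lra].
    destruct (Rle_or_lt (Cmod (subTI F a b c x (y + s / 2) (s / 2))) (eps * L * (s / 2) ^ 2)) as [B3|B3];
      [|apply K in B3; rewrite ?Rabs_Ropp; auto; unfold inside, in_simplex; lra].
    destruct (Rle_or_lt (Cmod (subTI F a b c (x + s / 2) (y + s / 2) (- (s / 2)))) (eps * L * (- (s / 2)) ^ 2)) as [B4|B4];
      [|apply K in B4; rewrite ?Rabs_Ropp; auto; unfold inside, in_simplex; lra].
    exfalso; auto. }
  assert (G0 : good (0, 0, 1)).
  { split; [unfold inside, in_simplex; simpl; lra|]. simpl fst; simpl snd. rewrite <- E0.
    assert (Cmod (TI F a b c) = eps * (2 * (L + 1))) by (unfold eps; field; lra). nra. }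
  set (next := fun q => proj1_sig (constructive_indefinite_description _ (step q))).
  set (sq := fun n => Nat.iter n next (exist _ _ G0)).
  set (xs := fun n => fst (fst (proj1_sig (sq n)))).
  set (ys := fun n => snd (fst (proj1_sig (sq n)))).
  set (ss := fun n => snd (proj1_sig (sq n))).
  assert (Hstep : forall n, Rabs (ss (S n)) = Rabs (ss n) / 2 /\
     Rabs (xs (S n) - xs n) <= Rabs (ss (S n)) /\ Rabs (ys (S n) - ys n) <= Rabs (ss (S n))).
  { intro n. exact (proj2_sig (constructive_indefinite_description _ (step (sq n)))). }
  assert (Hs : forall n, Rabs (ss (S n)) = Rabs (ss n) / 2) by (intro n; apply Hstep).
  destruct (halving_limit xs ss Hs) as [X HX]; [intro n; apply Hstep|].
  destruct (halving_limit ys ss Hs) as [Y HY]; [intro n; apply Hstep|].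
  assert (Hgood : forall n, inside (xs n) (ys n) (ss n) /\
     eps * L * ss n ^ 2 < Cmod (subTI F a b c (xs n) (ys n) (ss n))).
  { intro n. exact (proj2_sig (sq n)). }
  (* The limit point stays in the closed triangle: a positive excess would be larger than the size
     of some triangle of the sequence. *)
  assert (HXY : in_simplex X Y).
  { unfold in_simplex. repeat split; apply Rnot_lt_le; intros Hlt.
    - destruct (halving_small ss (- X) Hs) as [n Hn]; [lra|].
      pose proof (proj1 (Rabs_le_between _ _) (HX n)). destruct (Hgood n) as [[[? _] _] _]. lra.
    - destruct (halving_small ss (- Y) Hs) as [n Hn]; [lra|].
      pose proof (proj1 (Rabs_le_between _ _) (HY n)). destruct (Hgood n) as [[[? [? _]] _] _]. lra.
    - destruct (halving_small ss ((X + Y - 1) / 2) Hs) as [n Hn]; [lra|].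
      pose proof (proj1 (Rabs_le_between _ _) (HX n)).
      pose proof (proj1 (Rabs_le_between _ _) (HY n)). destruct (Hgood n) as [[[? [? ?]] _] _]. lra. }
  destruct (subTI_small F a b c X Y eps HFc) as [d [Hd Hsmall]]; auto.
  { apply HF. exists X, Y. auto. }
  destruct (halving_small ss d Hs Hd) as [n Hn].
  destruct (Hgood n) as [G1 G2].
  specialize (Hsmall _ _ _ G1 Hn (HX n) (HY n)). fold L in Hsmall. lra.
Qed.

(** The segment [p,q] is contracted towards [g] by the ratio 1 - e. Continuity of [F] along the
    segment becomes uniform by compactness, which lets [cauchy_triangle] reach the boundary as a
    limit. *)
Lemma SI_shrink (S : C -> Prop) F (g p q : C) :
  (forall t, S t -> ccont S F t) ->
  (forall e u, unit_itv e -> unit_itv u -> S (seg (seg p q u) g e)) ->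
  forall eta, 0 < eta -> exists d, 0 < d /\ forall e, 0 < e < d -> e <= 1 ->
    Cmod (SI F (seg p g e) (seg q g e) - RtoC (1 - e) * SI F p q) <= eta * Cmod (q - p).
Proof.
  intros HF HS eta Heta.
  set (La := Cmod (q - p) + Cmod (g - p) + Cmod (g - q) + 1).
  pose proof (Cmod_ge_0 (q - p)) as P1. pose proof (Cmod_ge_0 (g - p)) as P2. pose proof (Cmod_ge_0 (g - q)) as P3.
  assert (HLa : 0 < La) by (unfold La; lra).
  assert (HS0 : forall u, unit_itv u -> S (seg p q u)).
  { intros u Hu. rewrite <- (seg_0 (seg p q u) g). apply HS; auto. unfold unit_itv; lra. }
  assert (loc : forall u, exists d : posreal, unit_itv u -> forall v e, unit_itv v -> unit_itv e ->
     Rabs (v - u) < d -> e < d -> Cmod (F (seg (seg p q v) g e) - F (seg p q u)) < eta / 2).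
  { intros u. destruct (excluded_middle_informative (unit_itv u)) as [Hu|Hu].
    2:{ exists (mkposreal 1 Rlt_0_1). tauto. }
    destruct (proj1 (ccont_spec _ _ _) (HF _ (HS0 u Hu)) (eta / 2)) as [r [Hr Hcl]]; [lra|].
    assert (Hr2 : 0 < r / (2 * La)) by (apply Rdiv_lt_0_compat; lra).
    exists (mkposreal _ Hr2). simpl. intros _ v e Hv He Hvu Hed. apply Hcl; [apply HS; auto|].
    replace (seg (seg p q v) g e - seg p q u)%C
      with (RtoC (v - u) * (q - p) + RtoC e * (RtoC (1 - v) * (g - p) + RtoC v * (g - q)))%C
      by (unfold seg; rewrite !RtoC_minus; ring).
    unfold unit_itv in *.
    eapply Rle_lt_trans; [apply Cmod_triangle|]. rewrite !Cmod_mult, !Cmod_R.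
    assert (B : Cmod (RtoC (1 - v) * (g - p) + RtoC v * (g - q)) <= La).
    { eapply Rle_trans; [apply Cmod_triangle|]. rewrite !Cmod_mult, !Cmod_R, !Rabs_right by lra.
      unfold La. nra. }
    rewrite (Rabs_right e) by lra.
    assert (E : r = r / (2 * La) * La + r / (2 * La) * La) by (field; lra).
    rewrite E. pose proof (Rabs_pos (v - u)).
    apply Rplus_lt_le_compat.
    - apply Rle_lt_trans with (Rabs (v - u) * La); [apply Rmult_le_compat_l; unfold La; lra|].
      apply Rmult_lt_compat_r; lra.
    - apply Rmult_le_compat; try lra. apply Cmod_ge_0. }
  set (delta := fun u => proj1_sig (constructive_indefinite_description _ (loc u))).
  destruct (compactness_value_1d 0 1 delta) as [d Hd].
  exists d. split; [apply cond_pos|]. intros e [He0 Hed] He1.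
  assert (Ue : unit_itv e) by (unfold unit_itv; lra).
  assert (Eseg : forall u, seg (seg p g e) (seg q g e) u = seg (seg p q u) g e)
    by (intro u; unfold seg; ring).
  assert (H1 : segcont F (seg p g e) (seg q g e)).
  { apply (segcont_of_ccont S); auto. intros u Hu. rewrite Eseg. apply HS; auto. }
  assert (H2 : segcont F p q) by (apply (segcont_of_ccont S); auto).
  unfold SI.
  replace (seg q g e - seg p g e)%C with (RtoC (1 - e) * (q - p))%C
    by (unfold seg; rewrite RtoC_minus; ring).
  replace (RtoC (1 - e) * (q - p) * Cint (fun u => F (seg (seg p g e) (seg q g e) u))
    - RtoC (1 - e) * ((q - p) * Cint (fun u => F (seg p q u))))%C
    with (RtoC (1 - e) * (q - p) * Cint (fun u => F (seg (seg p g e) (seg q g e) u) + (- RtoC 1) * F (seg p q u)))%C.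
  2:{ rewrite Cint_plus, Cint_scal; [ring|exact H2|exact H1|].
      apply ucont_scal, H2. }
  rewrite !Cmod_mult, Cmod_R, Rabs_right by lra.
  assert (B : Cmod (Cint (fun u => F (seg (seg p g e) (seg q g e) u) + (- RtoC 1) * F (seg p q u)))%C <= eta).
  { apply Cint_bound.
    - apply ucont_plus; [exact H1|]. apply ucont_scal, H2.
    (* [compactness_value_1d] gives a doubly negated existence, hence the argument by
       contradiction. *)
    - intros u Hu. apply Rnot_lt_le. intros Hlt. apply (Hd u Hu). intros [t [Ht [Htu Hdt]]].
      revert Htu Hdt. unfold delta.
      destruct (constructive_indefinite_description _ (loc t)) as [dt Hloc]. simpl. intros Htu Hdt.
      pose proof (Hloc Ht u e Hu Ue Htu ltac:(lra)) as Q1.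
      assert (U0 : unit_itv 0) by (unfold unit_itv; lra).
      pose proof (Hloc Ht u 0 Hu U0 Htu (cond_pos dt)) as Q2. rewrite seg_0 in Q2.
      rewrite Eseg in Hlt.
      pose proof (Cmod_triangle (F (seg (seg p q u) g e) - F (seg p q t)) (- (F (seg p q u) - F (seg p q t)))) as Q3.
      rewrite Cmod_opp in Q3.
      replace (F (seg (seg p q u) g e) - F (seg p q t) + - (F (seg p q u) - F (seg p q t)))%C
        with (F (seg (seg p q u) g e) + (- RtoC 1) * F (seg p q u))%C in Q3 by ring.
      lra. }
  assert (0 <= Cmod (q - p) * Cmod (Cint (fun u => F (seg (seg p g e) (seg q g e) u) + (- RtoC 1) * F (seg p q u)))%C)
    by (apply Rmult_le_pos; apply Cmod_ge_0).
  rewrite Rmult_assoc.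
  apply Rle_trans with (1 * (Cmod (q - p) * Cmod (Cint (fun u => F (seg (seg p g e) (seg q g e) u) + (- RtoC 1) * F (seg p q u)))%C)).
  - apply Rmult_le_compat_r; lra.
  - rewrite Rmult_1_l, (Rmult_comm eta). apply Rmult_le_compat_l; auto.
Qed.

Lemma bary_a (a b c : C) : bary a b c 0 0 = a.
Proof. unfold bary. ring. Qed.
Lemma bary_b (a b c : C) : bary a b c 1 0 = b.
Proof. unfold bary. ring. Qed.
Lemma bary_c (a b c : C) : bary a b c 0 1 = c.
Proof. unfold bary. ring. Qed.

(** Triangles shrunk towards the centroid lie in the interior, where [goursat] applies. That mere
    continuity suffices on the boundary is used at the pole of the Cauchy kernel and at the corners
    of the polygon. *)
Lemma cauchy_triangle F (a b c : C) :
  (forall t, triangle a b c t -> ccont (triangle a b c) F t) ->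
  (forall x y, 0 < x -> 0 < y -> x + y < 1 -> cdiff F (bary a b c x y)) ->
  TI F a b c = RtoC 0.
Proof.
  intros HF HD.
  set (g := bary a b c (1 / 3) (1 / 3)).
  assert (Hg : in_simplex (1 / 3) (1 / 3)) by (unfold in_simplex; lra).
  assert (Hseg : forall x y x' y', in_simplex x y -> in_simplex x' y' ->
    forall e u, unit_itv e -> unit_itv u ->
      triangle a b c (seg (seg (bary a b c x y) (bary a b c x' y') u) g e)).
  { intros x y x' y' H1 H2 e u He Hu. unfold g. rewrite !seg_bary.
    do 2 eexists. split; [|reflexivity]. repeat (apply simplex_convex; auto). }
  assert (Sa : in_simplex 0 0) by (unfold in_simplex; lra).
  assert (Sb : in_simplex 1 0) by (unfold in_simplex; lra).
  assert (Sc : in_simplex 0 1) by (unfold in_simplex; lra).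
  assert (Hab := Hseg _ _ _ _ Sa Sb). rewrite bary_a, bary_b in Hab.
  assert (Hbc := Hseg _ _ _ _ Sb Sc). rewrite bary_b, bary_c in Hbc.
  assert (Hca := Hseg _ _ _ _ Sc Sa). rewrite bary_a, bary_c in Hca.
  set (P := Cmod (b - a) + Cmod (c - b) + Cmod (a - c)).
  assert (HP : 0 <= P).
  { unfold P. pose proof (Cmod_ge_0 (b - a)). pose proof (Cmod_ge_0 (c - b)). pose proof (Cmod_ge_0 (a - c)). lra. }
  apply Cmod_eq_0. apply Rle_antisym; [|apply Cmod_ge_0].
  apply Rnot_lt_le. intros Hpos.
  set (eta := Cmod (TI F a b c) / (4 * (P + 1))).
  assert (Heta : 0 < eta) by (apply Rdiv_lt_0_compat; lra).
  destruct (SI_shrink _ F g a b HF Hab eta Heta) as [d1 [D1 S1]].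
  destruct (SI_shrink _ F g b c HF Hbc eta Heta) as [d2 [D2 S2]].
  destruct (SI_shrink _ F g c a HF Hca eta Heta) as [d3 [D3 S3]].
  (* With e <= 1/2 the factor 1 - e is at least 1/2, and the factor 4 in [eta] then leads to a
     contradiction. *)
  set (e := Rmin (1 / 2) (Rmin d1 (Rmin d2 d3) / 2)).
  assert (He : 0 < e <= 1 / 2 /\ e < d1 /\ e < d2 /\ e < d3).
  { unfold e, Rmin. repeat destruct Rle_dec; lra. }
  specialize (S1 e ltac:(lra) ltac:(lra)). specialize (S2 e ltac:(lra) ltac:(lra)).
  specialize (S3 e ltac:(lra) ltac:(lra)).
  assert (E : TI F (seg a g e) (seg b g e) (seg c g e) = RtoC 0).
  { apply goursat. intros t [x [y [Hxy ->]]].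
    replace (bary (seg a g e) (seg b g e) (seg c g e) x y)
      with (bary a b c (e / 3 + (1 - e) * x) (e / 3 + (1 - e) * y)).
    - unfold in_simplex in Hxy. apply HD; nra.
    - unfold g, seg, bary. rewrite !RtoC_plus, !RtoC_mult, !RtoC_minus, !RtoC_div by lra. field. }
  unfold TI in E.
  assert (E2 : (RtoC (1 - e) * TI F a b c)%C =
    (- ((SI F (seg a g e) (seg b g e) - RtoC (1 - e) * SI F a b)
        + (SI F (seg b g e) (seg c g e) - RtoC (1 - e) * SI F b c)
        + (SI F (seg c g e) (seg a g e) - RtoC (1 - e) * SI F c a)))%C).
  { transitivity (RtoC (1 - e) * TI F a b c - RtoC 0)%C; [ring|]. rewrite <- E. unfold TI. ring. }
  apply (f_equal Cmod) in E2. rewrite Cmod_mult, Cmod_R, Rabs_right, Cmod_opp in E2 by lra.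
  match type of E2 with _ = Cmod (?A1 + ?A2 + ?A3)%C =>
    pose proof (Cmod_triangle (A1 + A2) A3); pose proof (Cmod_triangle A1 A2) end.
  assert (Q : Cmod (TI F a b c) = eta * (4 * (P + 1))) by (unfold eta; field; lra).
  assert ((1 - e) * Cmod (TI F a b c) <= eta * P) by (unfold P; lra).
  nra.
Qed.

(** * Polynomials and rational functions *)

Definition is_poly n (p : C -> C) : Prop := exists a, forall z, p z = poly_eval a n z.

Lemma poly_eval_S (a : nat -> C) n z :
  poly_eval a (S n) z = (poly_eval a n z + a (S n) * Cpow z (S n))%C.
Proof. unfold poly_eval. rewrite sum_Sn. reflexivity. Qed.

Lemma poly_eval_0 (a : nat -> C) z : poly_eval a 0 z = a 0%nat.
Proof. unfold poly_eval. rewrite sum_O. simpl. ring. Qed.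

Lemma poly_eval_ext (a b : nat -> C) n z :
  (forall j, (j <= n)%nat -> a j = b j) -> poly_eval a n z = poly_eval b n z.
Proof.
  intros H. induction n as [|n IH]; [rewrite !poly_eval_0; apply H; lia|].
  rewrite !poly_eval_S, IH, H by auto. reflexivity.
Qed.

Lemma is_poly_S n (p : C -> C) : is_poly n p -> is_poly (S n) p.
Proof.
  intros [a H]. exists (fun j => if Nat.leb j n then a j else RtoC 0). intros z.
  rewrite poly_eval_S, H.
  replace (Nat.leb (S n) n) with false by (symmetry; apply Nat.leb_gt; lia).
  rewrite (poly_eval_ext (fun j => if Nat.leb j n then a j else RtoC 0) a).
  - ring.
  - intros j Hj. rewrite (proj2 (Nat.leb_le j n) Hj). reflexivity.
Qed.

Lemma is_poly_le n m (p : C -> C) : (n <= m)%nat -> is_poly n p -> is_poly m p.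
Proof. intros H Hp. induction H; auto using is_poly_S. Qed.

Lemma is_poly_const (c : C) : is_poly 0 (fun _ => c).
Proof. exists (fun _ => c). intros z. rewrite poly_eval_0. reflexivity. Qed.

Lemma is_poly_plus n (p q : C -> C) :
  is_poly n p -> is_poly n q -> is_poly n (fun z => p z + q z)%C.
Proof.
  intros [a H] [b H']. exists (fun j => a j + b j)%C. intros z. rewrite H, H'. clear.
  induction n as [|n IH]; [rewrite !poly_eval_0; reflexivity|].
  rewrite !poly_eval_S, <- IH. ring.
Qed.

Lemma is_poly_scal n (c : C) (p : C -> C) : is_poly n p -> is_poly n (fun z => c * p z)%C.
Proof.
  intros [a H]. exists (fun j => c * a j)%C. intros z. rewrite H. clear.
  induction n as [|n IH]; [rewrite !poly_eval_0; reflexivity|].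
  rewrite !poly_eval_S, <- IH. ring.
Qed.

Lemma is_poly_X n (p : C -> C) : is_poly n p -> is_poly (S n) (fun z => z * p z)%C.
Proof.
  intros [a H]. exists (fun j => match j with O => RtoC 0 | S i => a i end). intros z. rewrite H. clear.
  induction n as [|n IH]; [rewrite poly_eval_S, !poly_eval_0; simpl; ring|].
  rewrite (poly_eval_S _ (S n)), <- IH, !poly_eval_S. simpl. ring.
Qed.

Lemma is_poly_ext n (p q : C -> C) : (forall z, p z = q z) -> is_poly n p -> is_poly n q.
Proof. intros E [a H]. exists a. intros z. rewrite <- E. apply H. Qed.

Lemma is_poly_mult n m (p q : C -> C) :
  is_poly n p -> is_poly m q -> is_poly (n + m) (fun z => p z * q z)%C.
Proof.
  intros Hp [b Hq]. apply is_poly_ext with (fun z => p z * poly_eval b m z)%C.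
  { intros z. rewrite Hq. reflexivity. }
  clear Hq. induction m as [|m IH].
  - rewrite Nat.add_0_r. apply is_poly_ext with (fun z => b 0%nat * p z)%C.
    + intros z. rewrite poly_eval_0. ring.
    + apply is_poly_scal, Hp.
  - apply is_poly_ext with (fun z => p z * poly_eval b m z + b (S m) * (Cpow z (S m) * p z))%C.
    + intros z. rewrite poly_eval_S. ring.
    + apply is_poly_plus; [apply is_poly_le with (n + m)%nat; [lia|exact IH]|].
      apply is_poly_scal. clear IH b. revert p Hp. generalize (S m). intros k p Hp.
      induction k as [|k IH].
      * rewrite Nat.add_0_r. apply is_poly_ext with p; [intros; simpl; ring|exact Hp].
      * rewrite Nat.add_succ_r. apply is_poly_ext with (fun z => z * (Cpow z k * p z))%C.
        { intros; simpl; ring. }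
        apply is_poly_X, IH.
Qed.

Lemma is_poly_lin (c d : C) : is_poly 1 (fun z => c * z + d)%C.
Proof.
  apply is_poly_plus; [apply is_poly_scal|apply is_poly_S, is_poly_const].
  apply is_poly_ext with (fun z => z * 1)%C; [intros; ring|]. apply is_poly_X, is_poly_const.
Qed.

Lemma is_poly_comp_lin n (p : C -> C) (c d : C) :
  is_poly n p -> is_poly n (fun z => p (c * z + d))%C.
Proof.
  intros [a H]. apply is_poly_ext with (fun z => poly_eval a n (c * z + d))%C.
  { intros; rewrite H; reflexivity. }
  clear H. induction n as [|n IH].
  - apply is_poly_ext with (fun _ => a 0%nat); [intros; rewrite poly_eval_0; reflexivity|apply is_poly_const].
  - apply is_poly_ext with (fun z => poly_eval a n (c * z + d) + a (S n) * Cpow (c * z + d) (S n))%C.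
    { intros; rewrite poly_eval_S; reflexivity. }
    apply is_poly_plus; [apply is_poly_S, IH|]. apply is_poly_scal.
    generalize (S n). clear. intros k. induction k as [|k IH]; [exact (is_poly_const 1)|].
    apply (is_poly_mult 1 k); [apply is_poly_lin|exact IH].
Qed.

Lemma is_poly_cdiff n (p : C -> C) z : is_poly n p -> cdiff p z.
Proof.
  intros [a H].
  replace p with (poly_eval a n) by (apply functional_extensionality; auto).
  clear H. induction n as [|n IH].
  - replace (poly_eval a 0) with (fun _ : C => a 0%nat); [apply cdiff_const|].
    apply functional_extensionality. intros; rewrite poly_eval_0; reflexivity.
  - replace (poly_eval a (S n)) with (fun z => poly_eval a n z + a (S n) * Cpow z (S n))%C.
    2:{ apply functional_extensionality. intros; rewrite poly_eval_S; reflexivity. }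
    apply cdiff_plus; [exact IH|]. apply cdiff_mult; [apply cdiff_const|].
    generalize (S n). clear. intros k. induction k as [|k IH]; [exact (cdiff_const 1 z)|].
    apply (cdiff_mult (fun z => z) (fun z => Cpow z k)); [apply cdiff_id|exact IH].
Qed.

(* Unlike [rational_on], this says nothing about [r] outside [X], which makes it stable under sums. *)
Definition rat_on (X : C -> Prop) n (r : C -> C) : Prop :=
  exists p q, is_poly n p /\ is_poly n q /\ forall z, X z -> q z <> RtoC 0 /\ r z = (p z / q z)%C.

Lemma rat_on_le (X : C -> Prop) n m (r : C -> C) :
  (n <= m)%nat -> rat_on X n r -> rat_on X m r.
Proof.
  intros H [p [q [A [B D]]]]. exists p, q. repeat split; try apply D; auto; eapply is_poly_le; eauto.
Qed.

Lemma rat_on_plus (X : C -> Prop) n m (r s : C -> C) :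
  rat_on X n r -> rat_on X m s -> rat_on X (n + m) (fun z => r z + s z)%C.
Proof.
  intros [p [q [A [B D]]]] [p' [q' [A' [B' D']]]].
  exists (fun z => p z * q' z + q z * p' z)%C, (fun z => q z * q' z)%C.
  split; [apply is_poly_plus; apply is_poly_mult; auto|].
  split; [apply is_poly_mult; auto|].
  intros z Hz. destruct (D z Hz) as [D1 ->], (D' z Hz) as [D2 ->].
  split; [apply Cmult_neq_0; auto|]. field. auto.
Qed.

Lemma rat_on_scal (X : C -> Prop) n (c : C) (r : C -> C) :
  rat_on X n r -> rat_on X n (fun z => c * r z)%C.
Proof.
  intros [p [q [A [B D]]]]. exists (fun z => c * p z)%C, q.
  split; [apply is_poly_scal; auto|]. split; [auto|].
  intros z Hz. destruct (D z Hz) as [D1 ->]. split; [auto|]. field. auto.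
Qed.

(** * Approximation of a Cauchy integral over a segment leaving a half plane *)

(** [zprod] and [pprod] are the numerator and denominator of B, with zeros at -b and poles at b, and
    [bprod] is |1/B|. As B(-z) = 1/B(z), [bprod] at -z is |B(z)|, so estimates in the right half
    plane serve for both. *)
Fixpoint zprod bs z : C :=
  match bs with nil => RtoC 1 | cons b l => ((z + RtoC b) * zprod l z)%C end.
Fixpoint pprod bs z : C :=
  match bs with nil => RtoC 1 | cons b l => ((z - RtoC b) * pprod l z)%C end.
Fixpoint bprod bs (t : C) : R :=
  match bs with nil => 1 | cons b l => Cmod (t - RtoC b) / Cmod (t + RtoC b) * bprod l t end.

Definition all_pos bs : Prop := forall b, In b bs -> 0 < b.

Lemma Re_neq0 z : Re z <> 0 -> z <> RtoC 0.
Proof. intros H E. apply H. rewrite E. reflexivity. Qed.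

Lemma zprod_neq0 bs (t : C) : all_pos bs -> 0 <= Re t -> zprod bs t <> RtoC 0.
Proof.
  intros H Ht. induction bs as [|b l IH]; simpl.
  - apply RtoC_neq0; lra.
  - assert (0 < b) by (apply H; left; reflexivity).
    apply Cmult_neq_0; [apply Re_neq0; simpl in *; unfold Re in *; lra|].
    apply IH. intros x Hx. apply H. right; auto.
Qed.

Lemma pprod_neq0 bs z : all_pos bs -> Re z <= 0 -> pprod bs z <> RtoC 0.
Proof.
  intros H Ht. induction bs as [|b l IH]; simpl.
  - apply RtoC_neq0; lra.
  - assert (0 < b) by (apply H; left; reflexivity).
    apply Cmult_neq_0; [apply Re_neq0; simpl in *; unfold Re in *; lra|].
    apply IH. intros x Hx. apply H. right; auto.
Qed.

Lemma is_poly_zprod bs : is_poly (length bs) (zprod bs).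
Proof.
  induction bs as [|b l IH]; [apply is_poly_const|]. simpl.
  apply (is_poly_mult 1 (length l)); [|exact IH].
  apply is_poly_ext with (fun z => 1 * z + RtoC b)%C; [intros; ring|apply is_poly_lin].
Qed.

Lemma is_poly_pprod bs : is_poly (length bs) (pprod bs).
Proof.
  induction bs as [|b l IH]; [apply is_poly_const|]. simpl.
  apply (is_poly_mult 1 (length l)); [|exact IH].
  apply is_poly_ext with (fun z => 1 * z + (- RtoC b))%C; [intros; ring|apply is_poly_lin].
Qed.

Lemma bprod_quotient bs (t : C) : all_pos bs -> 0 <= Re t ->
  Cmod (pprod bs t / zprod bs t) = bprod bs t.
Proof.
  intros H Ht. induction bs as [|b l IH]; simpl.
  - rewrite Cmod_div, !Cmod_1 by (apply RtoC_neq0; lra). field.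
  - assert (0 < b) by (apply H; left; reflexivity).
    assert (Hl : all_pos l) by (intros x Hx; apply H; right; auto).
    assert (N : (t + RtoC b)%C <> RtoC 0) by (apply Re_neq0; simpl in *; unfold Re in *; lra).
    rewrite <- IH by auto. pose proof (zprod_neq0 l t Hl Ht).
    rewrite <- Cmod_div, <- Cmod_mult by auto. f_equal. field. auto.
Qed.

Lemma bprod_opp_quotient bs z : all_pos bs -> Re z <= 0 ->
  Cmod (zprod bs z / pprod bs z) = bprod bs (- z)%C.
Proof.
  intros H Ht. induction bs as [|b l IH]; simpl.
  - rewrite Cmod_div, !Cmod_1 by (apply RtoC_neq0; lra). field.
  - assert (0 < b) by (apply H; left; reflexivity).
    assert (Hl : all_pos l) by (intros x Hx; apply H; right; auto).
    assert (N : (- z + RtoC b)%C <> RtoC 0) by (apply Re_neq0; simpl in *; unfold Re in *; lra).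
    assert (N' : (z - RtoC b)%C <> RtoC 0) by (apply Re_neq0; simpl in *; unfold Re in *; lra).
    rewrite <- IH by auto. pose proof (pprod_neq0 l z Hl Ht).
    rewrite <- Cmod_div, <- Cmod_mult by auto. f_equal. field. auto.
Qed.

Lemma Cmod_sqr z : Cmod z ^ 2 = fst z ^ 2 + snd z ^ 2.
Proof. apply Cmod2_alt. Qed.

Lemma bfactor_range (b : R) (t : C) : 0 < b -> 0 <= Re t ->
  0 <= Cmod (t - RtoC b) / Cmod (t + RtoC b) <= 1.
Proof.
  intros Hb Ht.
  assert (N : (t + RtoC b)%C <> RtoC 0) by (apply Re_neq0; simpl in *; unfold Re in *; lra).
  apply Cmod_gt_0 in N. pose proof (Cmod_ge_0 (t - RtoC b)) as P. split.
  - apply Rmult_le_pos; [exact P|]. apply Rlt_le, Rinv_0_lt_compat, N.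
  - apply Rmult_le_reg_r with (Cmod (t + RtoC b)); [exact N|].
    unfold Rdiv. rewrite Rmult_assoc, Rinv_l, Rmult_1_r, Rmult_1_l by lra.
    apply Rsqr_incr_0_var; [|lra].
    unfold Rsqr. pose proof (Cmod_sqr (t - RtoC b)) as E1. pose proof (Cmod_sqr (t + RtoC b)) as E2.
    destruct t as [x y]. simpl in *. nra.
Qed.

Lemma bprod_range bs (t : C) : all_pos bs -> 0 <= Re t -> 0 <= bprod bs t <= 1.
Proof.
  intros H Ht. induction bs as [|b l IH]; simpl; [lra|].
  assert (0 < b) by (apply H; left; reflexivity).
  assert (Hl : all_pos l) by (intros x Hx; apply H; right; auto).
  pose proof (bfactor_range b t ltac:(auto) Ht). specialize (IH Hl). split; nra.
Qed.

Lemma bprod_app (l l' : list R) (t : C) : bprod (l ++ l') t = bprod l t * bprod l' t.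
Proof. induction l as [|b l IH]; simpl; [ring|]. rewrite IH. ring. Qed.

Lemma bprod_repeat (b : R) n (t : C) :
  bprod (repeat b n) t = (Cmod (t - RtoC b) / Cmod (t + RtoC b)) ^ n.
Proof. induction n as [|n IH]; simpl; [reflexivity|]. rewrite IH. reflexivity. Qed.

(* Replacing [1/(t-z)] by [(1 - B(z)/B(t))/(t-z)], where [B = zprod/pprod], makes the
   integrand a rational function of [z] whose poles do not depend on [t]. *)
Lemma blaschke_integral_rational (H : R -> C) (sg : C) bs :
  ucont H -> 0 < Re sg -> all_pos bs ->
  exists N, is_poly (length bs) N /\ forall z, Re z < 0 ->
    Cint (fun u => H u * (1 - zprod bs z / pprod bs z * (pprod bs (RtoC u * sg) / zprod bs (RtoC u * sg)))
                   * / (RtoC u * sg - z))%C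
    = (N z / pprod bs z)%C.
Proof.
  intros Hc Hsg. 
  assert (HRe : forall u, unit_itv u -> 0 <= Re (RtoC u * sg)).
  { intros u [Hu _]. destruct sg as [x y]. simpl in *. nra. }
  assert (Hsgc : ucont (fun u => RtoC u * sg)%C) by (apply ucont_mult; [apply ucont_RtoC|apply ucont_const]).
  assert (Hpol : forall n p, is_poly n p -> ucont (fun u => p (RtoC u * sg)%C)).
  { intros n p Hp. apply (ucont_comp (fun _ => True) p); auto.
    intros t _. apply cdiff_ccont. eapply is_poly_cdiff, Hp. }
  induction bs as [|b l IH]; intros Hpos.
  - exists (fun _ => RtoC 0). split; [apply is_poly_const|]. intros z Hz.
    rewrite (Cint_ext _ (fun _ => RtoC 0)); [rewrite Cint_const; simpl; field|].
    intros u Hu. simpl. field.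
    apply Re_neq0. assert (unit_itv u) by (unfold unit_itv; lra). specialize (HRe u ltac:(auto)).
    destruct z as [z1 z2], sg as [x y]. simpl in *. lra.
  - assert (Hb : 0 < b) by (apply Hpos; left; reflexivity).
    assert (Hl : all_pos l) by (intros x Hx; apply Hpos; right; auto).
    destruct (IH Hl) as [N [HN HE]].
    (* From (z+b)(t-b) = (z-b)(t+b) + 2b(t-z), one more factor adds to the numerator a multiple of t
       - z, which cancels against the kernel. In what remains [z] and [t] separate, and [k] is the
       integral of the part in [t]. *)
    set (k := Cint (fun u => H u * (pprod l (RtoC u * sg) * / (zprod l (RtoC u * sg) * (RtoC u * sg + RtoC b))))%C).
    exists (fun z => N z * (z - RtoC b) + (- RtoC 2 * RtoC b * k) * zprod l z)%C. split.
    + simpl. apply is_poly_plus.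
      * replace (S (length l)) with (length l + 1)%nat by lia.
        apply is_poly_mult; [exact HN|].
        apply is_poly_ext with (fun z => 1 * z + (- RtoC b))%C; [intros; ring|apply is_poly_lin].
      * apply is_poly_scal, is_poly_S, is_poly_zprod.
    + intros z Hz.
      assert (Nz : forall u, unit_itv u -> (RtoC u * sg - z)%C <> RtoC 0).
      { intros u Hu. specialize (HRe u Hu). apply Re_neq0.
        destruct z as [z1 z2], sg as [x y]. simpl in *. lra. }
      assert (Nb : forall u, unit_itv u -> (RtoC u * sg + RtoC b)%C <> RtoC 0).
      { intros u Hu. specialize (HRe u Hu). apply Re_neq0.
        destruct sg as [x y]. simpl in *. lra. }
      assert (Nl : forall u, unit_itv u -> zprod l (RtoC u * sg) <> RtoC 0)
        by (intros u Hu; apply zprod_neq0; auto).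
      assert (Nq : pprod l z <> RtoC 0) by (apply pprod_neq0; auto; lra).
      assert (Nzb : (z - RtoC b)%C <> RtoC 0)
        by (apply Re_neq0; destruct z as [z1 z2]; simpl in *; lra).
      rewrite (Cint_ext _ (fun u =>
        H u * (1 - zprod l z / pprod l z * (pprod l (RtoC u * sg) / zprod l (RtoC u * sg))) * / (RtoC u * sg - z)
        + (- RtoC 2 * RtoC b * zprod l z / (pprod l z * (z - RtoC b))) *
          (H u * (pprod l (RtoC u * sg) * / (zprod l (RtoC u * sg) * (RtoC u * sg + RtoC b)))))%C).
      * assert (C2 : ucont (fun u => H u * (pprod l (RtoC u * sg) * / (zprod l (RtoC u * sg) * (RtoC u * sg + RtoC b))))%C).
        { apply ucont_mult; [exact Hc|]. apply ucont_mult; [apply (Hpol (length l)), is_poly_pprod|].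
          apply ucont_inv.
          - apply ucont_mult; [apply (Hpol (length l)), is_poly_zprod|].
            apply ucont_plus; [exact Hsgc|apply ucont_const].
          - intros u Hu. apply Cmult_neq_0; auto. }
        rewrite Cint_plus, Cint_scal, HE; [|exact Hz|exact C2| |].
        -- fold k. simpl. field. auto.
        -- apply ucont_mult; [apply ucont_mult; [exact Hc|]|].
           ++ apply (ucont_plus (fun _ => RtoC 1)); [apply ucont_const|].
              apply ucont_ext with (fun u => (- RtoC 1 * (zprod l z / pprod l z)) * (pprod l (RtoC u * sg) * / zprod l (RtoC u * sg)))%C.
              { intros u Hu. unfold Cdiv. ring. }
              apply ucont_mult; [apply ucont_const|].
              apply ucont_mult; [apply (Hpol (length l)), is_poly_pprod|].
              apply ucont_inv; [apply (Hpol (length l)), is_poly_zprod|]. auto.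
           ++ apply ucont_inv; [|auto]. apply ucont_plus; [exact Hsgc|apply ucont_const].
        -- apply ucont_scal, C2.
      * intros u Hu. assert (Uu : unit_itv u) by (unfold unit_itv; lra).
        specialize (Nz u Uu). specialize (Nb u Uu). specialize (Nl u Uu).
        simpl. field. repeat split; auto.
Qed.

(** The majorant u^(dl-1) may be unbounded at 0, so it is integrated over [h,1] only, by its
    primitive u^dl/dl. On [0,h] continuity of [phi] at 0 gives at most eps. *)
Lemma Cint_Rpower_bound (phi : R -> C) (A dl : R) : ucont phi -> 0 < dl ->
  (forall u, 0 < u <= 1 -> Cmod (phi u) <= A * Rpower u (dl - 1)) -> Cmod (Cint phi) <= A / dl.
Proof.
  intros Hc Hdl HA.
  assert (A0 : 0 <= A).
  { specialize (HA 1 ltac:(lra)). unfold Rpower in HA. rewrite ln_1, Rmult_0_r, exp_0 in HA.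
    pose proof (Cmod_ge_0 (phi 1)). lra. }
  assert (U0 : unit_itv 0) by (unfold unit_itv; lra).
  destruct (proj1 (ucont_spec phi) Hc 0 U0 1 Rlt_0_1) as [r [Hr Hnear]].
  apply le_epsilon. intros eps Heps.
  set (B := Cmod (phi 0) + 1). assert (HB : 0 < B) by (unfold B; pose proof (Cmod_ge_0 (phi 0)); lra).
  set (h := Rmin (1 / 2) (Rmin (r / 2) (eps / B))).
  assert (HeB : 0 < eps / B) by (apply Rdiv_lt_0_compat; lra).
  assert (Hh : 0 < h <= 1 / 2 /\ h < r /\ h <= eps / B) by (unfold h, Rmin; repeat destruct Rle_dec; lra).
  assert (Uh : unit_itv h) by (unfold unit_itv; lra).
  assert (U1 : unit_itv 1) by (unfold unit_itv; lra).
  assert (Split : Cint phi = (RInt (V := CR) phi 0 h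
                              + RInt (V := CR) phi h 1)%C).
  { symmetry. apply (RInt_Chasles (V := CR)); apply ucont_ex_Cint_sub; auto. }
  rewrite Split. eapply Rle_trans; [apply Cmod_triangle|]. rewrite Rplus_comm. apply Rplus_le_compat.
  - set (prim := fun u => A * (Rpower u dl / dl)).
    assert (Hd : forall u, 0 < u -> is_derive prim u (A * Rpower u (dl - 1))).
    { intros u Hu. unfold prim.
      assert (D : is_derive (fun v => Rpower v dl) u (dl * Rpower u (dl - 1)))
        by (apply is_derive_Reals, derivable_pt_lim_power; exact Hu).
      replace (A * Rpower u (dl - 1)) with (A / dl * (dl * Rpower u (dl - 1))) by (field; lra).
      apply (is_derive_ext (fun v => A / dl * Rpower v dl)); [intros v; match goal with |- ?x = ?y => change (@eq R x y) end; field; lra|].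
      apply is_derive_scal, D. }
    assert (I : is_RInt (fun u => A * Rpower u (dl - 1)) h 1 (prim 1 - prim h)).
    { apply (is_RInt_derive (V := R_CompleteNormedModule) prim).
      - intros u Hu. rewrite Rmin_left in Hu by lra. apply Hd; lra.
      - intros u Hu. rewrite Rmin_left in Hu by lra.
        apply (continuous_scal_r (K := R_AbsRing) (V := R_NormedModule) A).
        apply (ex_derive_continuous (K := R_AbsRing) (V := R_NormedModule)).
        exists ((dl - 1) * Rpower u (dl - 1 - 1)). apply is_derive_Reals, derivable_pt_lim_power. lra. }
    apply Rle_trans with (prim 1 - prim h).
    + rewrite Cmod_norm.
      apply (norm_RInt_le (V := C_R_NormedModule) phi (fun u => A * Rpower u (dl - 1)) h 1); [lra| | |exact I].
      * intros u Hu. eapply Rle_trans; [|apply (HA u); lra]. rewrite Cmod_norm. apply Rle_refl.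
      * apply (RInt_correct (V := CR)), ucont_ex_Cint_sub; auto.
    + unfold prim. unfold Rpower at 1. rewrite ln_1, Rmult_0_r, exp_0.
      assert (0 <= A * (Rpower h dl / dl)).
      { apply Rmult_le_pos; [exact A0|]. apply Rlt_le, Rdiv_lt_0_compat; [apply exp_pos|exact Hdl]. }
      unfold Rdiv in *. lra.
  - rewrite <- (Cint_affine phi 0 h) by auto. rewrite Cmod_mult, Cmod_R, Rminus_0_r, Rabs_right by lra.
    assert (Q : Cmod (Cint (fun u => phi (0 + u * h))) <= B).
    { apply Cint_bound.
      - apply ucont_spec. intros u Hu e0 He0.
        assert (Uu : forall v, unit_itv v -> unit_itv (0 + v * h)) by (unfold unit_itv; intros; nra).
        destruct (proj1 (ucont_spec phi) Hc _ (Uu u Hu) e0 He0) as [eta [E1 E2]].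
        exists eta. split; [exact E1|]. intros v Hv Hvu. apply E2; [auto|].
        replace (0 + v * h - (0 + u * h)) with (h * (v - u)) by ring.
        rewrite Rabs_mult, (Rabs_right h) by lra. pose proof (Rabs_pos (v - u)). nra.
      - intros u [Hu0 Hu1].
        assert (Uu : unit_itv (0 + u * h)) by (unfold unit_itv; nra).
        specialize (Hnear _ Uu).
        replace (phi (0 + u * h)) with ((phi (0 + u * h)%R - phi 0) + phi 0)%C by ring.
        eapply Rle_trans; [apply Cmod_triangle|]. unfold B.
        assert (Cmod (phi (0 + u * h) - phi 0) < 1); [|lra].
        apply Hnear. rewrite Rabs_right; nra. }
    apply Rle_trans with (eps / B * B); [|right; field; lra].
    apply Rmult_le_compat; try lra. apply Cmod_ge_0.
Qed.

(** The number [k] of dyadic scales is kept apart from the multiplicity [m], for induction on [k]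
    alone. *)
Fixpoint cluster (m k : nat) : list R :=
  match k with O => nil | S k => (repeat ((1 / 2) ^ k) m ++ cluster m k)%list end.
(* The [m^2] poles at [1] give the rate [exp (- c m^2)] away from the boundary. *)
Definition poles m : list R := (repeat 1 (m * m) ++ cluster m m)%list.

Lemma cluster_length (m k : nat) : length (cluster m k) = (k * m)%nat.
Proof. induction k as [|k IH]; simpl; [reflexivity|]. rewrite length_app, repeat_length, IH. reflexivity. Qed.

Lemma poles_length m : length (poles m) = (2 * (m * m))%nat.
Proof. unfold poles. rewrite length_app, repeat_length, cluster_length. lia. Qed.

Lemma cluster_pos (m k : nat) : all_pos (cluster m k).
Proof.
  induction k as [|k IH]; simpl; intros b Hb; [destruct Hb|].
  apply in_app_or in Hb. destruct Hb as [Hb|Hb]; [|apply IH, Hb].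
  apply repeat_spec in Hb. subst. apply pow_lt. lra.
Qed.

Lemma poles_pos m : all_pos (poles m).
Proof.
  intros b Hb. apply in_app_or in Hb. destruct Hb as [Hb|Hb]; [|eapply cluster_pos, Hb].
  apply repeat_spec in Hb. subst. lra.
Qed.

Local Notation diag e u := (RtoC u * (1, e))%C.

(** The points u (1 + i e) with e = 1 or e = -1 form the two legs of a tent, seen from their feet.
    With x = u/b the squared claim is 18 x^2 - 82 x + 9 <= 0, which by convexity is decided at x =
    1/2 and x = 1; scale invariance makes the constant independent of b. *)
Lemma bfactor_diagonal (e b u : R) : e ^ 2 = 1 -> 0 < b -> b / 2 <= u <= b ->
  Cmod (diag e u - RtoC b) / Cmod (diag e u + RtoC b) <= 4 / 5.
Proof.
  intros He Hb Hu.
  assert (N : 0 < Cmod (diag e u + RtoC b)).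
  { apply Cmod_gt_0, Re_neq0. simpl. lra. }
  pose proof (Cmod_ge_0 (diag e u - RtoC b)) as P.
  apply Rmult_le_reg_r with (Cmod (diag e u + RtoC b)); [exact N|].
  unfold Rdiv at 1. rewrite Rmult_assoc, Rinv_l, Rmult_1_r by lra.
  apply Rsqr_incr_0_var; [|lra].
  unfold Rsqr. pose proof (Cmod_sqr (diag e u - RtoC b)) as E1.
  pose proof (Cmod_sqr (diag e u + RtoC b)) as E2. simpl fst in *. simpl snd in *.
  ring_simplify in E1. ring_simplify in E2. rewrite He in E1, E2.
  replace (4 / 5 * Cmod (diag e u + RtoC b) * (4 / 5 * Cmod (diag e u + RtoC b)))
    with (16 / 25 * Cmod (diag e u + RtoC b) ^ 2) by field.
  replace (Cmod (diag e u - RtoC b) * Cmod (diag e u - RtoC b))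
    with (Cmod (diag e u - RtoC b) ^ 2) by ring.
  rewrite E1, E2. nra.
Qed.

(** Some scale b of the cluster has b/2 <= u <= b and contributes (4/5)^m, the other factors being
    at most 1. If u is above the smallest scale, it is found by induction among the larger ones; at
    the largest scale 1 this leaves u = 1. *)
Lemma cluster_bound (e u : R) (m k : nat) : e ^ 2 = 1 -> (1 / 2) ^ k <= u <= 1 -> 0 < u ->
  (0 < k)%nat -> bprod (cluster m k) (diag e u) <= (4 / 5) ^ m.
Proof.
  intros He Hu Hu0 Hk.
  assert (HRe : 0 <= Re (diag e u)) by (simpl; lra).
  induction k as [|k IH]; [lia|]. simpl cluster. rewrite bprod_app, bprod_repeat.
  pose proof (bprod_range (cluster m k) _ (cluster_pos m k) HRe) as R1.
  assert (Hb : 0 < (1 / 2) ^ k) by (apply pow_lt; lra).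
  pose proof (bfactor_range ((1 / 2) ^ k) _ Hb HRe) as R2.
  pose proof (pow_le _ m (proj1 R2)) as R3.
  pose proof (pow_incr _ 1 m (conj (proj1 R2) (proj2 R2))) as R4. rewrite pow1 in R4.
  destruct (Rle_or_lt ((1 / 2) ^ k) u) as [L|L].
  - destruct k as [|k].
    + assert (u = 1) by (simpl in L; lra). subst.
      assert (F := bfactor_diagonal e ((1 / 2) ^ 0) 1 He ltac:(simpl; lra) ltac:(simpl; lra)).
      pose proof (pow_incr _ (4 / 5) m (conj (proj1 R2) F)). nra.
    + specialize (IH ltac:(lra) ltac:(lia)). nra.
  - assert (F := bfactor_diagonal e _ u He Hb ltac:(simpl in Hu; lra)).
    pose proof (pow_incr _ (4 / 5) m (conj (proj1 R2) F)). nra.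
Qed.

Lemma exp_le (x y : R) : x <= y -> exp x <= exp y.
Proof. intros [H| ->]; [left; apply exp_increasing, H|lra]. Qed.

Lemma pow_le_exp (x c : R) n : 0 <= x -> x <= 1 - c -> x ^ n <= exp (- c * INR n).
Proof.
  intros Hx Hc.
  replace (exp (- c * INR n)) with (exp (- c) ^ n).
  - apply pow_incr. split; [exact Hx|]. pose proof (exp_ineq1_le (- c)). lra.
  - induction n as [|n IH]; [simpl; rewrite Rmult_0_r, exp_0; reflexivity|].
    rewrite S_INR. simpl pow. rewrite IH, <- exp_plus. f_equal. ring.
Qed.

Lemma poles_bound_segment (dl e : R) : 0 < dl -> e ^ 2 = 1 ->
  (* Two regimes: for u >= 2^-m the poles give (4/5)^m <= exp (-m/5), and for smaller u the power
     gives at most 2^(-m dl/2). *)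
  exists c0, 0 < c0 /\ forall m u, 0 < u <= 1 ->
    bprod (poles m) (diag e u) * Rpower u (dl / 2) <= exp (- c0 * INR m).
Proof.
  intros Hdl He. exists (Rmin (1 / 5) (dl / 2 * ln 2)).
  assert (L2 : 0 < ln 2) by (rewrite <- ln_1; apply ln_increasing; lra).
  assert (L3 : 0 < dl / 2 * ln 2) by nra.
  split; [unfold Rmin; destruct Rle_dec; lra|].
  intros m u Hu.
  assert (HRe : 0 <= Re (diag e u)) by (simpl; lra).
  assert (Hp1 : Rpower u (dl / 2) <= 1).
  { unfold Rpower. rewrite <- exp_0. destruct (Req_dec u 1) as [->|N].
    - rewrite ln_1, Rmult_0_r. lra.
    - left. apply exp_increasing. assert (ln u < 0) by (rewrite <- ln_1; apply ln_increasing; lra). nra. }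
  assert (Hp0 : 0 < Rpower u (dl / 2)) by apply exp_pos.
  pose proof (pos_INR m) as Hm.
  unfold poles. rewrite bprod_app.
  pose proof (bprod_range (repeat 1 (m * m)) _ (fun b Hb => eq_ind_r (fun x => 0 < x) Rlt_0_1 (repeat_spec _ _ _ Hb)) HRe) as R1.
  pose proof (bprod_range (cluster m m) _ (cluster_pos m m) HRe) as R2.
  set (x1 := bprod (repeat 1 (m * m)) (diag e u)) in *.
  destruct (Rle_or_lt ((1 / 2) ^ m) u) as [L|L].
  - assert (B : bprod (cluster m m) (diag e u) <= exp (- (1 / 5) * INR m)).
    { destruct m as [|m]; [simpl; rewrite Rmult_0_r, exp_0; lra|].
      eapply Rle_trans; [apply cluster_bound; auto; [lra|lra|lia]|]. apply pow_le_exp; lra. }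
    apply Rle_trans with (bprod (cluster m m) (diag e u)).
    + set (x2 := bprod (cluster m m) (diag e u)) in *.
      assert (x1 * x2 <= 1 * x2) by (apply Rmult_le_compat_r; lra).
      assert (0 <= x1 * x2) by (apply Rmult_le_pos; lra). nra.
    + eapply Rle_trans; [exact B|].
      assert (Rmin (1 / 5) (dl / 2 * ln 2) <= 1 / 5) by apply Rmin_l.
      assert (H5 : - (1 / 5) * INR m <= - Rmin (1 / 5) (dl / 2 * ln 2) * INR m) by nra.
      apply exp_le, H5.
  - assert (B : Rpower u (dl / 2) <= exp (- (dl / 2 * ln 2) * INR m)).
    { apply Rlt_le. unfold Rpower. apply exp_increasing.
      assert (ln u < ln ((1 / 2) ^ m)) by (apply ln_increasing; lra).
      rewrite ln_pow in H by lra. unfold Rdiv in H at 1. rewrite Rmult_1_l, ln_Rinv in H by lra. nra. }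
    apply Rle_trans with (Rpower u (dl / 2)).
    + set (x2 := bprod (cluster m m) (diag e u)) in *.
      assert (0 <= x1 * x2 <= 1) by (split; [apply Rmult_le_pos; lra|nra]). nra.
    + eapply Rle_trans; [exact B|].
      assert (Rmin (1 / 5) (dl / 2 * ln 2) <= dl / 2 * ln 2) by apply Rmin_r.
      assert (H5 : - (dl / 2 * ln 2) * INR m <= - Rmin (1 / 5) (dl / 2 * ln 2) * INR m) by nra.
      apply exp_le, H5.
Qed.

(** Only the poles at 1 are used. For t = -z one has |t-1|^2/|t+1|^2 = 1 - 4 Re t/|t+1|^2, at most 1
    - 2s with s = 2d/(X+1)^2, and the square root of 1 - 2s is at most 1 - s. *)
Lemma poles_bound_inside (d X : R) m z : 0 < d -> Re z <= - d -> Cmod z <= X ->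
  bprod (poles m) (- z)%C <= exp (- (2 * d / (X + 1) ^ 2) * INR (m * m)).
Proof.
  intros Hd Hz HX. pose proof (Cmod_ge_0 z) as Hz0.
  assert (HRe : 0 <= Re (- z)%C) by (destruct z; simpl in *; lra).
  unfold poles. rewrite bprod_app, bprod_repeat.
  pose proof (bprod_range (cluster m m) _ (cluster_pos m m) HRe) as R2.
  pose proof (bfactor_range 1 _ Rlt_0_1 HRe) as R1.
  apply Rle_trans with ((Cmod (- z - RtoC 1) / Cmod (- z + RtoC 1)) ^ (m * m)).
  { pose proof (pow_le _ (m * m) (proj1 R1)). nra. }
  apply pow_le_exp; [apply R1|].
  set (s := 2 * d / (X + 1) ^ 2).
  assert (HX1 : 0 < (X + 1) ^ 2) by (apply pow_lt; lra).
  assert (Hs : s * (X + 1) ^ 2 = 2 * d) by (unfold s; field; lra).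
  assert (Hs0 : 0 < s) by (unfold s; apply Rdiv_lt_0_compat; lra).
  assert (N : 0 < Cmod (- z + RtoC 1)).
  { apply Cmod_gt_0, Re_neq0. destruct z; simpl in *; lra. }
  assert (NX : Cmod (- z + RtoC 1) <= X + 1).
  { eapply Rle_trans; [apply Cmod_triangle|]. rewrite Cmod_opp, Cmod_1. lra. }
  set (p := Cmod (- z - RtoC 1) / Cmod (- z + RtoC 1)) in *.
  assert (Ep : p * Cmod (- z + RtoC 1) = Cmod (- z - RtoC 1)) by (unfold p; field; lra).
  set (q := Cmod (- z + RtoC 1)) in *.
  assert (E : p ^ 2 * q ^ 2 <= q ^ 2 - 4 * d).
  { pose proof (Cmod_sqr (- z - RtoC 1)) as E1. pose proof (Cmod_sqr (- z + RtoC 1)) as E2.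
    fold q in E2. rewrite <- Ep in E1. destruct z as [x y]. simpl fst in *. simpl snd in *.
    simpl in Hz. nra. }
  assert (Eq : q ^ 2 <= (X + 1) ^ 2) by (apply pow_incr; lra).
  assert (Hq : 0 < q ^ 2) by (apply pow_lt; lra).
  assert (F : p ^ 2 <= 1 - 2 * s).
  { apply Rmult_le_reg_r with (q ^ 2); [exact Hq|]. nra. }
  assert (p <= 1 - s); [|lra]. nra.
Qed.

(** The error is B(z) times the integral of H(t)/(B(t)(t-z)). The first rate uses |B(z)| <= 1 and
    the smallness of u^(dl/2)/|B(t)|, the second 1/|B(t)| <= 1 and the smallness of |B(z)|. *)
Lemma diagonal_integral_approx (H : R -> C) (e M dl : R) :
  ucont H -> e ^ 2 = 1 -> 0 < dl -> (forall u, 0 < u <= 1 -> Cmod (H u) <= M * Rpower u dl) ->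
  exists (N : nat -> C -> C) (B c0 : R), 0 < c0 /\
    forall m, is_poly (2 * (m * m)) (N m) /\
      (forall z, Re z < 0 ->
        Cmod (Cint (fun u => H u * / (diag e u - z))%C - N m z / pprod (poles m) z)
          <= B * exp (- c0 * INR m)) /\
      (forall d X z, 0 < d -> Re z <= - d -> Cmod z <= X ->
        Cmod (Cint (fun u => H u * / (diag e u - z))%C - N m z / pprod (poles m) z)
          <= B * exp (- (2 * d / (X + 1) ^ 2) * INR (m * m))).
Proof.
  intros Hc He Hdl HM.
  assert (M0 : 0 <= M).
  { specialize (HM 1 ltac:(lra)). unfold Rpower in HM. rewrite ln_1, Rmult_0_r, exp_0 in HM.
    pose proof (Cmod_ge_0 (H 1)). lra. }
  destruct (poles_bound_segment dl e Hdl He) as [c0 [Hc0 Hseg]].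
  assert (Hsg : 0 < Re (1, e)) by (simpl; lra).
  set (Nex := fun m => blaschke_integral_rational H (1, e) (poles m) Hc Hsg (poles_pos m)).
  set (N := fun m => proj1_sig (constructive_indefinite_description _ (Nex m))).
  assert (HN : forall m, is_poly (length (poles m)) (N m) /\ forall z, Re z < 0 ->
    Cint (fun u => H u * (1 - zprod (poles m) z / pprod (poles m) z
        * (pprod (poles m) (diag e u) / zprod (poles m) (diag e u)))
                   * / (diag e u - z))%C
    = (N m z / pprod (poles m) z)%C).
  { intro m. exact (proj2_sig (constructive_indefinite_description _ (Nex m))). }
  clearbody N. clear Nex.
  assert (Hsgc : ucont (fun u => diag e u)%C) by (apply ucont_mult; [apply ucont_RtoC|apply ucont_const]).
  assert (Hpol : forall n p, is_poly n p -> ucont (fun u => p (diag e u))).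
  { intros n p Hp. apply (ucont_comp (fun _ => True) p); auto.
    intros t _. apply cdiff_ccont. eapply is_poly_cdiff, Hp. }
  assert (Err : forall m z, Re z < 0 ->
    Cmod (Cint (fun u => H u * / (diag e u - z))%C - N m z / pprod (poles m) z)
      <= bprod (poles m) (- z)%C * (M * exp (- c0 * INR m)) / (dl / 2) /\
    Cmod (Cint (fun u => H u * / (diag e u - z))%C - N m z / pprod (poles m) z)
      <= bprod (poles m) (- z)%C * M / dl).
  { intros m z Hz. destruct (HN m) as [_ HNm]. rewrite <- HNm by exact Hz.
    set (bs := poles m). assert (Hpos := poles_pos m). fold bs in Hpos.
    (* As Re z < 0, |t-z| >= Re (t-z) >= u. *)
    assert (Nz : forall u, 0 <= u -> u <= Cmod (diag e u - z) /\ (diag e u - z)%C <> RtoC 0).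
    { intros u Hu. split.
      - eapply Rle_trans; [|apply re_le_Cmod]. eapply Rle_trans; [|apply RRle_abs].
        destruct z as [x y]. simpl in *. lra.
      - apply Re_neq0. destruct z as [x y]. simpl in *. lra. }
    assert (HRe : forall u, 0 <= u -> 0 <= Re (diag e u)) by (intros; simpl; lra).
    assert (Ck : ucont (fun u => / (diag e u - z))%C).
    { apply ucont_inv; [apply ucont_plus; [exact Hsgc|apply ucont_const]|]. intros u [Hu _]. apply Nz, Hu. }
    assert (Cq : ucont (fun u => pprod bs (diag e u) / zprod bs (diag e u))%C).
    { apply ucont_mult; [apply (Hpol (length bs)), is_poly_pprod|].
      apply ucont_inv; [apply (Hpol (length bs)), is_poly_zprod|].
      intros u [Hu _]. apply zprod_neq0; auto. }
    set (phi := fun u => (zprod bs z / pprod bs z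
       * (H u * (pprod bs (diag e u) / zprod bs (diag e u)) * / (diag e u - z)))%C).
    assert (Cphi : ucont phi).
    { apply ucont_mult; [apply ucont_const|]. apply ucont_mult; [apply ucont_mult; auto|exact Ck]. }
    match goal with |- Cmod ?D <= _ /\ _ => replace D with (Cint phi) end.
    2:{ unfold Cminus at 1.
        match goal with |- _ = (_ + - Cint ?g)%C => replace (- Cint g)%C with (- RtoC 1 * Cint g)%C by ring end.
        assert (Cg : ucont (fun u => (H u * (1 - zprod bs z / pprod bs z *
           (pprod bs (diag e u) / zprod bs (diag e u))) * / (diag e u - z))%C)).
        { apply ucont_mult; [apply ucont_mult; [exact Hc|]|exact Ck].
          apply (ucont_plus (fun _ => RtoC 1)); [apply ucont_const|].
          apply ucont_ext with (fun u => (- RtoC 1 * (zprod bs z / pprod bs z)) * (pprod bs (diag e u) / zprod bs (diag e u)))%C.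
          { intros u Hu. ring. }
          apply ucont_scal, Cq. }
        rewrite <- Cint_scal, <- Cint_plus by
          (first [exact Cg | apply ucont_mult; [exact Hc|exact Ck] | apply ucont_scal, Cg]).
        apply Cint_ext. intros u Hu. unfold phi. ring. }
    assert (Bz := bprod_opp_quotient bs z Hpos ltac:(lra)).
    pose proof (bprod_range bs (- z)%C Hpos ltac:(destruct z; simpl in *; lra)) as Rz.
    assert (Bphi : forall u, 0 < u <= 1 ->
      Cmod (phi u) <= bprod bs (- z)%C * (M * Rpower u (dl - 1) * bprod bs (diag e u))).
    { intros u Hu. unfold phi. rewrite Cmod_mult, Bz. apply Rmult_le_compat_l; [apply Rz|].
      rewrite !Cmod_mult, bprod_quotient by (auto; apply HRe; lra).
      destruct (Nz u ltac:(lra)) as [Nz1 Nz2].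
      rewrite Cmod_inv by exact Nz2.
      pose proof (bprod_range bs _ Hpos (HRe u ltac:(lra))) as Ru.
      assert (I : / Cmod (diag e u - z) <= / u) by (apply Rinv_le_contravar; lra).
      assert (I0 : 0 <= / Cmod (diag e u - z))
        by (apply Rlt_le, Rinv_0_lt_compat, Cmod_gt_0, Nz2).
      assert (EP : Rpower u (dl - 1) = Rpower u dl * / u).
      { unfold Rminus. rewrite Rpower_plus, Rpower_Ropp, Rpower_1 by lra. reflexivity. }
      rewrite EP. specialize (HM u Hu). pose proof (Cmod_ge_0 (H u)).
      replace (M * (Rpower u dl * / u) * bprod bs (diag e u))
        with ((M * Rpower u dl * bprod bs (diag e u)) * / u) by ring.
      apply Rmult_le_compat; auto.
      - apply Rmult_le_pos; lra.
      - apply Rmult_le_compat_r; lra. }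
    split.
    - apply Cint_Rpower_bound; [exact Cphi|lra|]. intros u Hu.
      eapply Rle_trans; [apply Bphi, Hu|].
      (* The exponent is shared: u^(dl/2-1) stays integrable, and u^(dl/2) is what [Hseg] needs. *)
      replace (dl - 1) with ((dl / 2 - 1) + dl / 2) by field. rewrite Rpower_plus.
      assert (0 < Rpower u (dl / 2 - 1)) by apply exp_pos.
      specialize (Hseg m u Hu). fold bs in Hseg.
      replace (bprod bs (- z)%C * (M * exp (- c0 * INR m)) * Rpower u (dl / 2 - 1))
        with ((bprod bs (- z)%C * M * Rpower u (dl / 2 - 1)) * exp (- c0 * INR m)) by ring.
      replace (bprod bs (- z)%C * (M * (Rpower u (dl / 2 - 1) * Rpower u (dl / 2)) * bprod bs (diag e u)))
        with ((bprod bs (- z)%C * M * Rpower u (dl / 2 - 1)) * (bprod bs (diag e u) * Rpower u (dl / 2))) by ring.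
      apply Rmult_le_compat_l; [|exact Hseg].
      apply Rmult_le_pos; [apply Rmult_le_pos|]; lra.
    - apply Cint_Rpower_bound; [exact Cphi|exact Hdl|]. intros u Hu.
      eapply Rle_trans; [apply Bphi, Hu|].
      pose proof (bprod_range bs _ Hpos (HRe u ltac:(lra))) as Ru.
      assert (0 < Rpower u (dl - 1)) by apply exp_pos.
      replace (bprod bs (- z)%C * (M * Rpower u (dl - 1) * bprod bs (diag e u)))
        with (bprod bs (- z)%C * M * Rpower u (dl - 1) * bprod bs (diag e u)) by ring.
      rewrite <- (Rmult_1_r (bprod bs (- z)%C * M * Rpower u (dl - 1))) at 2.
      apply Rmult_le_compat_l; [|lra]. apply Rmult_le_pos; [apply Rmult_le_pos|]; lra. }
  (* 2M/dl is M/(dl/2), from the integral of u^(dl/2-1); the second estimate fits under the same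
     constant. *)
  exists N, (2 * M / dl), c0. split; [exact Hc0|]. intros m. split; [|split].
  - rewrite <- poles_length. apply HN.
  - intros z Hz. eapply Rle_trans; [apply (proj1 (Err m z Hz))|].
    pose proof (bprod_range (poles m) (- z)%C (poles_pos m) ltac:(destruct z; simpl in *; lra)) as Rz.
    assert (0 < exp (- c0 * INR m)) by apply exp_pos.
    apply Rle_trans with (1 * (M * exp (- c0 * INR m)) / (dl / 2)); [|right; field; lra].
    apply Rmult_le_compat_r; [apply Rlt_le, Rinv_0_lt_compat; lra|].
    apply Rmult_le_compat_r; [apply Rmult_le_pos; lra|lra].
  - intros d X z Hd Hz HX. eapply Rle_trans; [apply (proj2 (Err m z ltac:(lra)))|].
    pose proof (poles_bound_inside d X m z Hd Hz HX) as Q.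
    replace (2 * M / dl * exp (- (2 * d / (X + 1) ^ 2) * INR (m * m)))
      with (exp (- (2 * d / (X + 1) ^ 2) * INR (m * m)) * (2 * (M / dl))) by (field; lra).
    unfold Rdiv at 1. rewrite Rmult_assoc.
    assert (0 <= M / dl) by (apply Rmult_le_pos; [lra|apply Rlt_le, Rinv_0_lt_compat; lra]).
    pose proof (exp_pos (- (2 * d / (X + 1) ^ 2) * INR (m * m))). unfold Rdiv in *. nra.
Qed.

(** * Geometry of the polygon *)

Implicit Types (k : nat) (w : nat -> C).

Local Notation side k w i := (seg (w i) (w (next k i))).

(* [sum_n] leaves equations typed at a Coquelicot carrier, which [ring] does not recognise. *)
Ltac eqC := match goal with |- ?x = ?y => change (@eq C x y) end.
Ltac eqR := match goal with |- ?x = ?y => change (@eq R x y) end.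

Ltac cring := first [ring | eqC; ring | eqR; ring].

Lemma cross_plus_r (d u v : C) : cross d (u + v) = cross d u + cross d v.
Proof. destruct d, u, v. unfold cross, Cconj. simpl. cring. Qed.

Lemma cross_minus_r (d u v : C) : cross d (u - v) = cross d u - cross d v.
Proof. destruct d, u, v. unfold cross, Cconj. simpl. cring. Qed.

Lemma cross_scal_r (d v : C) (x : R) : cross d (RtoC x * v) = x * cross d v.
Proof. destruct d, v. unfold cross, Cconj. simpl. cring. Qed.

Lemma cross_self (d : C) : cross d d = 0.
Proof. destruct d. unfold cross, Cconj. simpl. cring. Qed.

Lemma cross_0_r (d : C) : cross d (RtoC 0) = 0.
Proof. destruct d. unfold cross, Cconj. simpl. cring. Qed.

Lemma cross_bound (d v : C) : Rabs (cross d v) <= Cmod d * Cmod v.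
Proof.
  unfold cross. rewrite <- (Cmod_conj d), <- Cmod_mult.
  eapply Rle_trans; [|apply (Rmax_Cmod (Cconj d * v)%C)]. apply Rmax_r.
Qed.

Lemma sum_n_C_lin (x y z : nat -> C) (a b c : C) n :
  sum_n (fun j => a * x j + b * y j + c * z j)%C n = (a * sum_n x n + b * sum_n y n + c * sum_n z n)%C.
Proof.
  induction n as [|n IH]; [rewrite !sum_O; reflexivity|]. rewrite !sum_Sn, IH.
  change (plus ?p ?q) with (Cplus p q). cring.
Qed.

Lemma sum_n_R_lin (x y z : nat -> R) (a b c : R) n :
  sum_n (fun j => a * x j + b * y j + c * z j) n = a * sum_n x n + b * sum_n y n + c * sum_n z n.
Proof.
  induction n as [|n IH]; [rewrite !sum_O; reflexivity|]. rewrite !sum_Sn, IH.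
  change (plus ?p ?q) with (Rplus p q). cring.
Qed.

Lemma sum_n_nonneg (x : nat -> R) n : (forall j, (j <= n)%nat -> 0 <= x j) -> 0 <= sum_n x n.
Proof.
  intros H. induction n as [|n IH]; [rewrite sum_O; apply H; lia|]. rewrite sum_Sn.
  change (plus ?p ?q) with (Rplus p q). assert (0 <= x (S n)) by (apply H; lia).
  assert (0 <= sum_n x n) by (apply IH; auto). lra.
Qed.

Lemma cross_sum_n (d : C) (t : nat -> R) (w : nat -> C) n :
  cross d (sum_n (fun j => RtoC (t j) * w j)%C n) = sum_n (fun j => t j * cross d (w j)) n.
Proof.
  induction n as [|n IH]; [rewrite !sum_O; apply cross_scal_r|]. rewrite !sum_Sn.
  change (plus ?p ?q) with (Cplus p q) at 1. rewrite cross_plus_r, IH, cross_scal_r. reflexivity.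
Qed.

Lemma region_bary k w (a b c : C) (x y : R) :
  region k w a -> region k w b -> region k w c -> in_simplex x y -> region k w (bary a b c x y).
Proof.
  intros [ta [A1 [A2 A3]]] [tb [B1 [B2 B3]]] [tc [C1 [C2 C3]]] [Hx [Hy Hxy]].
  exists (fun j => (1 - x - y) * ta j + x * tb j + y * tc j). split; [|split].
  - intros j. specialize (A1 j). specialize (B1 j). specialize (C1 j). nra.
  - rewrite sum_n_R_lin, A2, B2, C2. cring.
  - rewrite (sum_n_ext _ (fun j => RtoC (1 - x - y) * (RtoC (ta j) * w j) + RtoC x * (RtoC (tb j) * w j)
               + RtoC y * (RtoC (tc j) * w j))%C).
    + rewrite sum_n_C_lin, <- A3, <- B3, <- C3. unfold bary. rewrite !RtoC_minus. cring.
    + intros j. rewrite !RtoC_plus, !RtoC_mult. cring.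
Qed.

Lemma region_seg k w (a b : C) (u : R) :
  region k w a -> region k w b -> unit_itv u -> region k w (seg a b u).
Proof.
  intros Ha Hb Hu. replace (seg a b u) with (bary a b a u 0) by (unfold seg, bary; cring).
  apply region_bary; auto. unfold in_simplex, unit_itv in *. lra.
Qed.

Lemma sum_n_single (x : nat -> R) (m n : nat) : (m <= n)%nat ->
  sum_n (fun j => (if Nat.eqb j m then 1 else 0) * x j) n = x m.
Proof.
  intros H.
  assert (Z : forall p, (p < m)%nat -> sum_n (fun j => (if Nat.eqb j m then 1 else 0) * x j) p = 0).
  { induction p as [|p IH]; intros Hp.
    - rewrite sum_O. rewrite (proj2 (Nat.eqb_neq 0 m)) by lia. cring.
    - rewrite sum_Sn, IH by lia. rewrite (proj2 (Nat.eqb_neq (S p) m)) by lia.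
      change (plus ?p ?q) with (Rplus p q). cring. }
  induction n as [|n IH].
  - replace m with 0%nat by lia. rewrite sum_O. simpl. cring.
  - rewrite sum_Sn. change (plus ?p ?q) with (Rplus p q).
    destruct (Nat.eq_dec m (S n)) as [E|E].
    + subst m. rewrite Nat.eqb_refl, Z by lia. cring.
    + rewrite IH by lia. rewrite (proj2 (Nat.eqb_neq (S n) m)) by lia. cring.
Qed.

Lemma region_corner k w m : (m < k)%nat -> region k w (w m).
Proof.
  intros H. exists (fun j => if Nat.eqb j m then 1 else 0). split; [|split].
  - intros j. destruct Nat.eqb; lra.
  - rewrite (sum_n_ext _ (fun j => (if Nat.eqb j m then 1 else 0) * 1)) by (intros; cring).
    apply (sum_n_single (fun _ => 1)). lia.
  - assert (E : forall n, sum_n (fun j => RtoC (if Nat.eqb j m then 1 else 0) * w j)%C n =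
      (sum_n (fun j => (if Nat.eqb j m then 1 else 0) * fst (w j)) n,
       sum_n (fun j => (if Nat.eqb j m then 1 else 0) * snd (w j)) n)).
    { induction n as [|n IH].
      - rewrite !sum_O. apply injective_projections; simpl; cring.
      - rewrite !sum_Sn, IH. apply injective_projections; simpl; unfold plus; simpl; cring. }
    rewrite E, (sum_n_single (fun j => fst (w j))), (sum_n_single (fun j => snd (w j))) by lia.
    apply surjective_pairing.
Qed.

Lemma region_bounded k w : exists X, 0 < X /\ forall z, region k w z -> Cmod z <= X.
Proof.
  assert (B : forall n, exists X, 0 < X /\ forall j, (j <= n)%nat -> Cmod (w j) <= X).
  { induction n as [|n [X [X0 IH]]].
    - exists (Cmod (w 0%nat) + 1). pose proof (Cmod_ge_0 (w 0%nat)). split; [lra|].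
      intros j Hj. replace j with 0%nat by lia. lra.
    - exists (X + Cmod (w (S n))). pose proof (Cmod_ge_0 (w (S n))). split; [lra|].
      intros j Hj. destruct (Nat.eq_dec j (S n)) as [->|]; [lra|].
      specialize (IH j ltac:(lia)). lra. }
  destruct (B (pred k)) as [X [X0 HX]]. exists X. split; [exact X0|].
  intros z [t [T1 [T2 ->]]].
  replace X with (X * sum_n t (pred k)) by (rewrite T2; cring). clear T2.
  revert HX. generalize (pred k). intros n HX. induction n as [|n IH].
  - rewrite !sum_O, Cmod_mult, Cmod_R, Rabs_right by (apply Rle_ge, T1).
    rewrite Rmult_comm. apply Rmult_le_compat_r; auto.
  - rewrite !sum_Sn. change (plus ?p ?q) with (Cplus p q) at 1. change (plus ?p ?q) with (Rplus p q).
    eapply Rle_trans; [apply Cmod_triangle|]. rewrite Rmult_plus_distr_l.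
    apply Rplus_le_compat; [apply IH; auto|].
    rewrite Cmod_mult, Cmod_R, Rabs_right by (apply Rle_ge, T1).
    rewrite Rmult_comm. apply Rmult_le_compat_r; auto.
Qed.

(** The signed distance to the line of side [i], times the length of that side; positive on the
    inner side. *)
Definition ell k w i z : R := cross (w (next k i) - w i) (z - w i).

Lemma next_lt (k i : nat) : (0 < k)%nat -> (next k i < k)%nat.
Proof. intros. unfold next. apply Nat.mod_upper_bound. lia. Qed.

Lemma ell_seg k w i z (u : R) :
  ell k w i z = cross (w (next k i) - w i) (z - side k w i u).
Proof.
  unfold ell, seg. rewrite !cross_minus_r, cross_plus_r, cross_scal_r, cross_self. cring.
Qed.

Lemma ell_lip k w i (z z' : C) :
  Rabs (ell k w i z - ell k w i z') <= Cmod (w (next k i) - w i) * Cmod (z - z').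
Proof.
  unfold ell. rewrite <- cross_minus_r.
  replace (z - w i - (z' - w i))%C with (z - z')%C by cring. apply cross_bound.
Qed.

Lemma region_ell k w i z :
  convex_polygon k w -> (i < k)%nat -> region k w z -> 0 <= ell k w i z.
Proof.
  intros [Hk Hp] Hi [t [T1 [T2 ->]]].
  assert (Hc : forall j, (j < k)%nat -> 0 <= cross (w (next k i) - w i) (w j - w i)).
  { intros j Hj. destruct (Nat.eq_dec j i) as [->|N1].
    - replace (w i - w i)%C with (RtoC 0) by cring. rewrite cross_0_r. lra.
    - destruct (Nat.eq_dec j (next k i)) as [->|N2]; [rewrite cross_self; lra|].
      apply Rlt_le, Hp; auto. }
  unfold ell. rewrite cross_minus_r, cross_sum_n.
  set (d := (w (next k i) - w i)%C) in *.
  replace (cross d (w i)) with (cross d (w i) * sum_n t (pred k)) by (rewrite T2; cring).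
  assert (E : sum_n (fun j => t j * cross d (w j)) (pred k) - cross d (w i) * sum_n t (pred k)
            = sum_n (fun j => t j * cross d (w j - w i)) (pred k)).
  { rewrite (sum_n_ext (fun j => t j * cross d (w j - w i))
      (fun j => 1 * (t j * cross d (w j)) + (- cross d (w i)) * t j + 0 * t j)).
    - rewrite sum_n_R_lin. cring.
    - intros j. rewrite cross_minus_r. cring. }
  rewrite E. apply sum_n_nonneg. intros j Hj. apply Rmult_le_pos; auto. apply Hc. lia.
Qed.

Lemma side_neq0 k w i :
  convex_polygon k w -> (i < k)%nat -> (w (next k i) - w i)%C <> RtoC 0.
Proof.
  intros [Hk Hp] Hi E.
  assert (exists j, (j < k)%nat /\ j <> i /\ j <> next k i) as [j [J1 [J2 J3]]].
  { destruct (Nat.eq_dec 0 i), (Nat.eq_dec 0 (next k i)), (Nat.eq_dec 1 i), (Nat.eq_dec 1 (next k i));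
      first [exists 0%nat; lia | exists 1%nat; lia | exists 2%nat; lia]. }
  specialize (Hp i j Hi J1 J2 J3). rewrite E in Hp.
  destruct (w j - w i)%C. unfold cross, Cconj in Hp. simpl in Hp. lra.
Qed.

Lemma interior_spec (X : C -> Prop) z :
  interior X z <-> exists r, 0 < r /\ forall t, Cmod (t - z) < r -> X t.
Proof. apply (locally_Cmod z X). Qed.

Lemma interior_sub (X : C -> Prop) z : interior X z -> X z.
Proof. intros H. exact (locally_singleton _ _ H). Qed.

(** A point at distance r/2 from [z] towards the side is still in the region, so it has [ell] >= 0,
    while [ell] drops by r/2 times the side length on the way. *)
Lemma interior_ell k w i z :
  convex_polygon k w -> (i < k)%nat -> interior (region k w) z -> 0 < ell k w i z.
Proof.
  intros Hp Hi Hz. destruct (proj1 (interior_spec _ _) Hz) as [r [Hr H]].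
  pose proof (proj1 (Cmod_gt_0 _) (side_neq0 k w i Hp Hi)) as Hd.
  set (d := (w (next k i) - w i)%C) in *.
  set (z' := (z + RtoC (- (r / (2 * Cmod d))) * (Ci * d))%C).
  assert (Hz' : 0 <= ell k w i z').
  { apply region_ell; auto. apply H. unfold z'.
    replace (z + RtoC (- (r / (2 * Cmod d))) * (Ci * d) - z)%C
      with (RtoC (- (r / (2 * Cmod d))) * (Ci * d))%C by cring.
    assert (0 < r / (2 * Cmod d)) by (apply Rdiv_lt_0_compat; lra).
    rewrite !Cmod_mult, Cmod_R, Rabs_Ropp, Cmod_Ci, Rabs_right, Rmult_1_l by lra.
    replace (r / (2 * Cmod d) * Cmod d) with (r / 2) by (field; lra). lra. }
  unfold ell in Hz'. fold d in Hz'. unfold z' in Hz'.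
  rewrite cross_minus_r, cross_plus_r, cross_scal_r in Hz'.
  unfold ell. fold d. rewrite cross_minus_r.
  assert (E : cross d (Ci * d) = Cmod d ^ 2).
  { rewrite Cmod2_alt. destruct d. unfold cross, Cconj. simpl. cring. }
  rewrite E in Hz'.
  assert (0 < r / (2 * Cmod d) * Cmod d ^ 2).
  { apply Rmult_lt_0_compat; [apply Rdiv_lt_0_compat; lra|apply pow_lt; lra]. }
  lra.
Qed.

Lemma interior_toward k w (z p : C) (u : R) :
  interior (region k w) z -> region k w p -> 0 <= u < 1 -> interior (region k w) (seg z p u).
Proof.
  intros Hz Hp Hu. destruct (proj1 (interior_spec _ _) Hz) as [r [Hr H]].
  apply interior_spec. exists (r * (1 - u)). split; [apply Rmult_lt_0_compat; lra|].
  intros t Ht.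
  assert (N : RtoC (1 - u) <> RtoC 0) by (apply RtoC_neq0; lra).
  (* The preimage of [t] under the contraction towards [p] with ratio 1 - u, which maps [z] to
     [seg z p u]. *)
  set (z' := (z + / RtoC (1 - u) * (t - seg z p u))%C).
  replace t with (seg z' p u).
  - apply region_seg; [|exact Hp|unfold unit_itv; lra]. apply H. unfold z'.
    replace (z + / RtoC (1 - u) * (t - seg z p u) - z)%C with (/ RtoC (1 - u) * (t - seg z p u))%C by cring.
    rewrite Cmod_mult, Cmod_inv, Cmod_R, Rabs_right by (auto; lra).
    apply Rmult_lt_reg_l with (1 - u); [lra|]. rewrite <- Rmult_assoc, Rinv_r by lra. lra.
  - unfold z', seg. rewrite RtoC_minus in *. field. exact N.
Qed.

Lemma interior_exists k w :
  convex_polygon k w -> exists z, interior (region k w) z.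
Proof.
  intros [Hk Hp].
  assert (E1 : next k 0 = 1%nat) by (unfold next; apply Nat.mod_small; lia).
  assert (D : 0 < cross (w 1%nat - w 0%nat) (w 2%nat - w 0%nat)).
  { specialize (Hp 0%nat 2%nat). rewrite E1 in Hp. apply Hp; lia. }
  set (a := w 0%nat) in *. set (b := w 1%nat) in *. set (c := w 2%nat) in *.
  set (De := cross (b - a) (c - a)) in *.
  exists (bary a b c (1 / 3) (1 / 3)). set (g := bary a b c (1 / 3) (1 / 3)).
  pose proof (Cmod_ge_0 (b - a)) as P1. pose proof (Cmod_ge_0 (c - a)) as P2.
  set (Q := Cmod (b - a) + Cmod (c - a) + 1).
  (* Within this radius of the centroid of the first three corners, the coordinates [x] and [y],
     given by Cramer's rule, move by at most 1/6, so they stay at least 1/6 with sum at most 1. *)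
  apply interior_spec. exists (De / (6 * Q)).
  assert (HQ : 0 < Q) by (unfold Q; lra).
  split; [apply Rdiv_lt_0_compat; lra|]. intros t Ht.
  set (x := 1 / 3 - cross (c - a) (t - g) / De). set (y := 1 / 3 + cross (b - a) (t - g) / De).
  assert (Et : t = bary a b c x y).
  { unfold x, y, g, De. unfold De in D. clear - D. unfold bary.
    destruct a as [a1 a2], b as [b1 b2], c as [c1 c2], t as [t1 t2].
    unfold cross, Cconj in *. simpl in *.
    apply injective_projections; simpl; field; lra. }
  assert (S1 : forall v, Cmod v <= Q -> Rabs (cross v (t - g) / De) <= 1 / 6).
  { intros v Hv. unfold Rdiv at 1. rewrite Rabs_mult, (Rabs_right (/ De)) by (apply Rle_ge, Rlt_le, Rinv_0_lt_compat, D).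
    apply Rmult_le_reg_r with De; [exact D|]. rewrite Rmult_assoc, Rinv_l, Rmult_1_r by lra.
    eapply Rle_trans; [apply cross_bound|].
    apply Rle_trans with (Q * (De / (6 * Q))); [|right; field; lra].
    apply Rmult_le_compat; try apply Cmod_ge_0; lra. }
  assert (X1 := S1 (c - a)%C ltac:(unfold Q; lra)). assert (Y1 := S1 (b - a)%C ltac:(unfold Q; lra)).
  apply Rabs_le_between in X1. apply Rabs_le_between in Y1.
  rewrite Et. apply region_bary; try (apply region_corner; lia).
  unfold in_simplex, x, y. lra.
Qed.

(** * Cauchy's formula for the polygon *)

(** The bound is exclusive, unlike that of [sum_n]; the empty sum starts the inductions. *)
Fixpoint csum n (A : nat -> C) : C :=
  match n with O => RtoC 0 | S m => (csum m A + A m)%C end.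

Lemma csum_ext n (A B : nat -> C) : (forall i, (i < n)%nat -> A i = B i) -> csum n A = csum n B.
Proof.
  intros H. induction n as [|n IH]; simpl; [reflexivity|]. rewrite IH, H by auto. reflexivity.
Qed.

Lemma csum_plus n (A B : nat -> C) : csum n (fun i => A i + B i)%C = (csum n A + csum n B)%C.
Proof. induction n as [|n IH]; simpl; [ring|]. rewrite IH. ring. Qed.

Lemma csum_scal n (c : C) (A : nat -> C) : csum n (fun i => c * A i)%C = (c * csum n A)%C.
Proof. induction n as [|n IH]; simpl; [ring|]. rewrite IH. ring. Qed.

Lemma csum_telescope n (A : nat -> C) :
  csum n (fun i => A i - A (S i))%C = (A 0%nat - A n)%C.
Proof. induction n as [|n IH]; simpl; [ring|]. rewrite IH. ring. Qed.

Lemma csum_cyclic (k : nat) (A : nat -> C) : (0 < k)%nat ->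
  csum k (fun i => A i - A (next k i))%C = RtoC 0.
Proof.
  intros Hk. destruct k as [|n]; [lia|]. cbn [csum].
  rewrite (csum_ext n _ (fun i => A i - A (S i))%C).
  - rewrite csum_telescope. unfold next. rewrite Nat.Div0.mod_same. ring.
  - intros i Hi. unfold next. rewrite Nat.mod_small by lia. reflexivity.
Qed.

Lemma ccont_sub (S T : C -> Prop) F (t : C) :
  (forall s, S s -> T s) -> ccont T F t -> ccont S F t.
Proof.
  intros H HF. apply ccont_spec. intros eps He.
  destruct (proj1 (ccont_spec _ _ _) HF eps He) as [eta [A B]]. exists eta. split; auto.
Qed.

Lemma ccont_inv_sub (S : C -> Prop) (c t : C) : t <> c -> ccont S (fun s => / (s - c))%C t.
Proof. intros H. apply cdiff_ccont, cdiff_inv_sub, H. Qed.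

Lemma ccont_mult (S : C -> Prop) F G (t : C) :
  ccont S F t -> ccont S G t -> ccont S (fun s => F s * G s)%C t.
Proof. apply clim_mult. Qed.

Lemma ccont_plus (S : C -> Prop) F G (t : C) :
  ccont S F t -> ccont S G t -> ccont S (fun s => F s + G s)%C t.
Proof. apply clim_plus. Qed.

Lemma ccont_const (S : C -> Prop) (c t : C) : ccont S (fun _ => c) t.
Proof. apply clim_const. exact _. Qed.

Lemma ccont_ext_loc (S : C -> Prop) F G (t : C) :
  Cloc t (fun s => F s = G s) -> ccont S F t -> ccont S G t.
Proof.
  intros HE HF. apply clim_eq with (F t); [exact (locally_singleton _ _ HE)|].
  apply (clim_ext _ F); [|exact HF]. unfold within. revert HE. apply filter_imp. auto.
Qed.

Lemma Cloc_neq (t z : C) : t <> z -> Cloc t (fun s => s <> z).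
Proof.
  intros H. apply locally_Cmod. exists (Cmod (t - z)). split; [apply Cmod_gt_0, Csub_neq, H|].
  intros s Hs E. subst. replace (z - t)%C with (- (t - z))%C in Hs by ring. rewrite Cmod_opp in Hs. lra.
Qed.

Lemma triangle_region k w (a b c t : C) :
  region k w a -> region k w b -> region k w c -> triangle a b c t -> region k w t.
Proof. intros Ha Hb Hc [x [y [H ->]]]. apply region_bary; auto. Qed.

Lemma seg_triangle_ab (a b c : C) (u : R) : unit_itv u -> triangle a b c (seg a b u).
Proof.
  intros Hu. exists u, 0. split; [unfold in_simplex, unit_itv in *; lra|]. unfold seg, bary. ring.
Qed.

Lemma seg_triangle_bc (a b c : C) (u : R) : unit_itv u -> triangle a b c (seg b c u).
Proof.
  intros Hu. exists (1 - u), u. split; [unfold in_simplex, unit_itv in *; lra|].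
  unfold seg, bary. rewrite RtoC_minus. ring.
Qed.

Lemma seg_triangle_ac (a b c : C) (u : R) : unit_itv u -> triangle a b c (seg a c u).
Proof.
  intros Hu. exists 0, u. split; [unfold in_simplex, unit_itv in *; lra|]. unfold seg, bary. ring.
Qed.

Lemma side_neq_point k w i z (u : R) :
  0 < ell k w i z -> side k w i u <> z.
Proof.
  intros H E. rewrite (ell_seg k w i z u), E in H.
  replace (z - z)%C with (RtoC 0) in H by ring. rewrite cross_0_r in H. lra.
Qed.

(** The constant W of the overview, with value 2 pi i inside; it enters through [winding_const] and
    [winding_neq0]. *)
Definition winding k w z : C :=
  csum k (fun i => SI (fun t => / (t - z))%C (w i) (w (next k i))).

(** The difference quotient [phi] of [h] at [z] is integrated over the fan of triangles joining [z]
    to the sides. Since [z] is a vertex of each, [phi] need only be continuous there, and the spokes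
    cancel cyclically. *)
Lemma cauchy_polygon k w (h : C -> C) z :
  convex_polygon k w ->
  (forall t, region k w t -> ccont (region k w) h t) ->
  (forall t, interior (region k w) t -> cdiff h t) ->
  interior (region k w) z ->
  csum k (fun i => SI (fun t => h t * / (t - z))%C (w i) (w (next k i))) = (h z * winding k w z)%C.
Proof.
  intros Hp Hc Hd Hz. assert (Hk : (0 < k)%nat) by (destruct Hp; lia).
  pose proof (interior_sub _ _ Hz) as Hzr.
  destruct (Hd z Hz) as [phi [Hlim Hphi]].
  assert (Ephi : forall t, t <> z -> phi t = ((h t + - h z) * / (t - z))%C).
  { intros t Ht. pose proof (Hphi t) as E. apply Csub_neq in Ht.
    replace (h t + - h z)%C with (phi t * (t - z))%C by (rewrite <- E; ring). field. exact Ht. }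
  assert (Cphi : forall t, region k w t -> ccont (region k w) phi t).
  { intros t Ht. destruct (Ceq_dec t z) as [->|n].
    - apply clim_within, Hlim.
    - apply (ccont_ext_loc _ (fun s => (h s + - h z) * / (s - z))%C).
      + generalize (Cloc_neq t z n). apply filter_imp. intros s Hs. symmetry. apply Ephi, Hs.
      + apply ccont_mult; [apply ccont_plus; [apply Hc, Ht|apply ccont_const]|apply ccont_inv_sub, n]. }
  assert (Dphi : forall t, interior (region k w) t -> t <> z -> cdiff phi t).
  { intros t Ht n. apply (cdiff_ext_loc (fun s => (h s + - h z) * / (s - z))%C).
    - generalize (Cloc_neq t z n). apply filter_imp. intros s Hs. symmetry. apply Ephi, Hs.
    - apply cdiff_mult; [apply cdiff_plus; [apply Hd, Ht|apply cdiff_const]|apply cdiff_inv_sub, n]. }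
  assert (Rw : forall i, (i < k)%nat -> region k w (w i) /\ region k w (w (next k i))).
  { intros i Hi. split; apply region_corner; auto. apply next_lt, Hk. }
  assert (SCphi : forall a b, region k w a -> region k w b -> segcont phi a b).
  { intros a b Ha Hb. apply (segcont_of_ccont (region k w)); auto. intros; apply region_seg; auto. }
  assert (Tri : forall i, (i < k)%nat -> TI phi z (w i) (w (next k i)) = RtoC 0).
  { intros i Hi. destruct (Rw i Hi) as [R1 R2]. apply cauchy_triangle.
    - intros t Ht. apply ccont_sub with (region k w).
      + intros s Hs. eapply triangle_region; [| | |exact Hs]; auto.
      + apply Cphi. eapply triangle_region; [| | |exact Ht]; auto.
    - intros x y Hx Hy Hxy. apply Dphi.
      (* An inner point of a fan triangle lies strictly between [z] and a point of the side. *)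
      + replace (bary z (w i) (w (next k i)) x y) with
          (seg z (side k w i (y / (x + y))) (x + y)).
        * apply interior_toward; [exact Hz| |lra]. apply region_seg; auto.
          split; [apply Rlt_le, Rdiv_lt_0_compat; lra|].
          apply Rmult_le_reg_r with (x + y); [lra|]. unfold Rdiv. rewrite Rmult_assoc, Rinv_l; lra.
        * unfold seg, bary. rewrite RtoC_div by lra. rewrite RtoC_plus. field.
          rewrite <- RtoC_plus. apply RtoC_neq0. lra.
      (* Such a point differs from [z] because its offset has a nonzero cross product with the
         side. *)
      + intros E.
        assert (E2 : (RtoC x * (w i - z) + RtoC y * (w (next k i) - z))%C = RtoC 0).
        { transitivity (bary z (w i) (w (next k i)) x y - z)%C; [unfold bary; ring|]. rewrite E. ring. }
        pose proof (interior_ell k w i z Hp Hi Hz) as Hl.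
        assert (E3 : cross (w (next k i) - w i) (RtoC x * (w i - z) + RtoC y * (w (next k i) - z))
                     = - (x + y) * ell k w i z).
        { unfold ell. rewrite cross_plus_r, !cross_scal_r.
          destruct (w (next k i)), (w i), z. unfold cross, Cconj. simpl. ring. }
        rewrite E2, cross_0_r in E3. nra. }
  assert (S0 : csum k (fun i => SI phi (w i) (w (next k i))) = RtoC 0).
  { rewrite (csum_ext k _ (fun i => - RtoC 1 * (SI phi z (w i) - SI phi z (w (next k i))))%C).
    - rewrite csum_scal, (csum_cyclic k (fun i => SI phi z (w i))) by exact Hk. ring.
    - intros i Hi. destruct (Rw i Hi) as [R1 R2]. specialize (Tri i Hi). unfold TI in Tri.
      rewrite (SI_rev phi z (w (next k i))) in Tri by (apply SCphi; auto).
      transitivity (SI phi (w i) (w (next k i)) - RtoC 0)%C; [ring|]. rewrite <- Tri. ring. }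
  rewrite (csum_ext k _ (fun i => SI phi (w i) (w (next k i)) +
             h z * SI (fun t => / (t - z))%C (w i) (w (next k i)))%C).
  - rewrite csum_plus, S0, csum_scal. unfold winding. ring.
  - intros i Hi. destruct (Rw i Hi) as [R1 R2].
    pose proof (interior_ell k w i z Hp Hi Hz) as Hl.
    assert (Sinv : segcont (fun t => / (t - z))%C (w i) (w (next k i))).
    { apply (segcont_of_ccont (fun t => t <> z)).
      - intros u _. apply side_neq_point, Hl.
      - intros t Ht. apply ccont_inv_sub, Ht. }
    rewrite <- SI_scal by exact Sinv. rewrite <- SI_plus.
    + apply SI_ext. intros u Hu.
      rewrite Ephi by (apply side_neq_point, Hl). ring.
    + apply SCphi; auto.
    + apply ucont_scal, Sinv.
Qed.

(** * The winding integral is a nonzero constant *)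

Lemma is_derive_seg (G phi : C -> C) (a b : C) (u : R) :
  Cloc (seg a b u) (fun t => (G t - G (seg a b u) = phi t * (t - seg a b u))%C) ->
  clim (Cloc (seg a b u)) phi (phi (seg a b u)) ->
  is_derive (K := R_AbsRing) (V := C_R_NormedModule) (fun v => G (seg a b v)) u
    (phi (seg a b u) * (b - a))%C.
Proof.
  intros HE Hlim. split; [apply is_linear_scal_l|].
  intros x Hx. rewrite <- (is_filter_lim_locally_unique _ _ Hx). clear x Hx.
  intros eps. pose proof (Cmod_ge_0 (b - a)) as Hba.
  set (L := Cmod (b - a) + 1).
  assert (He : 0 < eps / L) by (apply Rdiv_lt_0_compat; [apply cond_pos|unfold L; lra]).
  destruct (proj1 (locally_Cmod _ _) (filter_and _ _ HE (proj2 Hlim _ He))) as [eta [He1 H1]].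
  assert (Hd : 0 < eta / L) by (apply Rdiv_lt_0_compat; unfold L; lra).
  exists (mkposreal _ Hd). intros v Hv.
  assert (Hv2 : Rabs (v - u) < eta / L) by exact Hv.
  assert (Hn : Cmod (seg a b v - seg a b u) < eta).
  { rewrite seg_sub, Cmod_mult, Cmod_R.
    apply Rle_lt_trans with (Rabs (v - u) * L).
    - apply Rmult_le_compat_l; [apply Rabs_pos|unfold L; lra].
    - apply Rmult_lt_reg_r with (/ L); [apply Rinv_0_lt_compat; unfold L; lra|].
      rewrite Rmult_assoc, Rinv_r by (unfold L; lra). rewrite Rmult_1_r. exact Hv2. }
  destruct (H1 _ Hn) as [E1 E2].
  change (minus v u) with (v - u).
  change (norm (v - u)) with (Rabs (v - u)).
  rewrite scal_R_Cmult.
  match goal with |- norm ?X <= _ => replace (norm X) with (Cmod X) by apply Cmod_norm end.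
  change (minus ?p ?q) with (p - q)%C.
  change (Cmod ((G (seg a b v) - G (seg a b u)) - RtoC (v - u) * (phi (seg a b u) * (b - a)))%C
          <= eps * Rabs (v - u)).
  rewrite E1, seg_sub.
  replace (phi (seg a b v) * (RtoC (v - u) * (b - a)) - RtoC (v - u) * (phi (seg a b u) * (b - a)))%C
    with ((phi (seg a b v) - phi (seg a b u)) * (RtoC (v - u) * (b - a)))%C by ring.
  rewrite !Cmod_mult, Cmod_R.
  pose proof (Rabs_pos (v - u)). pose proof (Cmod_ge_0 (phi (seg a b v) - phi (seg a b u))).
  assert (EL : pos eps = eps / L * L) by (field; unfold L; lra).
  rewrite EL.
  replace (eps / L * L * Rabs (v - u)) with (eps / L * (Rabs (v - u) * L)) by ring.
  apply Rmult_le_compat; try lra.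
  - apply Rmult_le_pos; lra.
  - apply Rmult_le_compat_l; unfold L; lra.
Qed.

Lemma continuous_seg F (a b : C) (u : R) :
  clim (Cloc (seg a b u)) F (F (seg a b u)) ->
  continuous (U := C_R_NormedModule) (fun v => F (seg a b v)) u.
Proof.
  intros [_ H] P [eps HP].
  destruct (proj1 (locally_Cmod _ _) (H eps (cond_pos eps))) as [eta [He1 H1]].
  pose proof (Cmod_ge_0 (b - a)) as Hba.
  assert (Hd : 0 < eta / (Cmod (b - a) + 1)) by (apply Rdiv_lt_0_compat; lra).
  exists (mkposreal _ Hd). intros v Hv. apply HP. apply C_NormedModule_mixin_compat1. apply H1.
  assert (Hv2 : Rabs (v - u) < eta / (Cmod (b - a) + 1)) by exact Hv.
  rewrite seg_sub, Cmod_mult, Cmod_R.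
  apply Rle_lt_trans with (Rabs (v - u) * (Cmod (b - a) + 1)).
  - apply Rmult_le_compat_l; [apply Rabs_pos|lra].
  - apply Rmult_lt_reg_r with (/ (Cmod (b - a) + 1)); [apply Rinv_0_lt_compat; lra|].
    rewrite Rmult_assoc, Rinv_r, Rmult_1_r by lra. exact Hv2.
Qed.

Lemma cdiff_inv_sub_clim (c z : C) : z <> c -> clim (Cloc z) (fun t => / (t - c))%C (/ (z - c))%C.
Proof. intros H. apply (cdiff_clim (fun t => / (t - c))%C), cdiff_inv_sub, H. Qed.

(** The fundamental theorem of calculus with primitive -1/(t-z) along the segment. *)
Lemma SI_inv_square (a b z : C) : (forall u, unit_itv u -> seg a b u <> z) ->
  SI (fun t => / (t - z) * / (t - z))%C a b = (/ (a - z) - / (b - z))%C.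
Proof.
  intros H.
  assert (U : forall u, Rmin 0 1 <= u <= Rmax 0 1 -> unit_itv u)
    by (intros u; rewrite Rmin_left, Rmax_right by lra; auto).
  set (df := fun t => (/ (t - z) * / (t - z) * (b - a))%C).
  assert (I : is_RInt (V := C_R_NormedModule) (fun u => df (seg a b u)) 0 1
     (minus (G := C_R_NormedModule) (- / (seg a b 1 - z))%C (- / (seg a b 0 - z))%C)).
  { apply (is_RInt_derive (V := CR) (fun u => - / (seg a b u - z))%C).
    - intros u Hu. specialize (H u (U u Hu)).
      apply (is_derive_seg (fun t => - / (t - z))%C (fun t => / (t - z) * / (seg a b u - z))%C a b u).
      + generalize (Cloc_neq _ _ H). apply filter_imp. intros t Ht.
        field. split; apply Csub_neq; assumption.
      + apply clim_mult; [apply cdiff_inv_sub_clim, H|apply clim_const; exact _].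
    - intros u Hu. specialize (H u (U u Hu)).
      apply (continuous_seg df). unfold df.
      apply clim_mult; [apply clim_mult; apply cdiff_inv_sub_clim, H|apply clim_const; exact _]. }
  apply (is_RInt_unique (V := CR)) in I.
  rewrite seg_0, seg_1 in I.
  unfold SI. rewrite <- Cint_scal.
  - transitivity (Cint (fun u => df (seg a b u))).
    + apply Cint_ext. intros u Hu. unfold df. ring.
    + unfold Cint. rewrite I. change (minus ?p ?q) with (p - q)%C. ring.
  - apply (ucont_comp (fun t => t <> z) (fun t => / (t - z) * / (t - z))%C); [apply ucont_seg|exact H|].
    intros t Ht. apply ccont_mult; apply ccont_inv_sub, Ht.
Qed.

Lemma segcont_inv (a b z : C) : (forall u, unit_itv u -> seg a b u <> z) ->
  segcont (fun t => / (t - z))%C a b.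
Proof.
  intros H. apply (segcont_of_ccont (fun t => t <> z)); auto.
  intros t Ht. apply ccont_inv_sub, Ht.
Qed.

(** Differentiation under the integral sign, in the form of [cdiff]. The quotient of the kernels
    differs from 1/(t-z)^2 by (s-z)/((t-s)(t-z)^2), at most |s-z| times 2/r^3 once |s-z| < r/2. *)
Lemma SI_kernel_derivative (a b z : C) (r : R) : 0 < r ->
  (forall u, unit_itv u -> r <= Cmod (seg a b u - z)) ->
  exists phi, clim (Cloc z) phi (phi z) /\ phi z = (/ (a - z) - / (b - z))%C /\
    forall s, (SI (fun t => / (t - s))%C a b - SI (fun t => / (t - z))%C a b = phi s * (s - z))%C.
Proof.
  intros Hr H.
  assert (Nz : forall u, unit_itv u -> seg a b u <> z).
  { intros u Hu E. specialize (H u Hu). rewrite E in H.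
    rewrite Cmod_sub_self in H. lra. }
  set (V := fun s => SI (fun t => / (t - s))%C a b).
  exists (fun s => if Ceq_dec s z then / (a - z) - / (b - z) else (V s - V z) / (s - z))%C.
  destruct (Ceq_dec z z) as [_|n]; [|congruence]. split; [|split; [reflexivity|]].
  2:{ intros s. destruct (Ceq_dec s z) as [->|n]; [unfold V; ring|]. fold (V s) (V z). field. apply Csub_neq, n. }
  split; [exact _|]. intros eps He.
  pose proof (Cmod_ge_0 (b - a)) as Hba.
  set (K := (Cmod (b - a) + 1) * (2 / r ^ 3)).
  assert (Hr3 : 0 < r ^ 3) by (apply pow_lt, Hr).
  assert (HK : 0 < K) by (apply Rmult_lt_0_compat; [lra|apply Rdiv_lt_0_compat; lra]).
  apply locally_Cmod. exists (Rmin (r / 2) (eps / K)). split.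
  { apply Rmin_glb_lt; [lra|apply Rdiv_lt_0_compat; lra]. }
  intros s Hs. destruct (Ceq_dec s z) as [->|n].
  { replace (/ (a - z) - / (b - z) - (/ (a - z) - / (b - z)))%C with (RtoC 0) by ring. rewrite Cmod_0. exact He. }
  assert (Hs1 : Cmod (s - z) < r / 2) by (eapply Rlt_le_trans; [exact Hs|apply Rmin_l]).
  assert (Hs2 : Cmod (s - z) < eps / K) by (eapply Rlt_le_trans; [exact Hs|apply Rmin_r]).
  assert (Ds : forall u, unit_itv u -> r / 2 <= Cmod (seg a b u - s)).
  { intros u Hu. specialize (H u Hu).
    pose proof (Cmod_triangle (seg a b u - s) (s - z)) as T.
    replace (seg a b u - s + (s - z))%C with (seg a b u - z)%C in T by ring. lra. }
  assert (Ns : forall u, unit_itv u -> seg a b u <> s).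
  { intros u Hu E. specialize (Ds u Hu). rewrite E in Ds.
    rewrite Cmod_sub_self in Ds. lra. }
  pose proof (Csub_neq _ _ n) as Nsz.
  assert (C1 := segcont_inv a b z Nz). assert (C2 := segcont_inv a b s Ns).
  assert (C12 : segcont (fun t => / (t - z) * / (t - z))%C a b) by (apply ucont_mult; exact C1).
  assert (C3 : segcont (fun t => / (t - s) + - RtoC 1 * / (t - z))%C a b)
    by (apply ucont_plus; [exact C2|apply ucont_scal, C1]).
  rewrite <- (SI_inv_square a b z Nz).
  replace ((V s - V z) / (s - z) - SI (fun t => / (t - z) * / (t - z))%C a b)%C
    with (SI (fun t => / (s - z) * (/ (t - s) + - RtoC 1 * / (t - z)) + - RtoC 1 * (/ (t - z) * / (t - z)))%C a b).
  2:{ rewrite SI_plus, !SI_scal, SI_plus, SI_scal; auto.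
      - unfold V. field. exact Nsz.
      - apply ucont_scal, C1.
      - apply ucont_scal, C3.
      - apply ucont_scal, C12. }
  eapply Rle_lt_trans.
  - apply SI_bound with (M := Cmod (s - z) * (2 / r ^ 3)).
    + apply ucont_plus; [apply ucont_scal, C3|apply ucont_scal, C12].
    + intros u Hu. specialize (Ds u Hu). specialize (H u Hu).
      assert (N1 := Csub_neq _ _ (Nz u Hu)). assert (N2 := Csub_neq _ _ (Ns u Hu)).
      set (t := seg a b u) in *.
      replace (/ (s - z) * (/ (t - s) + - RtoC 1 * / (t - z)) + - RtoC 1 * (/ (t - z) * / (t - z)))%C
        with ((s - z) / ((t - s) * ((t - z) * (t - z))))%C by (field; auto).
      rewrite Cmod_div, !Cmod_mult by (repeat apply Cmult_neq_0; auto).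
      apply Rmult_le_compat_l; [apply Cmod_ge_0|].
      replace (2 / r ^ 3) with (/ (r / 2 * (r * r))) by (field; lra).
      apply Rinv_le_contravar; [apply Rmult_lt_0_compat; nra|].
      apply Rmult_le_compat; try lra; [nra|]. apply Rmult_le_compat; lra.
  - apply Rle_lt_trans with (Cmod (s - z) * K).
    + unfold K. pose proof (Cmod_ge_0 (s - z)). assert (0 < 2 / r ^ 3) by (apply Rdiv_lt_0_compat; lra). nra.
    + apply Rmult_lt_reg_r with (/ K); [apply Rinv_0_lt_compat, HK|].
      rewrite Rmult_assoc, Rinv_r, Rmult_1_r by lra. exact Hs2.
Qed.

Lemma side_dist k w i z (u : R) :
  convex_polygon k w -> (i < k)%nat -> 0 < ell k w i z ->
  ell k w i z / Cmod (w (next k i) - w i) <= Cmod (side k w i u - z).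
Proof.
  intros Hp Hi Hl. pose proof (proj1 (Cmod_gt_0 _) (side_neq0 k w i Hp Hi)) as Hd.
  apply Rmult_le_reg_r with (Cmod (w (next k i) - w i)); [exact Hd|].
  unfold Rdiv. rewrite Rmult_assoc, Rinv_l, Rmult_1_r by lra.
  rewrite (ell_seg k w i z u).
  eapply Rle_trans; [apply RRle_abs|]. eapply Rle_trans; [apply cross_bound|].
  rewrite Rmult_comm. right. f_equal. rewrite <- Cmod_opp. f_equal. ring.
Qed.

(** The derivative contributed by each side is a difference of values of 1/(w-z) at its two ends;
    around the polygon these cancel. *)
Lemma winding_cdiff k w z :
  convex_polygon k w -> interior (region k w) z ->
  exists phi, clim (Cloc z) phi (phi z) /\ phi z = RtoC 0 /\
    forall s, (winding k w s - winding k w z = phi s * (s - z))%C.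
Proof.
  intros Hp Hz.
  assert (Hk : (0 < k)%nat) by (destruct Hp; lia).
  assert (P : forall n, (n <= k)%nat -> exists phi, clim (Cloc z) phi (phi z) /\
    phi z = csum n (fun i => / (w i - z) - / (w (next k i) - z))%C /\
    forall s, (csum n (fun i => SI (fun t => / (t - s))%C (w i) (w (next k i)))
               - csum n (fun i => SI (fun t => / (t - z))%C (w i) (w (next k i))) = phi s * (s - z))%C).
  { induction n as [|n IH]; intros Hn.
    - exists (fun _ => RtoC 0). split; [apply clim_const; exact _|]. split; [reflexivity|]. intros s. simpl. ring.
    - destruct IH as [p [P1 [P2 P3]]]; [lia|].
      pose proof (interior_ell k w n z Hp Hn Hz) as Hl.
      pose proof (proj1 (Cmod_gt_0 _) (side_neq0 k w n Hp Hn)) as Hd.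
      destruct (SI_kernel_derivative (w n) (w (next k n)) z (ell k w n z / Cmod (w (next k n) - w n)))
        as [q [Q1 [Q2 Q3]]].
      + apply Rdiv_lt_0_compat; auto.
      + intros u _. apply side_dist; auto.
      + exists (fun s => p s + q s)%C. split; [apply clim_plus; auto|]. split.
        * cbn [csum]. rewrite P2, Q2. reflexivity.
        * intros s. cbn [csum].
          match goal with |- (?x1 + ?y1 - (?x2 + ?y2))%C = _ =>
            transitivity ((x1 - x2) + (y1 - y2))%C; [ring|] end.
          rewrite P3, Q3. ring. }
  destruct (P k (Nat.le_refl k)) as [phi [P1 [P2 P3]]].
  exists phi. split; [exact P1|]. split; [|exact P3].
  rewrite P2. apply (csum_cyclic k (fun i => / (w i - z))%C), Hk.
Qed.

Lemma winding_const k w (z z' : C) :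
  convex_polygon k w -> interior (region k w) z -> interior (region k w) z' ->
  winding k w z = winding k w z'.
Proof.
  intros Hp Hz Hz'.
  pose proof (eq_is_derive (V := C_R_NormedModule) (fun v => winding k w (seg z z' v)) 0 1) as E.
  cbv beta in E. rewrite seg_0, seg_1 in E. apply E; [|lra]. intros u Hu.
  assert (Hu' : interior (region k w) (seg z z' u)).
  { destruct (Req_dec u 1) as [->|n]; [rewrite seg_1; exact Hz'|].
    apply interior_toward; [exact Hz|apply interior_sub, Hz'|lra]. }
  destruct (winding_cdiff k w _ Hp Hu') as [phi [P1 [P2 P3]]].
  replace (zero (G := C_R_NormedModule)) with (phi (seg z z' u) * (z' - z))%C.
  - apply is_derive_seg; [|exact P1]. apply filter_forall. exact P3.
  - rewrite P2. change (zero (G := C_R_NormedModule)) with (RtoC 0). ring.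
Qed.

Lemma Cint_Im_lower (phi : R -> C) (c : R) : ucont phi ->
  (forall u, unit_itv u -> c <= snd (phi u)) -> c <= snd (Cint phi).
Proof.
  intros Hc H.
  assert (I : is_RInt (V := C_R_NormedModule) phi 0 1 (Cint phi))
    by (apply (RInt_correct (V := CR)), ucont_ex_Cint, Hc).
  apply (is_RInt_fct_extend_snd (U := R_NormedModule) (V := R_NormedModule)) in I.
  pose proof (is_RInt_const (V := R_NormedModule) 0 1 c) as I2.
  pose proof (is_RInt_le (fun _ => c) (fun u => snd (phi u)) 0 1 _ _ ltac:(lra) I2 I) as Q.
  change (scal (1 - 0) c) with ((1 - 0) * c) in Q. rewrite Rminus_0_r, Rmult_1_l in Q.
  apply Q. intros u Hu. apply H. unfold unit_itv. lra.
Qed.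

(** The corners run counterclockwise, so Im ((b-a)/(t-z)) = cross (b-a) (z-t)/|t-z|^2 is positive on
    every side and the imaginary parts add up. *)
Lemma winding_neq0 k w z :
  convex_polygon k w -> interior (region k w) z -> winding k w z <> RtoC 0.
Proof.
  intros Hp Hz E. assert (Hk : (0 < k)%nat) by (destruct Hp; lia).
  assert (P : forall i, (i < k)%nat -> 0 < snd (SI (fun t => / (t - z))%C (w i) (w (next k i)))).
  { intros i Hi. pose proof (interior_ell k w i z Hp Hi Hz) as Hl.
    assert (Nz : forall u, side k w i u <> z) by (intros u; apply side_neq_point, Hl).
    unfold SI. rewrite <- Cint_scal by (apply segcont_inv; auto).
    set (a := w i) in *. set (b := w (next k i)) in *.
    set (X := Cmod (a - z) + Cmod (b - a) + 1).
    pose proof (Cmod_ge_0 (a - z)). pose proof (Cmod_ge_0 (b - a)).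
    assert (HX : 0 < X) by (unfold X; lra).
    apply Rlt_le_trans with (ell k w i z / X ^ 2); [apply Rdiv_lt_0_compat; [exact Hl|apply pow_lt, HX]|].
    apply Cint_Im_lower.
    - apply ucont_scal, segcont_inv; auto.
    - intros u Hu. specialize (Nz u). apply Csub_neq in Nz.
      rewrite (ell_seg k w i z u). fold a b.
      assert (B : Cmod (seg a b u - z) <= X).
      { replace (seg a b u - z)%C with ((a - z) + RtoC u * (b - a))%C by (unfold seg; ring).
        eapply Rle_trans; [apply Cmod_triangle|]. unfold unit_itv in Hu.
        rewrite Cmod_mult, Cmod_R, Rabs_right by lra. unfold X. nra. }
      assert (Hl2 : 0 < cross (b - a) (z - seg a b u))
        by (unfold a, b; rewrite <- ell_seg; exact Hl).
      set (v := (seg a b u - z)%C) in *.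
      replace (z - seg a b u)%C with (- v)%C in * by (unfold v; ring).
      pose proof (proj1 (Cmod_gt_0 _) Nz) as Hv.
      assert (Ev : snd ((b - a) * / v)%C = cross (b - a) (- v) / Cmod v ^ 2).
      { rewrite Cmod2_alt. set (d := (b - a)%C).
        assert (Hs : Re v ^ 2 + Im v ^ 2 <> 0) by (rewrite <- Cmod2_alt; apply pow_nonzero; lra).
        destruct d as [d1 d2], v as [v1 v2]. unfold cross, Cconj, Cinv. simpl in *. field. intro Q; apply Hs; lra. }
      rewrite Ev. apply Rmult_le_compat_l; [lra|].
      apply Rinv_le_contravar; [apply pow_lt, Hv|]. apply pow_incr. split; [lra|exact B]. }
  assert (Q : forall n, (0 < n <= k)%nat ->
    0 < snd (csum n (fun i => SI (fun t => / (t - z))%C (w i) (w (next k i))))).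
  { induction n as [|n IH]; intros Hn; [lia|]. cbn [csum].
    specialize (P n ltac:(lia)). change (snd (?p + ?q)%C) with (snd p + snd q).
    destruct n as [|n]; [cbn [csum]; simpl snd at 1; lra|]. specialize (IH ltac:(lia)). lra. }
  specialize (Q k ltac:(lia)). unfold winding in E. rewrite E in Q. simpl in Q. lra.
Qed.

(** * Functions approximable at the two rates *)

Definition deep k w (d : R) z : Prop :=
  forall i, (i < k)%nat -> d <= ell k w i z.

(* With [m] of order [sqrt n] these are the rates of the theorem. *)
Definition approximable k w F : Prop :=
  exists (A : nat) (r : nat -> C -> C) (c0 M : R), 0 < c0 /\ 0 <= M /\
    (forall m, rat_on (region k w) (A * S (m * m)) (r m)) /\
    (forall m z, interior (region k w) z -> Cmod (F z - r m z) <= M * exp (- c0 * INR m)) /\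
    (forall d, 0 < d -> exists c M', 0 < c /\ 0 <= M' /\
       forall m z, interior (region k w) z -> deep k w d z ->
         Cmod (F z - r m z) <= M' * exp (- c * INR (m * m))).

Lemma exp_rate_le (c c' M M' x : R) : 0 <= M <= M' -> c' <= c -> 0 <= x ->
  M * exp (- c * x) <= M' * exp (- c' * x).
Proof.
  intros HM Hc Hx. apply Rmult_le_compat; try lra; [apply Rlt_le, exp_pos|].
  assert (H : - c * x <= - c' * x) by nra.
  apply exp_le, H.
Qed.

Lemma approximable_ext k w F G :
  (forall z, interior (region k w) z -> F z = G z) -> approximable k w F -> approximable k w G.
Proof.
  intros H [A [r [c0 [M [H1 [H2 [H3 [H4 H5]]]]]]]]. exists A, r, c0, M.
  repeat split; auto.
  - intros m z Hz. rewrite <- H by exact Hz. auto.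
  - intros d Hd. destruct (H5 d Hd) as [c [M' [J1 [J2 J3]]]]. exists c, M'. repeat split; auto.
    intros m z Hz Hdz. rewrite <- H by exact Hz. auto.
Qed.

Lemma approximable_plus k w F G :
  approximable k w F -> approximable k w G -> approximable k w (fun z => F z + G z)%C.
Proof.
  intros [A [r [c0 [M [H1 [H2 [H3 [H4 H5]]]]]]]] [A' [r' [c0' [M' [H1' [H2' [H3' [H4' H5']]]]]]]].
  exists (A + A')%nat, (fun m z => r m z + r' m z)%C, (Rmin c0 c0'), (M + M').
  split; [apply Rmin_glb_lt; auto|]. split; [lra|]. split; [|split].
  - intros m. rewrite Nat.mul_add_distr_r. apply rat_on_plus; auto.
  - intros m z Hz.
    replace (F z + G z - (r m z + r' m z))%C with ((F z - r m z) + (G z - r' m z))%C by ring.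
    eapply Rle_trans; [apply Cmod_triangle|]. rewrite Rmult_plus_distr_r.
    apply Rplus_le_compat; [eapply Rle_trans; [apply H4, Hz|apply exp_rate_le; [lra|apply Rmin_l|apply pos_INR]]|eapply Rle_trans; [apply H4', Hz|apply exp_rate_le; [lra|apply Rmin_r|apply pos_INR]]].
  - intros d Hd. destruct (H5 d Hd) as [c [N [J1 [J2 J3]]]]. destruct (H5' d Hd) as [c' [N' [J1' [J2' J3']]]].
    exists (Rmin c c'), (N + N'). split; [apply Rmin_glb_lt; auto|]. split; [lra|].
    intros m z Hz Hdz.
    replace (F z + G z - (r m z + r' m z))%C with ((F z - r m z) + (G z - r' m z))%C by ring.
    eapply Rle_trans; [apply Cmod_triangle|]. rewrite Rmult_plus_distr_r.
    apply Rplus_le_compat; [eapply Rle_trans; [apply J3; auto|apply exp_rate_le; [lra|apply Rmin_l|apply pos_INR]]|eapply Rle_trans; [apply J3'; auto|apply exp_rate_le; [lra|apply Rmin_r|apply pos_INR]]].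
Qed.

Lemma approximable_scal k w (c : C) F :
  approximable k w F -> approximable k w (fun z => c * F z)%C.
Proof.
  intros [A [r [c0 [M [H1 [H2 [H3 [H4 H5]]]]]]]]. pose proof (Cmod_ge_0 c) as Hc.
  exists A, (fun m z => c * r m z)%C, c0, (Cmod c * M).
  split; [auto|]. split; [apply Rmult_le_pos; auto|]. split; [|split].
  - intros m. apply rat_on_scal; auto.
  - intros m z Hz. replace (c * F z - c * r m z)%C with (c * (F z - r m z))%C by ring.
    rewrite Cmod_mult, Rmult_assoc. apply Rmult_le_compat_l; auto.
  - intros d Hd. destruct (H5 d Hd) as [c1 [N [J1 [J2 J3]]]].
    exists c1, (Cmod c * N). split; [auto|]. split; [apply Rmult_le_pos; auto|].
    intros m z Hz Hdz. replace (c * F z - c * r m z)%C with (c * (F z - r m z))%C by ring.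
    rewrite Cmod_mult, Rmult_assoc. apply Rmult_le_compat_l; auto.
Qed.

Lemma approximable_poly k w n (p : C -> C) :
  is_poly n p -> approximable k w p.
Proof.
  intros Hp. exists n, (fun _ => p), 1, 0.
  assert (E : forall z : C, Cmod (p z - p z) = 0).
  { intros z. replace (p z - p z)%C with (RtoC 0) by ring. apply Cmod_0. }
  split; [lra|]. split; [lra|]. split; [|split].
  - intros m. exists p, (fun _ => RtoC 1). split; [apply is_poly_le with n; [nia|exact Hp]|].
    split; [apply is_poly_le with 0%nat; [lia|apply is_poly_const]|].
    intros z _. split; [apply RtoC_neq0; lra|field].
  - intros m z _. rewrite E. lra.
  - intros d Hd. exists 1, 0. split; [lra|]. split; [lra|]. intros. rewrite E. lra.
Qed.

Lemma approximable_csum k w n (F : nat -> C -> C) :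
  (forall i, (i < n)%nat -> approximable k w (F i)) -> approximable k w (fun z => csum n (fun i => F i z)).
Proof.
  induction n as [|n IH]; intros H; simpl.
  - apply approximable_poly with 0%nat, is_poly_const.
  - apply approximable_plus; auto.
Qed.

(* [- Ci] turns a side, traversed counterclockwise, to its outer normal. *)
Definition outward k w i (tau : R) : C :=
  (RtoC tau * (- Ci * (w (next k i) - w i)))%C.

Lemma ell_outward k w i (s be : R) :
  ell k w i (side k w i s + outward k w i be)%C = - (be * Cmod (w (next k i) - w i) ^ 2).
Proof.
  unfold ell, outward, seg. rewrite Cmod2_alt.
  destruct (w (next k i)), (w i). unfold cross, Cconj. simpl. ring.
Qed.

(** For a side vector d, the apex offset is tau (-i d)(1 + i) = tau (d - i d): it lies over the
    middle of the base, at half the length of the base. Both legs thus make 45 degrees with the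
    side. *)
Lemma tent_point k w i (s0 tau x y : R) :
  bary (side k w i s0) (side k w i (s0 + 2 * tau))
       (side k w i s0 + outward k w i tau * (1, 1)%R)%C x y
  = (side k w i (s0 + 2 * tau * x + tau * y) + outward k w i (tau * y))%C.
Proof.
  unfold bary, seg, outward. rewrite !RtoC_plus, !RtoC_mult.
  destruct (w (next k i)), (w i). apply injective_projections; simpl; ring.
Qed.

(** The similarity taking the outer normal to 1 carries the polygon into the half plane Re <= 0, so
    that the model segment estimates apply. *)
Lemma outward_coord k w i (tau : R) (s : R) z :
  convex_polygon k w -> (i < k)%nat -> 0 < tau ->
  Re ((z - side k w i s) / outward k w i tau)
    = - ell k w i z / (tau * Cmod (w (next k i) - w i) ^ 2).
Proof.
  intros Hp Hi Ht. rewrite (ell_seg k w i z s), Cmod2_alt. unfold outward.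
  pose proof (pow_lt _ 2 (proj1 (Cmod_gt_0 _) (side_neq0 k w i Hp Hi))) as Hd. rewrite Cmod2_alt in Hd.
  set (d := (w (next k i) - w i)%C) in *. set (v := (z - side k w i s)%C).
  clearbody d v. destruct d as [d1 d2], v as [v1 v2]. unfold cross, Cconj, Cdiv, Cinv. simpl in *.
  assert (0 < tau * tau * (d1 * (d1 * 1) + d2 * (d2 * 1))) by (apply Rmult_lt_0_compat; nra).
  field. split; [|split; [lra|]]; intro Q; lra.
Qed.

(** [diagonal_integral_approx] transported by the similarity [zeta], which turns the leg into the
    segment from 0 to 1 + i e. The poles land on the outer normal at the foot [a], outside the
    polygon. *)
Lemma edge_approximable k w i (s tau e : R) (h : C -> C) (M dl : R) :
  convex_polygon k w -> (i < k)%nat -> 0 < tau -> e ^ 2 = 1 -> 0 < dl ->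
  let a := side k w i s in
  let q := (a + outward k w i tau * (1, e))%C in
  segcont h a q -> (forall u, 0 < u <= 1 -> Cmod (h (seg a q u)) <= M * Rpower u dl) ->
  approximable k w (fun z => SI (fun t => h t * / (t - z))%C a q).
Proof.
  intros Hp Hi Ht He Hdl a q Hc HM. set (mu := outward k w i tau) in *.
  pose proof (side_neq0 k w i Hp Hi) as Nd. pose proof (proj1 (Cmod_gt_0 _) Nd) as Hd.
  assert (Nmu : mu <> RtoC 0).
  { unfold mu, outward. apply Cmult_neq_0; [apply RtoC_neq0; lra|]. apply Cmult_neq_0; [|exact Nd].
    intro Q. apply (f_equal Cmod) in Q. rewrite Cmod_opp, Cmod_Ci, Cmod_0 in Q. lra. }
  set (H := fun u => ((1, e) * h (seg a q u))%C).
  assert (Hcont : ucont H) by (apply ucont_scal, Hc).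
  assert (HH : forall u, 0 < u <= 1 -> Cmod (H u) <= Cmod (1, e) * M * Rpower u dl).
  { intros u Hu. unfold H. rewrite Cmod_mult, Rmult_assoc.
    apply Rmult_le_compat_l; [apply Cmod_ge_0|]. apply HM, Hu. }
  destruct (diagonal_integral_approx H e (Cmod (1, e) * M) dl Hcont He Hdl HH) as [N [B [c0 [Hc0 HN]]]].
  set (zeta := fun z => ((z - a) / mu)%C).
  set (D := tau * Cmod (w (next k i) - w i) ^ 2).
  assert (HD : 0 < D) by (apply Rmult_lt_0_compat; [exact Ht|apply pow_lt, Hd]).
  assert (HRe : forall z, Re (zeta z) = - ell k w i z / D) by (intros z; apply outward_coord; auto).
  assert (HE : forall z, interior (region k w) z ->
    SI (fun t => h t * / (t - z))%C a q = Cint (fun u => H u * / (RtoC u * (1, e) - zeta z))%C).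
  { intros z Hz. pose proof (interior_ell k w i z Hp Hi Hz) as Hl.
    assert (Nz : forall u, unit_itv u -> (RtoC u * (1, e) - zeta z)%C <> RtoC 0).
    { intros u Hu. apply Re_neq0. unfold unit_itv in Hu.
      assert (Re (zeta z) < 0).
      { rewrite HRe. unfold Rdiv. rewrite Ropp_mult_distr_l_reverse.
        apply Ropp_lt_gt_0_contravar, Rmult_lt_0_compat; [exact Hl|apply Rinv_0_lt_compat, HD]. }
      destruct (zeta z) as [z1 z2]. simpl in *. lra. }
    assert (Eseg : forall u, (seg a q u - z)%C = (mu * (RtoC u * (1, e) - zeta z))%C).
    { intros u. unfold zeta, q, seg. field. exact Nmu. }
    unfold SI. rewrite <- Cint_scal.
    - apply Cint_ext. intros u Hu. rewrite Eseg. unfold H.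
      replace (q - a)%C with (mu * (1, e))%C by (unfold q; ring).
      field. split; [apply Nz; unfold unit_itv; lra|exact Nmu].
    - apply ucont_mult; [exact Hc|]. apply ucont_inv.
      + apply ucont_plus; [apply ucont_seg|apply ucont_const].
      + intros u Hu. rewrite Eseg. apply Cmult_neq_0; auto. }
  assert (Hneg : forall z, interior (region k w) z -> Re (zeta z) < 0).
  { intros z Hz. rewrite HRe. pose proof (interior_ell k w i z Hp Hi Hz).
    unfold Rdiv. rewrite Ropp_mult_distr_l_reverse.
    apply Ropp_lt_gt_0_contravar, Rmult_lt_0_compat; auto. apply Rinv_0_lt_compat, HD. }
  (* The sign of [B] is read off from the first estimate at m = 0 and z = -1. *)
  assert (HB : 0 <= B).
  { destruct (HN 0%nat) as [_ [HN1 _]]. specialize (HN1 (- RtoC 1)%C ltac:(simpl; lra)).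
    pose proof (Cmod_ge_0 (Cint (fun u => H u * / (RtoC u * (1, e) - - RtoC 1))%C - N 0%nat (- RtoC 1)%C / pprod (poles 0) (- RtoC 1)%C)).
    simpl INR in HN1. rewrite Rmult_0_r, exp_0 in HN1. lra. }
  assert (Elin : forall z, zeta z = (/ mu * z + (- a / mu))%C) by (intros z; unfold zeta; field; exact Nmu).
  exists 2%nat, (fun m z => (N m (zeta z) / pprod (poles m) (zeta z))%C), c0, B.
  split; [exact Hc0|]. split; [exact HB|]. split; [|split].
  - intros m. destruct (HN m) as [HN0 _].
    exists (fun z => N m (zeta z)), (fun z => pprod (poles m) (zeta z)).
    split; [|split].
    + apply is_poly_le with (2 * (m * m))%nat; [lia|].
      apply is_poly_ext with (fun z => N m (/ mu * z + (- a / mu))%C); [intros; rewrite Elin; reflexivity|].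
      apply is_poly_comp_lin, HN0.
    + apply is_poly_le with (2 * (m * m))%nat; [lia|].
      apply is_poly_ext with (fun z => pprod (poles m) (/ mu * z + (- a / mu))%C); [intros; rewrite Elin; reflexivity|].
      apply is_poly_comp_lin. rewrite <- poles_length. apply is_poly_pprod.
    + intros z Hz. split; [|reflexivity]. apply pprod_neq0; [apply poles_pos|].
      rewrite HRe. pose proof (region_ell k w i z Hp Hi Hz). unfold Rdiv.
      rewrite Ropp_mult_distr_l_reverse. apply Rge_le, Ropp_0_le_ge_contravar, Rmult_le_pos; auto.
      apply Rlt_le, Rinv_0_lt_compat, HD.
  - intros m z Hz. destruct (HN m) as [_ [HN1 _]]. rewrite HE by exact Hz. auto.
  - intros d Hdp. destruct (region_bounded k w) as [X [X0 HX]].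
    (* [Y] bounds |zeta z| on the region and -d/D bounds its real part on the deep points. *)
    set (Y := (X + Cmod a) / Cmod mu).
    pose proof (proj1 (Cmod_gt_0 _) Nmu) as Hmu. pose proof (Cmod_ge_0 a) as Ha.
    assert (HY : 0 <= Y) by (apply Rmult_le_pos; [lra|apply Rlt_le, Rinv_0_lt_compat, Hmu]).
    assert (HdD : 0 < d / D) by (apply Rdiv_lt_0_compat; auto).
    exists (2 * (d / D) / (Y + 1) ^ 2), B.
    split; [apply Rdiv_lt_0_compat; [lra|apply pow_lt; lra]|]. split; [exact HB|].
    intros m z Hz Hdeep. destruct (HN m) as [_ [_ HN2]]. rewrite HE by exact Hz.
    apply HN2; [exact HdD| |].
    + rewrite HRe. unfold Rdiv. rewrite <- Ropp_mult_distr_l. apply Ropp_le_contravar.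
      apply Rmult_le_compat_r; [apply Rlt_le, Rinv_0_lt_compat, HD|]. apply Hdeep, Hi.
    + unfold zeta, Y. rewrite Cmod_div by exact Nmu.
      apply Rmult_le_compat_r; [apply Rlt_le, Rinv_0_lt_compat, Hmu|].
      eapply Rle_trans; [apply Cmod_triangle|]. rewrite Cmod_opp.
      apply Rplus_le_compat_r, HX, interior_sub, Hz.
Qed.

(** The tent lies in the closed outer half plane of its side, so the kernel is analytic on it and
    the base integral is the difference of the two leg integrals. Each leg is oriented from its
    foot, where the power bound on [G] applies. *)
Lemma tent_approximable k w i (s tau : R) (G : C -> C) (M dl M' dl' : R) :
  convex_polygon k w -> (i < k)%nat -> 0 < tau -> 0 < dl -> 0 < dl' ->
  let a := side k w i s in
  let b := side k w i (s + 2 * tau) in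
  let q := (a + outward k w i tau * (1, 1)%R)%C in
  (forall t, triangle a b q t -> ccont (triangle a b q) G t) ->
  (forall x y, 0 < x -> 0 < y -> x + y < 1 -> cdiff G (bary a b q x y)) ->
  (forall u, 0 < u <= 1 -> Cmod (G (seg a q u)) <= M * Rpower u dl) ->
  (forall u, 0 < u <= 1 -> Cmod (G (seg b q u)) <= M' * Rpower u dl') ->
  approximable k w (fun z => SI (fun t => G t * / (t - z))%C a b).
Proof.
  intros Hp Hi Ht Hdl Hdl' a b q Hc Hdf HM HM'.
  (* Seen from [b], the apex is in the mirrored direction 1 - i, the case e = -1. *)
  assert (Eq : q = (b + outward k w i tau * (1, -1)%R)%C).
  { unfold q, a, b, outward, seg. rewrite RtoC_plus, RtoC_mult.
    destruct (w (next k i)), (w i). apply injective_projections; simpl; ring. }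
  pose proof (proj1 (Cmod_gt_0 _) (side_neq0 k w i Hp Hi)) as Hd.
  assert (Hsa : segcont G a q).
  { apply (segcont_of_ccont (triangle a b q)); auto using seg_triangle_ac. }
  assert (Hsb : segcont G b q).
  { apply (segcont_of_ccont (triangle a b q)); auto. intros u Hu. apply seg_triangle_bc, Hu. }
  assert (Lt : forall x y, in_simplex x y -> ell k w i (bary a b q x y) <= 0).
  { intros x y [_ [Hy _]].
    unfold a, b, q. rewrite tent_point, ell_outward.
    assert (0 < tau * Cmod (w (next k i) - w i) ^ 2) by (apply Rmult_lt_0_compat; [exact Ht|apply pow_lt, Hd]). nra. }
  assert (A1 : approximable k w (fun z => SI (fun t => G t * / (t - z))%C a q)).
  { apply (edge_approximable k w i s tau 1 G M dl); auto; ring. }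
  assert (A2 : approximable k w (fun z => SI (fun t => G t * / (t - z))%C b q)).
  { rewrite Eq. apply (edge_approximable k w i (s + 2 * tau) tau (-1) G M' dl'); auto; try ring.
    - fold b. rewrite <- Eq. exact Hsb.
    - fold b. rewrite <- Eq. exact HM'. }
  apply approximable_ext with (fun z => SI (fun t => G t * / (t - z))%C a q
                                        + (- RtoC 1) * SI (fun t => G t * / (t - z))%C b q)%C.
  2:{ apply approximable_plus; [exact A1|]. apply approximable_scal, A2. }
  intros z Hz. pose proof (interior_ell k w i z Hp Hi Hz) as Hl.
  assert (Nz : forall t, triangle a b q t -> t <> z).
  { intros t [x [y [Hxy ->]]] E. specialize (Lt x y Hxy). rewrite E in Lt. lra. }
  assert (Hck : forall t, triangle a b q t -> ccont (triangle a b q) (fun t => G t * / (t - z))%C t).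
  { intros t Htt. apply ccont_mult; [apply Hc, Htt|apply ccont_inv_sub, Nz, Htt]. }
  assert (T : TI (fun t => G t * / (t - z))%C a b q = RtoC 0).
  { apply cauchy_triangle; [exact Hck|]. intros x y Hx Hy Hxy.
    apply cdiff_mult; [apply Hdf; auto|]. apply cdiff_inv_sub, Nz.
    exists x, y. split; [unfold in_simplex; lra|reflexivity]. }
  unfold TI in T. rewrite (SI_rev _ a q) in T.
  - match goal with |- (?x + - RtoC 1 * ?y)%C = ?v =>
      transitivity (x + - RtoC 1 * y + RtoC 0)%C; [ring|]; rewrite <- T; ring end.
  - apply (segcont_of_ccont (triangle a b q)); auto using seg_triangle_ac.
Qed.

(** * Hölder continuity at a point *)

(** The point s = t is excluded because [Rpower] is positive even at base 0. *)
Definition hold (S : C -> Prop) (phi : C -> C) (t : C) : Prop :=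
  exists dl M eta, 0 < dl /\ 0 < eta /\ forall s, S s -> 0 < Cmod (s - t) < eta ->
    Cmod (phi s - phi t) <= M * Rpower (Cmod (s - t)) dl.

Lemma Rpower_le_small (x a b : R) : 0 < x <= 1 -> a <= b -> Rpower x b <= Rpower x a.
Proof.
  intros Hx Hab. unfold Rpower.
  assert (ln x <= 0).
  { destruct (Req_dec x 1) as [->|]; [rewrite ln_1; lra|].
    apply Rlt_le. rewrite <- ln_1. apply ln_increasing; lra. }
  assert (Q : b * ln x <= a * ln x) by nra.
  apply exp_le, Q.
Qed.

Lemma cdiff_hold (S : C -> Prop) (phi : C -> C) (t : C) : cdiff phi t -> hold S phi t.
Proof.
  intros [p [H1 H2]].
  destruct (proj1 (locally_Cmod _ _) (clim_bounded _ _ _ H1)) as [eta [He Hb]].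
  exists 1, (Cmod (p t) + 1), eta. split; [lra|]. split; [exact He|].
  intros s _ [Hs1 Hs2]. rewrite H2, Cmod_mult, Rpower_1 by exact Hs1.
  apply Rmult_le_compat_r; [lra|]. apply Hb, Hs2.
Qed.

Lemma hold_plus (S : C -> Prop) (phi psi : C -> C) (t : C) :
  hold S phi t -> hold S psi t -> hold S (fun s => phi s + psi s)%C t.
Proof.
  intros [dl [M [eta [H1 [H2 H3]]]]] [dl' [M' [eta' [H1' [H2' H3']]]]].
  (* The radius is capped at 1, below which the smaller exponent gives the larger power. *)
  exists (Rmin dl dl'), (Rabs M + Rabs M'), (Rmin 1 (Rmin eta eta')).
  split; [apply Rmin_glb_lt; auto|]. split; [repeat apply Rmin_glb_lt; auto; lra|].
  intros s Hs [Hs1 Hs2].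
  pose proof (Rmin_l 1 (Rmin eta eta')). pose proof (Rmin_r 1 (Rmin eta eta')).
  pose proof (Rmin_l eta eta'). pose proof (Rmin_r eta eta').
  specialize (H3 s Hs ltac:(lra)). specialize (H3' s Hs ltac:(lra)).
  replace (phi s + psi s - (phi t + psi t))%C with ((phi s - phi t) + (psi s - psi t))%C by ring.
  eapply Rle_trans; [apply Cmod_triangle|]. rewrite Rmult_plus_distr_r.
  assert (K : forall N a, Rmin dl dl' <= a ->
     N * Rpower (Cmod (s - t)) a <= Rabs N * Rpower (Cmod (s - t)) (Rmin dl dl')).
  { intros N a Ha. pose proof (RRle_abs N). pose proof (Rabs_pos N).
    apply Rle_trans with (Rabs N * Rpower (Cmod (s - t)) a).
    - apply Rmult_le_compat_r; [apply Rlt_le, exp_pos|assumption].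
    - apply Rmult_le_compat_l; [assumption|]. apply Rpower_le_small; lra. }
  apply Rplus_le_compat; [eapply Rle_trans; [exact H3|apply K, Rmin_l]|eapply Rle_trans; [exact H3'|apply K, Rmin_r]].
Qed.

Lemma hold_ccont (S : C -> Prop) (phi : C -> C) (t : C) : hold S phi t -> ccont S phi t.
Proof.
  intros [dl [M [eta [H1 [H2 H3]]]]]. apply ccont_spec. intros eps He.
  pose proof (Rabs_pos M) as HM. set (x := eps / (Rabs M + 1)).
  assert (Hx : 0 < x) by (apply Rdiv_lt_0_compat; lra).
  set (y := Rpower x (/ dl)). assert (Hy : 0 < y) by apply exp_pos.
  assert (Eyx : Rpower y dl = x).
  { unfold y. rewrite Rpower_mult, Rinv_l, Rpower_1; lra. }
  exists (Rmin eta y). split; [apply Rmin_glb_lt; auto|]. intros s Hs Hst.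
  pose proof (Rmin_l eta y). pose proof (Rmin_r eta y).
  destruct (Ceq_dec s t) as [->|n].
  - replace (phi t - phi t)%C with (RtoC 0) by ring. rewrite Cmod_0. exact He.
  - pose proof (proj1 (Cmod_gt_0 _) (Csub_neq _ _ n)) as Hp.
    eapply Rle_lt_trans; [apply H3; [exact Hs|lra]|].
    assert (Q : Rpower (Cmod (s - t)) dl <= x) by (rewrite <- Eyx; apply Rle_Rpower_l; lra).
    assert (Q0 : 0 < Rpower (Cmod (s - t)) dl) by apply exp_pos.
    pose proof (RRle_abs M).
    apply Rle_lt_trans with (Rabs M * x); [nra|].
    apply Rlt_le_trans with ((Rabs M + 1) * x); [lra|]. unfold x. right. field. lra.
Qed.

Lemma ucont_bounded (phi : R -> C) : ucont phi -> exists B, 0 <= B /\ forall u, unit_itv u -> Cmod (phi u) <= B.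
Proof.
  intros H. destruct (continuity_ab_maj (fun u => Cmod (phi (clamp u))) 0 1) as [x [Hx _]]; [lra| |].
  - intros c _ eps He.
    destruct (proj1 (ucont_spec phi) H (clamp c) (clamp_unit c) eps He) as [eta [E1 E2]].
    exists eta. split; [exact E1|]. intros v [_ Hv].
    change (Rabs (Cmod (phi (clamp v)) - Cmod (phi (clamp c))) < eps).
    change (Rabs (v - c) < eta) in Hv.
    assert (Q : Cmod (phi (clamp v) - phi (clamp c)) < eps).
    { apply E2; [apply clamp_unit|]. eapply Rle_lt_trans; [apply clamp_lip|exact Hv]. }
    eapply Rle_lt_trans; [|exact Q]. apply Rabs_le. split.
    + pose proof (Cmod_triangle (phi (clamp v)) (- (phi (clamp v) - phi (clamp c)))) as T.
      rewrite Cmod_opp in T.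
      replace (phi (clamp v) + - (phi (clamp v) - phi (clamp c)))%C with (phi (clamp c)) in T by ring. lra.
    + pose proof (Cmod_triangle (phi (clamp c)) (phi (clamp v) - phi (clamp c))) as T.
      replace (phi (clamp c) + (phi (clamp v) - phi (clamp c)))%C with (phi (clamp v)) in T by ring. lra.
  - exists (Cmod (phi (clamp x))). split; [apply Cmod_ge_0|]. intros u Hu.
    specialize (Hx u Hu). cbv beta in Hx. rewrite (clamp_id u Hu) in Hx. exact Hx.
Qed.

(** The Hölder bound holds only near the foot [a]. Beyond u0 the power u^dl is at least u0^dl, so
    boundedness of [phi] on the segment gives the rest of the estimate. *)
Lemma hold_edge (S : C -> Prop) (phi : C -> C) (a q : C) :
  a <> q -> hold S phi a -> (forall u, unit_itv u -> S (seg a q u)) -> segcont phi a q ->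
  phi a = RtoC 0 ->
  exists dl M, 0 < dl /\ forall u, 0 < u <= 1 -> Cmod (phi (seg a q u)) <= M * Rpower u dl.
Proof.
  intros Naq [dl [M [eta [H1 [H2 H3]]]]] HS Hc H0.
  destruct (ucont_bounded _ Hc) as [B [HB0 HB]].
  assert (Hl : 0 < Cmod (q - a)) by (apply Cmod_gt_0, Csub_neq; auto).
  set (u0 := eta / Cmod (q - a)). assert (Hu0 : 0 < u0) by (apply Rdiv_lt_0_compat; auto).
  exists dl, (Rabs M * Rpower (Cmod (q - a)) dl + B / Rpower u0 dl). split; [exact H1|].
  intros u Hu.
  assert (P1 : 0 < Rpower u dl) by apply exp_pos.
  assert (P2 : 0 < Rpower u0 dl) by apply exp_pos.
  assert (P3 : 0 < Rpower (Cmod (q - a)) dl) by apply exp_pos.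
  assert (P4 : 0 <= B / Rpower u0 dl) by (apply Rmult_le_pos; [exact HB0|apply Rlt_le, Rinv_0_lt_compat, P2]).
  pose proof (Rabs_pos M) as HMp.
  assert (Uu : unit_itv u) by (unfold unit_itv; lra).
  rewrite Rmult_plus_distr_r.
  destruct (Rlt_or_le u u0) as [L|L].
  - assert (E : Cmod (seg a q u - a) = u * Cmod (q - a)).
    { replace (seg a q u - a)%C with (RtoC u * (q - a))%C by (unfold seg; ring).
      rewrite Cmod_mult, Cmod_R, Rabs_right by lra. reflexivity. }
    specialize (H3 (seg a q u) (HS u Uu)). rewrite E, H0 in H3.
    replace (phi (seg a q u) - RtoC 0)%C with (phi (seg a q u)) in H3 by ring.
    rewrite <- Rpower_mult_distr in H3 by lra.
    assert (Hlt : u * Cmod (q - a) < eta).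
    { apply Rmult_lt_compat_r with (r := Cmod (q - a)) in L; [|exact Hl].
      unfold u0 in L. replace (eta / Cmod (q - a) * Cmod (q - a)) with eta in L by (field; lra). exact L. }
    specialize (H3 ltac:(split; [apply Rmult_lt_0_compat; lra|exact Hlt])).
    pose proof (RRle_abs M).
    assert (0 < Rpower u dl * Rpower (Cmod (q - a)) dl) by (apply Rmult_lt_0_compat; auto).
    assert (M * (Rpower u dl * Rpower (Cmod (q - a)) dl) <= Rabs M * (Rpower u dl * Rpower (Cmod (q - a)) dl))
      by (apply Rmult_le_compat_r; lra).
    assert (0 <= B / Rpower u0 dl * Rpower u dl) by (apply Rmult_le_pos; lra). lra.
  - assert (Q : Rpower u0 dl <= Rpower u dl) by (apply Rle_Rpower_l; lra).
    assert (B <= B / Rpower u0 dl * Rpower u dl).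
    { apply Rle_trans with (B / Rpower u0 dl * Rpower u0 dl); [right; field; lra|].
      apply Rmult_le_compat_l; auto. }
    assert (0 <= Rabs M * Rpower (Cmod (q - a)) dl * Rpower u dl)
      by (apply Rmult_le_pos; [apply Rmult_le_pos|]; lra).
    specialize (HB u Uu). cbv beta in HB. lra.
Qed.

(** * Continuation of [f] to small tents erected on the sides *)

(** The Hölder condition on the closed tent supplies continuity up to the boundary and, at the two
    feet, the power bound for the legs. Agreement with [f] is asked on the base only, where the
    integrals are exchanged. *)
Definition good_tent (f : C -> C) (a b q : C) : Prop := exists G : C -> C,
  (forall t, triangle a b q t -> hold (triangle a b q) G t) /\
  (forall x y, 0 < x -> 0 < y -> x + y < 1 -> cdiff G (bary a b q x y)) /\
  (forall u, unit_itv u -> G (seg a b u) = f (seg a b u)).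

(** The real part of conj D times the sum of the two unit vectors is |D| plus a number of modulus at
    most |D|, hence nonnegative: the exterior bisector leaves the corner at 90 degrees or more from
    either side. *)
Lemma ray_half_plane (D D' z om : C) (T : R) : D <> RtoC 0 -> D' <> RtoC 0 -> 0 <= T ->
  z = (om - RtoC T * (D / RtoC (Cmod D) + D' / RtoC (Cmod D')))%C ->
  Re (Cconj D * (z - om)) <= 0.
Proof.
  intros N N' HT ->.
  pose proof (proj1 (Cmod_gt_0 _) N) as P. pose proof (proj1 (Cmod_gt_0 _) N') as P'.
  assert (E1 : (Cconj D * (om - RtoC T * (D / RtoC (Cmod D) + D' / RtoC (Cmod D')) - om))%C
    = (- (RtoC T * (RtoC (Cmod D) + Cconj D * D' * RtoC (/ Cmod D'))))%C).
  { rewrite RtoC_inv by lra. transitivity (- (RtoC T * ((D * Cconj D) / RtoC (Cmod D) + Cconj D * D' / RtoC (Cmod D'))))%C.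
    - field. split; apply RtoC_neq0; lra.
    - rewrite <- Cmod2_conj, RtoC_pow. field. split; apply RtoC_neq0; lra. }
  rewrite E1.
  assert (B : - Cmod D <= Re (Cconj D * D' * RtoC (/ Cmod D'))).
  { pose proof (re_le_Cmod (Cconj D * D' * RtoC (/ Cmod D'))) as Q.
    rewrite !Cmod_mult, Cmod_conj, Cmod_R, (Rabs_right (/ _)) in Q
      by (apply Rle_ge, Rlt_le, Rinv_0_lt_compat, P').
    rewrite Rmult_assoc, Rinv_r, Rmult_1_r in Q by lra. apply Rabs_le_between in Q. lra. }
  set (V := (Cconj D * D' * RtoC (/ Cmod D'))%C) in *. clearbody V. destruct V as [v1 v2].
  simpl in *. nra.
Qed.

Lemma prev_next (k i : nat) : (i < k)%nat -> prev k (next k i) = i.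
Proof.
  intros H. unfold prev, next.
  destruct (Nat.eq_dec (S i) k) as [E|E].
  - rewrite E, Nat.Div0.mod_same, Nat.add_0_l, Nat.mod_small; lia.
  - rewrite (Nat.mod_small (S i)) by lia.
    replace (S i + pred k)%nat with (i + 1 * k)%nat by lia.
    rewrite Nat.Div0.mod_add, Nat.mod_small; lia.
Qed.

Lemma next_prev (k i : nat) : (i < k)%nat -> next k (prev k i) = i.
Proof.
  intros H. unfold prev, next.
  destruct i as [|i].
  - rewrite Nat.add_0_l, (Nat.mod_small (pred k)) by lia.
    replace (S (pred k)) with k by lia. apply Nat.Div0.mod_same.
  - replace (S i + pred k)%nat with (i + 1 * k)%nat by lia.
    rewrite Nat.Div0.mod_add, (Nat.mod_small i), Nat.mod_small; lia.
Qed.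

Lemma bisector_half_planes k w m z :
  convex_polygon k w -> (m < k)%nat -> exterior_bisector k w m z ->
  Re (Cconj (w (next k m) - w m) * (z - w m)) <= 0 /\
  Re (Cconj (w (prev k m) - w m) * (z - w m)) <= 0.
Proof.
  intros Hp Hm [T [HT Ez]]. unfold direction in Ez.
  assert (N1 := side_neq0 k w m Hp Hm).
  assert (Hpm : (prev k m < k)%nat) by (unfold prev; apply Nat.mod_upper_bound; lia).
  assert (N2 := side_neq0 k w (prev k m) Hp Hpm). rewrite next_prev in N2 by exact Hm.
  assert (N3 : (w (prev k m) - w m)%C <> RtoC 0).
  { intro Q. apply N2. transitivity (- (w (prev k m) - w m))%C; [ring|]. rewrite Q. ring. }
  split.
  - apply (ray_half_plane _ (w (prev k m) - w m)%C z (w m) T); auto.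
  - apply (ray_half_plane _ (w (next k m) - w m)%C z (w m) T); auto.
    rewrite Ez. ring.
Qed.

Lemma tent_dist k w i (s0 tau x y s r : R) :
  0 < tau -> in_simplex x y -> 0 < r ->
  Rabs (s0 - s) < r / (4 * (Cmod (w (next k i) - w i) + 1)) ->
  tau < r / (4 * (Cmod (w (next k i) - w i) + 1)) ->
  Cmod (side k w i (s0 + 2 * tau * x + tau * y) + outward k w i (tau * y)
        - side k w i s) < r.
Proof.
  intros Ht [Hx [Hy Hxy]] Hr H1 H2.
  set (d := (w (next k i) - w i)%C) in *. pose proof (Cmod_ge_0 d) as Hd.
  replace (side k w i (s0 + 2 * tau * x + tau * y) + outward k w i (tau * y)
        - side k w i s)%C
    with (RtoC (s0 - s + 2 * tau * x + tau * y) * d + RtoC (tau * y) * (- Ci * d))%C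
    by (unfold outward, seg, d; rewrite !RtoC_plus, RtoC_minus, !RtoC_mult; ring).
  eapply Rle_lt_trans; [apply Cmod_triangle|].
  rewrite !Cmod_mult, Cmod_opp, Cmod_Ci, Rmult_1_l, !Cmod_R, (Rabs_right (tau * y)) by nra.
  (* The displacements along and across the side add up to at most |s0-s| + 2 tau (x+y) < 3 rho side
     lengths, which the 4 in the denominator covers. *)
  set (rho := r / (4 * (Cmod d + 1))) in *.
  assert (Er : r = 4 * rho * (Cmod d + 1)) by (unfold rho; field; lra).
  assert (Hrho : 0 < rho) by (unfold rho; apply Rdiv_lt_0_compat; lra).
  assert (A1 : Rabs (s0 - s + 2 * tau * x + tau * y) <= Rabs (s0 - s) + (2 * tau * x + tau * y)).
  { rewrite Rplus_assoc. eapply Rle_trans; [apply Rabs_triang|].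
    rewrite (Rabs_right (2 * tau * x + tau * y)) by nra. lra. }
  rewrite <- Rmult_plus_distr_r, Er.
  apply Rle_lt_trans with (3 * rho * Cmod d); [|nra].
  apply Rmult_le_compat_r; [exact Hd|]. nra.
Qed.

Lemma good_tent_disc k w (f g : C -> C) (a b q c : C) (r : R) :
  continues (region k w) f (disc c r) g ->
  (forall t, triangle a b q t -> disc c r t) ->
  (forall u, unit_itv u -> region k w (seg a b u)) ->
  good_tent f a b q.
Proof.
  intros [Ha He] Ht Hb.
  assert (Hd : forall t, triangle a b q t -> cdiff g t) by (intros t Htt; apply ex_derive_cdiff, Ha, Ht, Htt).
  exists g. split; [|split].
  - intros t Htt. apply cdiff_hold, Hd, Htt.
  - intros x y Hx Hy Hxy. apply Hd. exists x, y. split; [unfold in_simplex; lra|reflexivity].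
  - intros u Hu. apply He; [apply Ht, seg_triangle_ab, Hu|apply Hb, Hu].
Qed.

(** The slit contains the corner, so [g] carries no information there: [G] is given the value of [f]
    at the corner, and the growth hypothesis becomes the Hölder condition at that point. *)
Lemma good_tent_slit k w (f g : C -> C) m (rho delta : R) (a b q : C) :
  continues (region k w) f (slit_disc k w m rho) g -> 0 < delta ->
  big_O (within (slit_disc k w m rho) (locally (w m)))
    (fun z => Finite (Cmod (g z - f (w m)))) (fun z => Rpower (Cmod (z - w m)) delta) ->
  (forall t, triangle a b q t -> t <> w m -> slit_disc k w m rho t) ->
  (forall x y, 0 < x -> 0 < y -> x + y < 1 -> bary a b q x y <> w m) ->
  (forall u, unit_itv u -> region k w (seg a b u)) ->
  good_tent f a b q.
Proof.
  intros [Ha He] Hdelta [M HM] Ht Hint Hb.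
  set (G := fun t => if Ceq_dec t (w m) then f (w m) else g t).
  assert (EG : forall t, t <> w m -> Cloc t (fun s => g s = G s)).
  { intros t n. generalize (Cloc_neq t (w m) n). apply filter_imp. intros s Hs.
    unfold G. destruct (Ceq_dec s (w m)); [congruence|reflexivity]. }
  assert (Hd : forall t, triangle a b q t -> t <> w m -> cdiff G t).
  { intros t Htt n. apply (cdiff_ext_loc g); [apply EG, n|]. apply ex_derive_cdiff, Ha, Ht; auto. }
  exists G. split; [|split].
  - intros t Htt. destruct (Ceq_dec t (w m)) as [->|n]; [|apply cdiff_hold, Hd; auto].
    destruct (proj1 (locally_Cmod (w m) _) HM) as [eta [E1 E2]].
    exists delta, M, eta. split; [exact Hdelta|]. split; [exact E1|].
    intros s Hs [Hs1 Hs2].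
    assert (n : s <> w m).
    { intros ->. replace (w m - w m)%C with (RtoC 0) in Hs1 by ring. rewrite Cmod_0 in Hs1. lra. }
    specialize (E2 s Hs2 (Ht s Hs n)). simpl in E2.
    rewrite (Rabs_right (Cmod _)) in E2 by (apply Rle_ge, Cmod_ge_0).
    rewrite Rabs_right in E2 by (apply Rle_ge, Rlt_le, exp_pos).
    unfold G. destruct (Ceq_dec s (w m)); [congruence|]. destruct (Ceq_dec (w m) (w m)); [|congruence].
    exact E2.
  - intros x y Hx Hy Hxy. apply Hd; [|apply Hint; auto].
    exists x, y. split; [unfold in_simplex; lra|reflexivity].
  - intros u Hu. unfold G. destruct (Ceq_dec (seg a b u) (w m)) as [E|n]; [rewrite E; reflexivity|].
    apply He; [apply Ht; auto; apply seg_triangle_ab, Hu|apply Hb, Hu].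
Qed.

Definition continuable_at_sides k w (f : C -> C) : Prop :=
  forall i, (i < k)%nat -> forall z, open_side k w i z ->
    exists (rho : R) (g : C -> C), 0 < rho /\ continues (region k w) f (disc z rho) g.

Definition continuable_at_corners k w (f : C -> C) (delta : R) : Prop :=
  forall i, (i < k)%nat -> exists (rho : R) (g : C -> C),
    0 < rho /\ continues (region k w) f (slit_disc k w i rho) g /\
    big_O (within (slit_disc k w i rho) (locally (w i)))
      (fun z => Finite (Cmod (g z - f (w i)))) (fun z => Rpower (Cmod (z - w i)) delta).

(** At s = 0 and s = 1 a corner is continued across its slit disc, elsewhere a disc is available.
    The tent avoids the slit because its points project onto the side itself, whereas those of the
    slit project behind the corner ([Hproj]). *)
Lemma tents_near k w (f : C -> C) (delta : R)
  (hpoly : convex_polygon k w)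
  (hside : continuable_at_sides k w f) (hdelta : 0 < delta)
  (hcorner : continuable_at_corners k w f delta)
  i (s : R) :
  (i < k)%nat -> unit_itv s ->
  exists r, 0 < r /\ forall s0 tau, 0 < tau -> 0 <= s0 -> s0 + 2 * tau <= 1 ->
    Rabs (s0 - s) < r -> tau < r ->
    good_tent f (side k w i s0) (side k w i (s0 + 2 * tau))
      (side k w i s0 + outward k w i tau * (1, 1)%R)%C.
Proof.
  intros Hi Hs. assert (Hk : (0 < k)%nat) by lia.
  pose proof (side_neq0 k w i hpoly Hi) as Nd.
  pose proof (proj1 (Cmod_gt_0 _) Nd) as Hd.
  assert (Hbase : forall s0 tau, 0 < tau -> 0 <= s0 -> s0 + 2 * tau <= 1 -> forall u, unit_itv u ->
    region k w (seg (side k w i s0) (side k w i (s0 + 2 * tau)) u)).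
  { intros s0 tau H1 H2 H3 u Hu.
    apply region_seg; [| |exact Hu]; (apply region_seg; [apply region_corner, Hi|apply region_corner, next_lt, Hk|unfold unit_itv; lra]). }
  assert (Hpos : forall r, 0 < r -> 0 < r / (4 * (Cmod (w (next k i) - w i) + 1)))
    by (intros r Hr; apply Rdiv_lt_0_compat; lra).
  assert (Hell : forall s0 tau y, 0 < tau -> 0 < y ->
    ell k w i (side k w i s0 + outward k w i (tau * y))%C < 0).
  { intros s0 tau y H1 H2.
    rewrite ell_outward. assert (0 < tau * y * Cmod (w (next k i) - w i) ^ 2); [|lra].
    apply Rmult_lt_0_compat; [nra|apply pow_lt, Hd]. }
  assert (Hproj : forall al be v, Re (Cconj (w (next k i) - w i) *
      (side k w i al + outward k w i be - side k w i v))
      = (al - v) * Cmod (w (next k i) - w i) ^ 2).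
  { intros al be v. unfold outward, seg. rewrite Cmod2_alt.
    destruct (w (next k i)), (w i). unfold Cconj. simpl. ring. }
  pose proof (pow_lt _ 2 Hd) as Hd2.
  destruct (Req_dec s 0) as [Es0|Ns0]; [|destruct (Req_dec s 1) as [Es1|Ns1]].
  - destruct (hcorner i Hi) as [rho [g [Hr [Hg HO]]]].
    exists (rho / (4 * (Cmod (w (next k i) - w i) + 1))). split; [apply Hpos, Hr|].
    intros s0 tau Ht H0 H1 Hs0 Htau.
    apply (good_tent_slit k w f g i rho delta); auto.
    + intros t [x [y [Hxy ->]]]. rewrite tent_point. intros n. split.
      * unfold disc. pose proof (tent_dist k w i s0 tau x y s rho Ht Hxy Hr Hs0 Htau) as Q.
        rewrite Es0, seg_0 in Q. exact Q.
      * intros Hray. apply n.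
        destruct (bisector_half_planes k w i _ hpoly Hi Hray) as [Q _].
        pose proof (Hproj (s0 + 2 * tau * x + tau * y) (tau * y) 0) as Pj. rewrite seg_0 in Pj. rewrite Pj in Q.
        unfold in_simplex in Hxy.
        (* A tent point on the slit has nonpositive projection s0 + 2 tau x + tau y, which leaves
           only the corner. *)
        assert (Z : s0 = 0 /\ x = 0 /\ y = 0).
        { assert (s0 + 2 * tau * x + tau * y <= 0) by nra.
          assert (0 <= tau * x) by nra. assert (0 <= tau * y) by nra.
          split; [lra|]. split; apply Rle_antisym; try lra; nra. }
        destruct Z as [-> [-> ->]]. unfold outward.
        replace (0 + 2 * tau * 0 + tau * 0) with 0 by ring. rewrite seg_0, Rmult_0_r. ring.
    + intros x y Hx Hy Hxy E. rewrite tent_point in E.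
      specialize (Hell (s0 + 2 * tau * x + tau * y) tau y Ht Hy). rewrite E in Hell.
      unfold ell in Hell. replace (w i - w i)%C with (RtoC 0) in Hell by ring. rewrite cross_0_r in Hell. lra.
  - assert (Hm : (next k i < k)%nat) by (apply next_lt, Hk).
    destruct (hcorner (next k i) Hm) as [rho [g [Hr [Hg HO]]]].
    exists (rho / (4 * (Cmod (w (next k i) - w i) + 1))). split; [apply Hpos, Hr|].
    intros s0 tau Ht H0 H1 Hs0 Htau.
    apply (good_tent_slit k w f g (next k i) rho delta); auto.
    + intros t [x [y [Hxy ->]]]. rewrite tent_point. intros n. split.
      * unfold disc. pose proof (tent_dist k w i s0 tau x y s rho Ht Hxy Hr Hs0 Htau) as Q.
        rewrite Es1, seg_1 in Q. exact Q.
      * intros Hray. apply n.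
        destruct (bisector_half_planes k w (next k i) _ hpoly Hm Hray) as [_ Q].
        rewrite prev_next in Q by exact Hi.
        (* The corner is now the far end of the side, so the half plane inequality changes sign when
           rewritten with the direction of side [i]. *)
        assert (P : 0 <= Re (Cconj (w (next k i) - w i) *
             (side k w i (s0 + 2 * tau * x + tau * y) + outward k w i (tau * y)
              - side k w i 1))).
        { rewrite seg_1. set (m := next k i) in *.
          replace (Cconj (w m - w i)) with (- Cconj (w i - w m))%C
            by (destruct (w m), (w i); unfold Cconj; apply injective_projections; simpl; ring).
          match goal with |- 0 <= Re (- ?p * ?v)%C => replace (- p * v)%C with (- (p * v))%C by ring end.
          change (0 <= - Re (Cconj (w i - w m) * (seg (w i) (w m) (s0 + 2 * tau * x + tau * y) + outward k w i (tau * y) - w m))).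
          lra. }
        rewrite Hproj in P. unfold in_simplex in Hxy.
        assert (Z : y = 0 /\ s0 + 2 * tau * x + tau * y = 1).
        { assert (1 <= s0 + 2 * tau * x + tau * y) by nra.
          assert (tau * x + tau * y <= tau) by nra. assert (0 <= tau * y) by nra.
          split; [|lra]. apply Rle_antisym; try lra. nra. }
        destruct Z as [Zy ->]. rewrite Zy. unfold outward. rewrite seg_1, Rmult_0_r. ring.
    + intros x y Hx Hy Hxy E. rewrite tent_point in E.
      specialize (Hell (s0 + 2 * tau * x + tau * y) tau y Ht Hy). rewrite E in Hell.
      unfold ell in Hell. rewrite cross_self in Hell. lra.
  - assert (Ho : open_side k w i (side k w i s)).
    { exists s. split; [unfold unit_itv in Hs; lra|]. unfold seg. rewrite RtoC_minus. ring. }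
    destruct (hside i Hi _ Ho) as [rho [g [Hr Hg]]].
    exists (rho / (4 * (Cmod (w (next k i) - w i) + 1))). split; [apply Hpos, Hr|].
    intros s0 tau Ht H0 H1 Hs0 Htau.
    apply (good_tent_disc k w f g _ _ _ _ rho Hg); auto.
    intros t [x [y [Hxy ->]]]. rewrite tent_point. unfold disc. apply tent_dist; auto.
Qed.

(** A Lebesgue number of the local radii fixes one number of pieces: with 1/N < d, each tent is
    small enough for the local radius at some nearby parameter. *)
Lemma uniform_tents k w (f : C -> C) (delta : R)
  (hpoly : convex_polygon k w)
  (hside : continuable_at_sides k w f) (hdelta : 0 < delta)
  (hcorner : continuable_at_corners k w f delta)
  i :
  (i < k)%nat ->
  exists N, (0 < N)%nat /\ forall j, (j < N)%nat ->
    let s0 := INR j / INR N in let tau := / (2 * INR N) in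
    good_tent f (side k w i s0) (side k w i (s0 + 2 * tau))
      (side k w i s0 + outward k w i tau * (1, 1)%R)%C.
Proof.
  intros Hi.
  assert (loc : forall s, exists d : posreal, unit_itv s -> forall s0 tau, 0 < tau -> 0 <= s0 -> s0 + 2 * tau <= 1 ->
    Rabs (s0 - s) < d -> tau < d ->
    good_tent f (side k w i s0) (side k w i (s0 + 2 * tau))
      (side k w i s0 + outward k w i tau * (1, 1)%R)%C).
  { intros s. destruct (excluded_middle_informative (unit_itv s)) as [Hs|Hs].
    - destruct (tents_near k w f delta hpoly hside hdelta hcorner i s Hi Hs) as [r [Hr H]].
      exists (mkposreal r Hr). intros _. exact H.
    - exists (mkposreal 1 Rlt_0_1). tauto. }
  set (del := fun s => proj1_sig (constructive_indefinite_description _ (loc s))).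
  destruct (compactness_value_1d 0 1 del) as [d Hd].
  destruct (archimed_cor1 d (cond_pos d)) as [N [HN1 HN2]].
  exists N. split; [exact HN2|]. intros j Hj s0 tau.
  assert (HN0 : 0 < INR N) by (apply lt_0_INR, HN2).
  assert (Hj1 : INR j + 1 <= INR N) by (rewrite <- S_INR; apply le_INR; lia).
  pose proof (pos_INR j) as Hj0.
  assert (Ht : 0 < tau) by (unfold tau; apply Rinv_0_lt_compat; lra).
  assert (Ht2 : 2 * tau = / INR N) by (unfold tau; field; lra).
  assert (Hs0 : 0 <= s0) by (apply Rmult_le_pos; [exact Hj0|apply Rlt_le, Rinv_0_lt_compat, HN0]).
  assert (Hs1 : s0 + 2 * tau <= 1).
  { rewrite Ht2. unfold s0. apply Rmult_le_reg_r with (INR N); [exact HN0|].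
    replace ((INR j / INR N + / INR N) * INR N) with (INR j + 1) by (field; lra). lra. }
  apply NNPP. intros Hbad. apply (Hd s0); [lra|]. intros [t [Htt [Hst Hdt]]]. apply Hbad.
  revert Hst Hdt. unfold del.
  destruct (constructive_indefinite_description _ (loc t)) as [dt Hloc]. simpl. intros Hst Hdt.
  apply Hloc; auto. lra.
Qed.

(** * Assembly *)

Lemma interpolation (f : C -> C) (l : list C) :
  exists n p, is_poly n p /\ forall a, In a l -> p a = f a.
Proof.
  assert (V : forall l : list C, exists v, is_poly (length l) v /\
    (forall a, In a l -> v a = RtoC 0) /\ (forall a, ~ In a l -> v a <> RtoC 0)).
  { clear l. induction l as [|b l [v [V1 [V2 V3]]]].
    - exists (fun _ => RtoC 1). split; [apply is_poly_const|]. split; [intros a []|].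
      intros a _. apply RtoC_neq0. lra.
    - exists (fun z => (1 * z + (- b)) * v z)%C. split; [apply (is_poly_mult 1 (length l)); [apply is_poly_lin|exact V1]|].
      split.
      + intros a [->|Ha]; [ring|]. rewrite V2 by exact Ha. ring.
      + intros a Ha. apply Cmult_neq_0.
        * intro E. apply Ha. left. symmetry. apply NNPP. intro n.
          apply (Csub_neq a b n). rewrite <- E. ring.
        * apply V3. intro Hl. apply Ha. right. exact Hl. }
  induction l as [|b l [n [p [P1 P2]]]].
  - exists 0%nat, (fun _ => RtoC 0). split; [apply is_poly_const|]. intros a [].
  (* Nodes may be repeated, as corners shared by two sides will be. A new node is met in Newton's
     way, by adding a multiple of a polynomial vanishing at the old ones. *)
  - destruct (classic (In b l)) as [Hb|Hb].
    + exists n, p. split; [exact P1|]. intros a [<-|Ha]; auto.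
    + destruct (V l) as [v [V1 [V2 V3]]].
      exists (n + length l)%nat, (fun z => p z + (f b - p b) / v b * v z)%C. split.
      * apply is_poly_plus; [apply is_poly_le with n; [lia|exact P1]|].
        apply is_poly_scal. apply is_poly_le with (length l); [lia|exact V1].
      * intros a [<-|Ha]; [field; apply V3, Hb|]. rewrite (P2 a Ha), (V2 a Ha). ring.
Qed.

(** The second end point is written s0 + 2 tau with tau = 1/(2N), to match the feet of the tents. *)
Lemma SI_subdivide F (a b : C) (N : nat) : (0 < N)%nat -> segcont F a b ->
  SI F a b = csum N (fun j => SI F (seg a b (INR j / INR N)) (seg a b (INR j / INR N + 2 * / (2 * INR N)))).
Proof.
  intros HN HF. assert (HN0 : 0 < INR N) by (apply lt_0_INR, HN).
  assert (U : forall n, (n <= N)%nat -> unit_itv (INR n / INR N)).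
  { intros n Hn. apply le_INR in Hn. pose proof (pos_INR n). split.
    - apply Rmult_le_pos; [assumption|apply Rlt_le, Rinv_0_lt_compat, HN0].
    - apply Rmult_le_reg_r with (INR N); [exact HN0|].
      unfold Rdiv. rewrite Rmult_assoc, Rinv_l; lra. }
  assert (P : forall n, (n <= N)%nat -> SI F (seg a b 0) (seg a b (INR n / INR N)) =
    csum n (fun j => SI F (seg a b (INR j / INR N)) (seg a b (INR j / INR N + 2 * / (2 * INR N))))).
  { induction n as [|n IH]; intros Hn.
    - simpl csum. simpl INR. unfold Rdiv. rewrite Rmult_0_l. unfold SI. ring.
    - cbn [csum]. rewrite <- IH by lia.
      replace (INR n / INR N + 2 * / (2 * INR N)) with (INR (S n) / INR N) by (rewrite S_INR; field; lra).
      symmetry. apply SI_Chasles; auto. + unfold unit_itv; lra. + apply U; lia. }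
  rewrite <- P by lia. rewrite seg_0.
  replace (INR N / INR N) with 1 by (field; lra). rewrite seg_1. reflexivity.
Qed.

Lemma continuous_on_ccont (K : C -> Prop) (f : C -> C) (t : C) :
  continuous_on K f -> K t -> ccont K f t.
Proof.
  intros H Ht. split; [exact _|]. intros eps He.
  apply (H t Ht (fun y => Cmod (y - f t) < eps)).
  apply (locally_Cmod (f t)). exists eps. auto.
Qed.

Lemma corner_singular_approximable
  k w (f : C -> C) (delta : R)
  (hpoly : convex_polygon k w)
  (hcont : continuous_on (region k w) f)
  (hint : analytic_on (interior (region k w)) f)
  (hside : continuable_at_sides k w f) (hdelta : 0 < delta)
  (hcorner : continuable_at_corners k w f delta) :
  approximable k w f.
Proof.
  assert (Hk : (0 < k)%nat) by (destruct hpoly; lia).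
  assert (ex : forall i, exists N, (i < k)%nat -> (0 < N)%nat /\ forall j, (j < N)%nat ->
    let s0 := INR j / INR N in let tau := / (2 * INR N) in
    good_tent f (side k w i s0) (side k w i (s0 + 2 * tau))
      (side k w i s0 + outward k w i tau * (1, 1)%R)%C).
  { intros i. destruct (Nat.le_gt_cases k i) as [L|L]; [exists 0%nat; lia|].
    destruct (uniform_tents k w f delta hpoly hside hdelta hcorner i L) as [N HN]. exists N. auto. }
  set (N := fun i => proj1_sig (constructive_indefinite_description _ (ex i))).
  assert (HN : forall i, (i < k)%nat -> (0 < N i)%nat /\ forall j, (j < N i)%nat ->
    let s0 := INR j / INR (N i) in let tau := / (2 * INR (N i)) in
    good_tent f (side k w i s0) (side k w i (s0 + 2 * tau))
      (side k w i s0 + outward k w i tau * (1, 1)%R)%C).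
  { intros i. exact (proj2_sig (constructive_indefinite_description _ (ex i))). }
  clearbody N. clear ex.
  (* The range has [S (N i)] terms so that the end of the last piece, the next corner, is also a
     node. *)
  set (nodes := flat_map (fun i => map (fun j => side k w i (INR j / INR (N i)))
                                       (List.seq 0 (S (N i)))) (List.seq 0 k)).
  destruct (interpolation f nodes) as [n [p [Hpp Hnodes]]].
  assert (Hnode : forall i j, (i < k)%nat -> (j <= N i)%nat ->
    p (side k w i (INR j / INR (N i))) = f (side k w i (INR j / INR (N i)))).
  { intros i j Hi Hj. apply Hnodes. apply in_flat_map. exists i. split; [apply in_seq; lia|].
    apply in_map_iff. exists j. split; [reflexivity|]. apply in_seq. lia. }
  set (phi := fun t => (f t + - RtoC 1 * p t)%C).
  assert (Hpiece : forall i j, (i < k)%nat -> (j < N i)%nat ->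
    approximable k w (fun z => SI (fun t => phi t * / (t - z))%C
      (side k w i (INR j / INR (N i)))
      (side k w i (INR j / INR (N i) + 2 * / (2 * INR (N i)))))).
  { intros i j Hi Hj. destruct (HN i Hi) as [HN0 HNj]. specialize (HNj j Hj). cbv zeta in HNj.
    assert (HNp : 0 < INR (N i)) by (apply lt_0_INR, HN0).
    set (s0 := INR j / INR (N i)) in *. set (tau := / (2 * INR (N i))) in *.
    assert (Ht : 0 < tau) by (unfold tau; apply Rinv_0_lt_compat; lra).
    set (a := side k w i s0) in *.
    set (b := side k w i (s0 + 2 * tau)) in *.
    set (q := (a + outward k w i tau * (1, 1)%R)%C) in *.
    destruct HNj as [G [G1 [G2 G3]]].
    assert (Pa : p a = f a) by (unfold a, s0; apply Hnode; auto; lia).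
    assert (Pb : p b = f b).
    { unfold b. replace (s0 + 2 * tau) with (INR (S j) / INR (N i)).
      - apply Hnode; auto.
      - rewrite S_INR. unfold s0, tau. field. lra. }
    (* [h] continues f - p to the tent and vanishes at both feet, which [hold_edge] turns into the
       power bounds on the two legs. *)
    set (h := fun t => (G t + - RtoC 1 * p t)%C).
    assert (Hh : forall t, triangle a b q t -> hold (triangle a b q) h t).
    { intros t Htt. apply hold_plus; [apply G1, Htt|]. apply cdiff_hold.
      apply cdiff_mult; [apply cdiff_const|eapply is_poly_cdiff, Hpp]. }
    assert (Hhc : forall t, triangle a b q t -> ccont (triangle a b q) h t)
      by (intros t Htt; apply hold_ccont, Hh, Htt).
    assert (Taq : forall u, unit_itv u -> triangle a b q (seg a q u)) by (intros; apply seg_triangle_ac; auto).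
    assert (Tbq : forall u, unit_itv u -> triangle a b q (seg b q u)) by (intros; apply seg_triangle_bc; auto).
    assert (U0 : unit_itv 0) by (unfold unit_itv; lra). assert (U1 : unit_itv 1) by (unfold unit_itv; lra).
    assert (Ha0 : h a = RtoC 0).
    { unfold h. pose proof (G3 0 U0) as E. rewrite seg_0 in E. rewrite E, Pa. ring. }
    assert (Hb0 : h b = RtoC 0).
    { unfold h. pose proof (G3 1 U1) as E. rewrite seg_1 in E. rewrite E, Pb. ring. }
    pose proof (proj1 (Cmod_gt_0 _) (side_neq0 k w i hpoly Hi)) as Hd.
    assert (Lq : ell k w i q < 0).
    { pose proof (tent_point k w i s0 tau 0 1) as E. rewrite bary_c in E. fold a q in E.
      rewrite E, ell_outward, Rmult_1_r. assert (0 < tau * Cmod (w (next k i) - w i) ^ 2); [|lra].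
      apply Rmult_lt_0_compat; [exact Ht|apply pow_lt, Hd]. }
    assert (L0 : forall s, ell k w i (side k w i s) = 0).
    { intros s. rewrite (ell_seg k w i _ s).
      replace (side k w i s - side k w i s)%C with (RtoC 0) by ring. apply cross_0_r. }
    destruct (hold_edge (triangle a b q) h a q) as [dl [M [Hdl HM]]]; auto.
    { intro E. rewrite <- E in Lq. unfold a in Lq. rewrite L0 in Lq. lra. }
    { apply Hh. pose proof (Taq 0 U0) as Q. rewrite seg_0 in Q. exact Q. }
    { apply (segcont_of_ccont (triangle a b q)); auto. }
    destruct (hold_edge (triangle a b q) h b q) as [dl' [M' [Hdl' HM']]]; auto.
    { intro E. rewrite <- E in Lq. unfold b in Lq. rewrite L0 in Lq. lra. }
    { apply Hh. pose proof (Tbq 0 U0) as Q. rewrite seg_0 in Q. exact Q. }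
    { apply (segcont_of_ccont (triangle a b q)); auto. }
    apply approximable_ext with (fun z => SI (fun t => h t * / (t - z))%C a b).
    - intros z _. apply SI_ext. intros u Hu. unfold h, phi. rewrite G3 by (unfold unit_itv; lra). reflexivity.
    - apply (tent_approximable k w i s0 tau h M dl M' dl'); auto.
      intros x y Hx Hy Hxy. apply cdiff_plus; [apply G2; auto|].
      apply cdiff_mult; [apply cdiff_const|eapply is_poly_cdiff, Hpp]. }
  destruct (interior_exists k w hpoly) as [z0 Hz0].
  pose proof (winding_neq0 k w z0 hpoly Hz0) as HW.
  assert (Cphi : forall t, region k w t -> ccont (region k w) phi t).
  { intros t Ht. apply ccont_plus; [apply continuous_on_ccont; auto|].
    apply cdiff_ccont. apply cdiff_mult; [apply cdiff_const|eapply is_poly_cdiff, Hpp]. }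
  (* Cauchy's formula for f - p over the subdivided boundary, solved for [f]; W is taken at the
     fixed point [z0] so that it is a scalar. Interior points suffice, since [approximable] looks at
     its function only there. *)
  apply approximable_ext with (fun z => p z + / winding k w z0 *
     csum k (fun i => csum (N i) (fun j => SI (fun t => phi t * / (t - z))%C
      (side k w i (INR j / INR (N i)))
      (side k w i (INR j / INR (N i) + 2 * / (2 * INR (N i)))))))%C.
  - intros z Hz.
    rewrite (csum_ext k _ (fun i => SI (fun t => phi t * / (t - z))%C (w i) (w (next k i)))).
    + rewrite (cauchy_polygon k w phi z hpoly Cphi); auto.
      * rewrite (winding_const k w z z0) by auto. unfold phi. field. exact HW.
      * intros t Ht. apply cdiff_plus; [apply ex_derive_cdiff, hint, Ht|].
        apply cdiff_mult; [apply cdiff_const|eapply is_poly_cdiff, Hpp].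
    + intros i Hi. symmetry. apply SI_subdivide; [apply HN, Hi|].
      pose proof (interior_ell k w i z hpoly Hi Hz) as Hl.
      apply (ucont_mult (fun u => phi (side k w i u))).
      * apply (segcont_of_ccont (region k w)); auto. intros u Hu.
        apply region_seg; auto; apply region_corner; auto. apply next_lt, Hk.
      * apply (segcont_inv (w i) (w (next k i)) z). intros u _. apply side_neq_point, Hl.
  - apply approximable_plus; [apply approximable_poly with n, Hpp|].
    apply approximable_scal. apply (approximable_csum k w k (fun i z => csum (N i) _)).
    intros i Hi. apply (approximable_csum k w (N i) (fun j z => SI _ _ _)). intros j Hj. apply Hpiece; auto.
Qed.

(** * Compact subsets, suprema and the choice of degree *)

Lemma compact_deep k w (E : C -> Prop) :
  convex_polygon k w -> compact_set E -> (forall z, E z -> interior (region k w) z) ->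
  exists d, 0 < d /\ forall z, E z -> deep k w d z.
Proof.
  intros Hp HE Hin.
  assert (Hop : forall c n, (n <= k)%nat -> open (T := C_UniformSpace) (fun z => forall i, (i < n)%nat -> c < ell k w i z)).
  { intros c n Hn z Hz. induction n as [|n IH].
    - apply filter_forall. intros; lia.
    - pose proof (side_neq0 k w n Hp Hn) as Nd. apply Cmod_gt_0 in Nd.
      assert (L : Cloc z (fun t => c < ell k w n t)).
      { apply locally_Cmod. exists ((ell k w n z - c) / Cmod (w (next k n) - w n)).
        specialize (Hz n ltac:(lia)). split; [apply Rdiv_lt_0_compat; lra|]. intros t Ht.
        pose proof (ell_lip k w n t z) as Q. apply Rabs_le_between in Q.
        apply Rmult_lt_compat_l with (r := Cmod (w (next k n) - w n)) in Ht; [|exact Nd].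
        replace (Cmod (w (next k n) - w n) * ((ell k w n z - c) / Cmod (w (next k n) - w n)))
          with (ell k w n z - c) in Ht by (field; lra). lra. }
      assert (IH' := IH ltac:(lia) ltac:(intros; apply Hz; lia)).
      generalize (filter_and _ _ L IH'). apply filter_imp. intros t [T1 T2] i Hi.
      destruct (Nat.eq_dec i n) as [->|]; [exact T1|apply T2; lia]. }
  (* The open sets where every [ell] exceeds 1/(n+1) exhaust the interior; a finite subcover yields
     one depth for all of [E]. *)
  destruct (HE nat (fun n z => forall i, (i < k)%nat -> / (INR n + 1) < ell k w i z)) as [l Hl].
  - intros n. apply Hop. lia.
  - intros z Hz.
    assert (P : forall n, (n <= k)%nat -> exists c, 0 < c /\ forall i, (i < n)%nat -> c < ell k w i z).
    { induction n as [|n IH]; intros Hn; [exists 1; split; [lra|intros; lia]|].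
      destruct IH as [c [C1 C2]]; [lia|]. pose proof (interior_ell k w n z Hp Hn (Hin z Hz)) as Q.
      exists (Rmin c (ell k w n z / 2)). split; [apply Rmin_glb_lt; lra|]. intros i Hi.
      pose proof (Rmin_l c (ell k w n z / 2)). pose proof (Rmin_r c (ell k w n z / 2)).
      destruct (Nat.eq_dec i n) as [->|]; [lra|]. specialize (C2 i ltac:(lia)). lra. }
    destruct (P k (Nat.le_refl k)) as [c [C1 C2]].
    destruct (archimed_cor1 c C1) as [n [N1 N2]]. exists n. intros i Hi.
    apply Rlt_trans with c; [|auto]. apply Rle_lt_trans with (/ INR n); [|exact N1].
    apply lt_0_INR in N2. apply Rinv_le_contravar; lra.
  - assert (Q : exists d, 0 < d /\ forall n, In n l -> d <= / (INR n + 1)).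
    { clear Hl. induction l as [|n l [d [D1 D2]]]; [exists 1; split; [lra|intros n []]|].
      assert (0 < / (INR n + 1)) by (apply Rinv_0_lt_compat; pose proof (pos_INR n); lra).
      exists (Rmin d (/ (INR n + 1))). split; [apply Rmin_glb_lt; auto|]. intros m [<-|Hm]; [apply Rmin_r|].
      eapply Rle_trans; [apply Rmin_l|apply D2, Hm]. }
    destruct Q as [d [D1 D2]]. exists d. split; [exact D1|]. intros z Hz i Hi.
    destruct (Hl z Hz) as [n [N1 N2]]. specialize (D2 n N1). specialize (N2 i Hi). lra.
Qed.

Lemma sup_norm_le (X : C -> Prop) (g : C -> C) (B : R) : 0 <= B ->
  (forall z, X z -> Cmod (g z) <= B) -> exists s, sup_norm X g = Finite s /\ 0 <= s <= B.
Proof.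
  intros HB H. unfold sup_norm.
  destruct (Lub_Rbar_correct (fun y => y = 0 \/ exists z, X z /\ y = Cmod (g z))) as [U L].
  assert (L1 := L (Finite B)). assert (U1 := U 0 (or_introl eq_refl)).
  destruct (Lub_Rbar _) as [s| |].
  - exists s. split; [reflexivity|]. split; [exact U1|]. apply L1.
    intros x [->|[z [Hz ->]]]; simpl; auto.
  - exfalso. apply L1. intros x [->|[z [Hz ->]]]; simpl; auto.
  - exfalso. exact U1.
Qed.

Lemma sup_norm_ge_0 (X : C -> Prop) (g : C -> C) : Rbar_le 0 (sup_norm X g).
Proof. apply Lub_Rbar_correct. left. reflexivity. Qed.

(** The error bounds come from Cauchy's formula and so hold in the interior; continuity carries them
    to a boundary point along a segment from an interior one. *)
Lemma le_of_interior k w (phi : C -> C) (B : R) z :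
  convex_polygon k w -> ccont (region k w) phi z -> region k w z ->
  (forall t, interior (region k w) t -> Cmod (phi t) <= B) -> Cmod (phi z) <= B.
Proof.
  intros Hp Hc Hz H. destruct (interior_exists k w Hp) as [z0 Hz0].
  apply le_epsilon. intros eps He.
  destruct (proj1 (ccont_spec _ _ _) Hc eps He) as [eta [E1 E2]].
  pose proof (Cmod_ge_0 (z0 - z)) as Hd.
  set (v := Rmin (1 / 2) (eta / (2 * (Cmod (z0 - z) + 1)))).
  assert (Hq : 0 < eta / (2 * (Cmod (z0 - z) + 1))) by (apply Rdiv_lt_0_compat; lra).
  assert (Hv : 0 < v <= 1 / 2) by (unfold v, Rmin; destruct Rle_dec; lra).
  assert (Hv2 : v <= eta / (2 * (Cmod (z0 - z) + 1))) by apply Rmin_r.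
  set (t := seg z0 z (1 - v)).
  assert (Ht : interior (region k w) t) by (apply interior_toward; auto; lra).
  assert (Htz : Cmod (t - z) < eta).
  { unfold t. replace (seg z0 z (1 - v) - z)%C with (RtoC v * (z0 - z))%C
      by (unfold seg; rewrite RtoC_minus; ring).
    rewrite Cmod_mult, Cmod_R, Rabs_right by lra.
    apply Rle_lt_trans with (eta / (2 * (Cmod (z0 - z) + 1)) * (Cmod (z0 - z) + 1)).
    - apply Rmult_le_compat; lra.
    - replace (eta / (2 * (Cmod (z0 - z) + 1)) * (Cmod (z0 - z) + 1)) with (eta / 2) by (field; lra). lra. }
  specialize (E2 t (interior_sub _ _ Ht) Htz). specialize (H t Ht).
  pose proof (Cmod_triangle (phi t) (- (phi t - phi z))) as T. rewrite Cmod_opp in T.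
  replace (phi t + - (phi t - phi z))%C with (phi z) in T by ring. lra.
Qed.

Lemma Rbar_limsup_0 (u : nat -> Rbar) (M c : R) (n0 : nat) : 0 < c ->
  (forall n, Rbar_le 0 (u n)) -> (forall n, (n0 <= n)%nat -> Rbar_le (u n) (Finite (M * exp (- c * INR n)))) ->
  Rbar_limsup u = Finite 0.
Proof.
  intros Hc Hu0 Hu. apply is_inf_seq_unique. intros eps. split.
  - intros n. apply Rbar_lt_le_trans with 0; [simpl; pose proof (cond_pos eps); lra|].
    apply (Sup_seq_minor_le _ 0 0%nat). apply Hu0.
  - pose proof (cond_pos eps) as He. pose proof (Rabs_pos M) as HM.
    (* Chosen so that exp (c x) >= 1 + c x exceeds 2 (|M| + 1)/eps. Aiming at eps/2 keeps the
       inequality strict after passing to the supremum. *)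
    destruct (INR_unbounded (2 * (Rabs M + 1) / (c * eps))) as [m1 Hm1].
    exists (n0 + m1)%nat.
    apply Rbar_le_lt_trans with (Finite (eps / 2)); [|simpl; lra].
    apply Rbar_le_trans with (Sup_seq (fun _ => Finite (eps / 2))).
    + apply Sup_seq_le. intros n. eapply Rbar_le_trans; [apply Hu; lia|]. simpl.
      assert (Hn : 2 * (Rabs M + 1) / (c * eps) < INR (n + (n0 + m1))).
      { eapply Rlt_le_trans; [exact Hm1|]. apply le_INR. lia. }
      set (x := INR (n + (n0 + m1))) in *.
      assert (Hx : 2 * (Rabs M + 1) < c * x * eps).
      { apply Rmult_lt_compat_r with (r := c * eps) in Hn; [|apply Rmult_lt_0_compat; lra].
        replace (2 * (Rabs M + 1) / (c * eps) * (c * eps)) with (2 * (Rabs M + 1)) in Hn by (field; lra). lra. }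
      assert (Hcx : 0 < c * x) by nra.
      pose proof (exp_ineq1_le (c * x)) as He1.
      replace (- c * x) with (- (c * x)) by ring. rewrite exp_Ropp.
      apply Rmult_le_reg_r with (exp (c * x)); [apply exp_pos|].
      rewrite Rmult_assoc, Rinv_l by (apply Rgt_not_eq, exp_pos).
      pose proof (RRle_abs M). nra.
    + assert (Q : Sup_seq (fun _ => Finite (eps / 2)) = Finite (eps / 2)).
      { apply is_sup_seq_unique. intros e. split; [intros n; simpl; pose proof (cond_pos e); lra|].
        exists 0%nat. simpl. pose proof (cond_pos e). lra. }
      rewrite Q. apply Rbar_le_refl.
Qed.

(** For A <= n, the largest m whose approximant, of degree at most A (m^2 + 1), is allowed in degree
    n. *)
Definition level (A n : nat) : nat := Nat.sqrt (n / A - 1).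

(** Maximality of m gives n <= A ((m+1)^2 + 1). The losses 3 and 2 come from the crude bounds
    (m+1)^2 + 1 <= (m+3)^2 and (m+1)^2 + 1 <= 2 m^2 + 4. *)
Lemma level_spec (A n : nat) : (0 < A)%nat -> (A <= n)%nat ->
  (A * S (level A n * level A n) <= n)%nat /\
  sqrt (INR n) / sqrt (INR A) - 3 <= INR (level A n) /\
  INR n / (2 * INR A) - 2 <= INR (level A n * level A n).
Proof.
  intros HA Hn.
  assert (H1 : (1 <= n / A)%nat) by (apply Nat.div_le_lower_bound; lia).
  pose proof (Nat.sqrt_spec (n / A - 1) ltac:(lia)) as [S1 S2]. fold (level A n) in S1, S2.
  set (m := level A n) in *.
  pose proof (Nat.mul_div_le n A ltac:(lia)) as D1.
  pose proof (Nat.mul_succ_div_gt n A ltac:(lia)) as D2.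
  split; [nia|].
  assert (HAr : 0 < INR A) by (apply lt_0_INR, HA).
  assert (Q : INR n <= INR A * ((INR m + 1) * (INR m + 1) + 1)).
  { replace (INR A * ((INR m + 1) * (INR m + 1) + 1)) with (INR (A * (S m * S m + 1)))
      by (rewrite mult_INR, plus_INR, mult_INR, !S_INR; simpl; ring).
    apply le_INR. nia. }
  pose proof (pos_INR m) as Hm.
  split.
  - assert (HsA : 0 < sqrt (INR A)) by (apply sqrt_lt_R0, HAr).
    assert (R1 : sqrt (INR n) <= sqrt (INR A) * (INR m + 3)).
    { rewrite <- (sqrt_Rsqr (INR m + 3)) by lra. rewrite <- sqrt_mult_alt by lra.
      apply sqrt_le_1_alt. eapply Rle_trans; [exact Q|]. apply Rmult_le_compat_l; [lra|]. unfold Rsqr. nra. }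
    apply Rmult_le_reg_r with (sqrt (INR A)); [exact HsA|].
    replace ((sqrt (INR n) / sqrt (INR A) - 3) * sqrt (INR A)) with (sqrt (INR n) - 3 * sqrt (INR A)) by (field; lra).
    lra.
  - rewrite mult_INR. apply Rmult_le_reg_r with (2 * INR A); [lra|].
    replace ((INR n / (2 * INR A) - 2) * (2 * INR A)) with (INR n - 4 * INR A) by (field; lra).
    assert (Q2 : (INR m + 1) * (INR m + 1) + 1 <= 2 * (INR m * INR m) + 4) by nra.
    apply Rmult_le_compat_l with (r := INR A) in Q2; lra.
Qed.

Theorem theorem3
  (k : nat) (w : nat -> C) (f : C -> C) (delta : R)
  (hpoly : convex_polygon k w)
  (hcont : continuous_on (region k w) f)
  (hint : analytic_on (interior (region k w)) f)
  (hside : forall i, (i < k)%nat -> forall z, open_side k w i z ->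
     exists (rho : R) (g : C -> C),
       0 < rho /\ continues (region k w) f (disc z rho) g)
  (hdelta : 0 < delta)
  (hcorner : forall i, (i < k)%nat ->
     exists (rho : R) (g : C -> C),
       0 < rho /\
       continues (region k w) f (slit_disc k w i rho) g /\
       big_O (within (slit_disc k w i rho) (locally (w i)))
         (fun z => Finite (Cmod (g z - f (w i))))
         (fun z => Rpower (Cmod (z - w i)) delta)) :
  exists r : nat -> C -> C,
    (forall n, (1 <= n)%nat -> rational_on (region k w) n (r n)) /\
    (exists c0 : R, 0 < c0 /\
       big_O eventually
         (fun n => sup_norm (region k w) (fun z => f z - r n z)%C)
         (fun n => exp (- c0 * sqrt (INR n)))) /\
    (forall E : C -> Prop, compact_set E ->
       (forall z, E z -> interior (region k w) z) ->
       exists c : R, 0 < c /\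
         Rbar_limsup (fun n =>
           Rbar_mult (sup_norm E (fun z => f z - r n z)%C)
                     (Finite (exp (c * INR n)))) = Finite 0).
Proof.
  destruct (corner_singular_approximable k w f delta hpoly hcont hint hside hdelta hcorner)
    as [A0 [R0 [c0 [M [Hc0 [HM [Hrat [Hbd Hdeep]]]]]]]].
  (* The successor makes [A] positive, as the divisions by it require. *)
  set (A := S A0).
  assert (Hpq : forall m, exists pq : (C -> C) * (C -> C), is_poly (A * S (m * m)) (fst pq) /\
     is_poly (A * S (m * m)) (snd pq) /\
     forall z, region k w z -> snd pq z <> RtoC 0 /\ R0 m z = (fst pq z / snd pq z)%C).
  { intros m. destruct (rat_on_le _ (A0 * S (m * m)) (A * S (m * m)) _ ltac:(unfold A; nia) (Hrat m)) as [p [q [H1 [H2 H3]]]].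
    exists (p, q). auto. }
  set (P := fun m => fst (proj1_sig (constructive_indefinite_description _ (Hpq m)))).
  set (Q := fun m => snd (proj1_sig (constructive_indefinite_description _ (Hpq m)))).
  assert (HPQ : forall m, is_poly (A * S (m * m)) (P m) /\ is_poly (A * S (m * m)) (Q m) /\
     forall z, region k w z -> Q m z <> RtoC 0 /\ R0 m z = (P m z / Q m z)%C).
  { intro m. exact (proj2_sig (constructive_indefinite_description _ (Hpq m))). }
  clearbody P Q. clear Hpq.
  assert (HA : (0 < A)%nat) by (unfold A; lia).
  assert (HAr : 0 < INR A) by (apply lt_0_INR, HA).
  (* [rational_on] demands the quotient form at every z, hence [P] and [Q] instead of [R0]. Degrees
     below [A] get the zero function, which affects neither asymptotic claim. *)
  set (r := fun n z => if Nat.leb A n then (P (level A n) z / Q (level A n) z)%C else (RtoC 0 / RtoC 1)%C).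
  assert (Er : forall n z, (A <= n)%nat -> r n z = (P (level A n) z / Q (level A n) z)%C).
  { intros n z Hn. unfold r. rewrite (proj2 (Nat.leb_le A n) Hn). reflexivity. }
  exists r. split; [|split].
  - intros n _. destruct (Nat.le_gt_cases A n) as [Hn|Hn].
    + destruct (HPQ (level A n)) as [H1 [H2 H3]]. destruct (level_spec A n HA Hn) as [L1 _].
      apply (is_poly_le _ n) in H1; [|exact L1]. apply (is_poly_le _ n) in H2; [|exact L1].
      destruct H1 as [a Ha], H2 as [b Hb]. exists a, b. split.
      * intros z Hz. rewrite <- Hb. apply H3, Hz.
      * intros z. rewrite Er, Ha, Hb by exact Hn. reflexivity.
    + destruct (is_poly_le 0 n _ ltac:(lia) (is_poly_const (RtoC 0))) as [a Ha].
      destruct (is_poly_le 0 n _ ltac:(lia) (is_poly_const (RtoC 1))) as [b Hb].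
      exists a, b. split.
      * intros z _. rewrite <- Hb. apply RtoC_neq0. lra.
      * intros z. rewrite <- Ha, <- Hb. unfold r. rewrite (proj2 (Nat.leb_gt A n) Hn). reflexivity.
  - exists (c0 / sqrt (INR A)).
    assert (HsA : 0 < sqrt (INR A)) by (apply sqrt_lt_R0, HAr).
    split; [apply Rdiv_lt_0_compat; auto|].
    (* The factor exp (3 c0) pays for the loss of 3 in [level_spec]. *)
    exists (M * exp (3 * c0)), A. intros n Hn.
    destruct (level_spec A n HA Hn) as [_ [L2 _]].
    assert (B : forall z, region k w z ->
       Cmod (f z - r n z) <= M * exp (3 * c0) * exp (- (c0 / sqrt (INR A)) * sqrt (INR n))).
    { intros z Hz. apply (le_of_interior k w (fun z => f z - r n z)%C); auto.
      - apply ccont_plus; [apply continuous_on_ccont; auto|].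
        destruct (HPQ (level A n)) as [H1 [H2 H3]].
        apply (ccont_ext_loc _ (fun s => - RtoC 1 * (P (level A n) s * / Q (level A n) s))%C).
        + apply filter_forall. intros s. rewrite Er by exact Hn. unfold Cdiv. ring.
        + apply ccont_mult; [apply ccont_const|]. apply ccont_mult; [eapply cdiff_ccont, is_poly_cdiff, H1|].
          apply clim_inv; [apply H3, Hz|]. apply cdiff_ccont. eapply is_poly_cdiff, H2.
      - intros t Ht. rewrite Er by exact Hn. destruct (HPQ (level A n)) as [_ [_ H3]].
        rewrite <- (proj2 (H3 t (interior_sub _ _ Ht))).
        eapply Rle_trans; [apply Hbd, Ht|]. rewrite Rmult_assoc, <- exp_plus.
        apply Rmult_le_compat_l; [exact HM|].
        assert (L : - c0 * INR (level A n) <= 3 * c0 + - (c0 / sqrt (INR A)) * sqrt (INR n)).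
        { replace (3 * c0 + - (c0 / sqrt (INR A)) * sqrt (INR n))
            with (- c0 * (sqrt (INR n) / sqrt (INR A) - 3)) by (field; lra). nra. }
        apply exp_le, L. }
    destruct (sup_norm_le (region k w) (fun z => f z - r n z)%C
      (M * exp (3 * c0) * exp (- (c0 / sqrt (INR A)) * sqrt (INR n)))) as [s [Es Hs]]; auto.
    { apply Rmult_le_pos; [apply Rmult_le_pos; [exact HM|]|]; apply Rlt_le, exp_pos. }
    rewrite Es. simpl. rewrite (Rabs_right s), (Rabs_right (exp _)) by (try apply Rle_ge, Rlt_le, exp_pos; lra).
    apply Hs.
  - intros E HE HEin. destruct (compact_deep k w E hpoly HE HEin) as [d [Hd HdE]].
    destruct (Hdeep d Hd) as [c [M' [Hc [HM' HB]]]].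
    (* The error on [E] decays like exp (-2 c1 n), since m^2 >= n/(2A) - 2; half of this rate pays
       for the weight exp (c1 n), and the other half makes the limit superior 0. *)
    set (c1 := c / (4 * INR A)). assert (Hc1 : 0 < c1) by (apply Rdiv_lt_0_compat; lra).
    exists c1. split; [exact Hc1|].
    apply (Rbar_limsup_0 _ (M' * exp (2 * c)) c1 A Hc1).
    + intros n. pose proof (sup_norm_ge_0 E (fun z => f z - r n z)%C) as S0.
      pose proof (exp_pos (c1 * INR n)) as Ep.
      (* Nonnegativity is asked for every n, and finiteness of the norm is established only for n >=
         A, so an infinite value is treated as well. *)
      destruct (sup_norm E _) as [s| |]; simpl in S0.
      * simpl. apply Rmult_le_pos; lra.
      * unfold Rbar_mult, Rbar_mult'. destruct (Rle_dec 0 (exp (c1 * INR n))) as [H|H]; [|lra].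
        destruct (Rle_lt_or_eq_dec 0 (exp (c1 * INR n)) H); [exact I|lra].
      * contradiction.
    + intros n Hn. destruct (level_spec A n HA Hn) as [_ [_ L3]].
      destruct (sup_norm_le E (fun z => f z - r n z)%C (M' * exp (2 * c) * exp (- (2 * c1) * INR n)))
        as [s [Es Hs]].
      * apply Rmult_le_pos; [apply Rmult_le_pos; [exact HM'|]|]; apply Rlt_le, exp_pos.
      * intros z Hz. rewrite Er by exact Hn. destruct (HPQ (level A n)) as [_ [_ H3]].
        rewrite <- (proj2 (H3 z (interior_sub _ _ (HEin z Hz)))).
        eapply Rle_trans; [apply HB; auto|]. rewrite Rmult_assoc, <- exp_plus.
        apply Rmult_le_compat_l; [exact HM'|].
        assert (L : - c * INR (level A n * level A n) <= 2 * c + - (2 * c1) * INR n).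
        { replace (2 * c + - (2 * c1) * INR n) with (- c * (INR n / (2 * INR A) - 2))
            by (unfold c1; field; lra). nra. }
        apply exp_le, L.
      * rewrite Es. simpl.
        apply Rle_trans with (M' * exp (2 * c) * exp (- (2 * c1) * INR n) * exp (c1 * INR n)).
        -- apply Rmult_le_compat_r; [apply Rlt_le, exp_pos|apply Hs].
        -- rewrite Rmult_assoc, <- exp_plus. right. do 2 f_equal. ring.
Qed.
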